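(* Let $\rho:\Gamma\to\mathrm{PSL}_4(\mathbb{R})$ be a Hitchin representation with limit map $\xi_\rho=(\xi^1,\xi^2,\xi^3)$. A point $p\in\partial\Omega_\rho$ is a $C^1$ point of $\partial\Omega_\rho$ if and only if $p$ is not in the image of $\xi^1$. For any point $p\in\partial\Omega_\rho$ with $p\notin\mathrm{Im}(\xi^1)$, there is a neighborhood $U\subset\partial\Omega_\rho$ of $p$ that is contained in the boundary of a properly convex domain in $\mathbb{RP}^3$.
   Context: Let $S$ be a closed oriented surface of genus at least $2$, $\Gamma=\pi_1(S)$, and $\partial\Gamma$ the Gromov boundary of $\Gamma$, a topological circle with a natural $\Gamma$-action. $\mathcal{F}(\mathbb{R}^4)$ is the manifold of full flags $(V_1,V_2,V_3)$ in $\mathbb{R}^4$. Linear subspaces of $\mathbb{R}^4$ are identified with their projectivizations in $\mathbb{RP}^3$. A continuous map $\xi=(\xi^1,\xi^2,\xi^3):\partial\Gamma\to\mathcal{F}(\mathbb{R}^4)$ is a hyperconvex Frenet curve if, with $\xi^4:=\mathbb{R}^4$: (1) for all positive integers $k_1,\dots,k_j$ with $\sum k_l=p\le 4$ and distinct $x_1,\dots,x_j$, the sum $\xi^{k_1}(x_1)+\dots+\xi^{k_j}(x_j)$ is direct; (2) for such $k_1,\dots,k_j$, every $x$, and every sequence $(x_1^m,\dots,x_j^m)$ of $j$-tuples of distinct points converging to $(x,\dots,x)$, $\lim_{m\to\infty}\bigoplus_l\xi^{k_l}(x_l^m)=\xi^p(x)$. A representation $\rho:\Gamma\to\mathrm{PSL}_4(\mathbb{R})$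 is Hitchin if and only if there is a (necessarily unique) $\rho$-equivariant hyperconvex Frenet curve $\xi_\rho:\partial\Gamma\to\mathcal{F}(\mathbb{R}^4)$, its limit map; this is used as the definition. Put $\partial\Omega_\rho=\bigsqcup_{x\in\partial\Gamma}\xi^2(x)\subset\mathbb{RP}^3$. A point $p\in\partial\Omega_\rho$ is a $C^1$ point if $\partial\Omega_\rho$ is a $C^1$ embedded surface near $p$. A domain is properly convex if its closure is contained in an affine chart, in which it is convex. *)

(* Defs.v *)
From HB Require Import structures.
From mathcomp Require Import all_boot all_order all_algebra.
From mathcomp Require Import all_classical all_reals all_analysis.
From mathcomp Require Import lra.
Set Implicit Arguments.
Unset Strict Implicit.
Unset Printing Implicit Defensive.
Import Order.TTheory GRing.Theory Num.Theory.
Import numFieldNormedType.Exports.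
Local Open Scope classical_set_scope.
Local Open Scope ring_scope.

Section Surfaces.
Context {R : realType}.

Definition unit_circle : set (R * R) := [set z | z.1 ^+ 2 + z.2 ^+ 2 = 1].

Definition unit_disc : set (R * R) := [set z | z.1 ^+ 2 + z.2 ^+ 2 <= 1].

(* The unit circle is cut into 4g arcs, the sides of a 4g-gon; this is the
   point of parameter t in [0, 1] on the k-th side, counterclockwise. *)
Definition side (g k : nat) (t : R) : R * R :=
  let theta := 2 * pi * (k%:R + t) / (4 * g)%:R in (cos theta, sin theta).

(* The sides are labelled a_0 b_0 a_0^-1 b_0^-1 a_1 b_1 a_1^-1 b_1^-1 ... *)
Inductive side_pairing (g : nat) : R * R -> R * R -> Prop :=
| Pair_a j t : (j < g)%N -> 0 <= t <= 1 ->
    side_pairing g (side g (4 * j) t) (side g (4 * j + 2) (1 - t))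
| Pair_b j t : (j < g)%N -> 0 <= t <= 1 ->
    side_pairing g (side g (4 * j + 1) t) (side g (4 * j + 3) (1 - t))
| Pair_refl z : side_pairing g z z
| Pair_sym z w : side_pairing g z w -> side_pairing g w z
| Pair_trans z w y :
    side_pairing g z w -> side_pairing g w y -> side_pairing g z y.

(* S is homeomorphic to the closed disc with its sides glued by side_pairing:
   the disc is compact and S Hausdorff, so q is a quotient map. *)
Definition closed_oriented_surface (g : nat) (S : topologicalType) : Prop :=
  hausdorff_space S /\
  exists q : R * R -> S,
    [/\ {within unit_disc, continuous q},
        q @` unit_disc = setT &
        forall z w, unit_disc z -> unit_disc w ->
          (q z = q w <-> side_pairing g z w)].

(* Paths are functions on R of which only the values on [0, 1] matter. *)
Definition is_loop (S : topologicalType) (s0 : S) (f : R -> S) : Prop :=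
  [/\ {within `[0, 1], continuous f}, f 0 = s0 & f 1 = s0].

Definition loop_homotopic (S : topologicalType) (s0 : S) (f h : R -> S) :=
  exists H : R * R -> S,
    [/\ {within `[0, 1]%classic `*` `[0, 1]%classic, continuous H},
        forall t, 0 <= t <= 1 -> H (t, 0) = f t /\ H (t, 1) = h t &
        forall s, 0 <= s <= 1 -> H (0, s) = s0 /\ H (1, s) = s0].

Definition loop_concat (S : Type) (f h : R -> S) (t : R) : S :=
  if t <= 1 / 2 then f (2 * t) else h (2 * t - 1).

(* cl induces an isomorphism from pi_1(S, s0) onto G. *)
Definition is_fundamental_group (S : topologicalType) (s0 : S)
    (G : groupType) : Prop :=
  exists cl : (R -> S) -> G,
    [/\ forall f h, is_loop s0 f -> is_loop s0 h ->
          (cl f = cl h <-> loop_homotopic s0 f h),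
        forall x, exists2 f, is_loop s0 f & cl f = x &
        forall f h, is_loop s0 f -> is_loop s0 h ->
          cl (loop_concat f h) = (cl f * cl h)%g].

Definition is_topological_circle (B : topologicalType) : Prop :=
  exists f : B -> R * R,
    [/\ injective f, range f = unit_circle &
        forall O : set B,
          open O <-> exists2 W : set (R * R), open W & O = f @^-1` W].

End Surfaces.

Definition is_word (G : groupType) (s w : seq G) : Prop :=
  forall a, a \in w -> a \in s \/ (a^-1)%g \in s.

(* A group with a chosen finite generating set; for a hyperbolic group the
   Gromov boundary does not depend on this choice, up to canonical
   homeomorphism. *)
Record fgGroup := FgGroup {
  fg_group :> groupType;
  fg_gens : seq fg_group;
  fg_generated : forall x : fg_group,
    exists2 w, is_word fg_gens w & (\prod_(a <- w) a)%g = x }.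

Section GromovBoundary.
Context {G : fgGroup}.
Implicit Types (x y z : G) (u v : nat -> G).

Definition spelled_with (x : G) (n : nat) : Prop :=
  exists w : seq G,
    [/\ is_word (fg_gens G) w, size w = n & (\prod_(a <- w) a)%g = x].

Lemma spelled_ex (x : G) : exists n, `[< spelled_with x n >].
Proof.
by have [w ww wx] := fg_generated x; exists (size w); apply/asboolP; exists w.
Qed.

Definition word_length (x : G) : nat := ex_minn (spelled_ex x).

Definition gromov_product (x y : G) : rat :=
  ((word_length x)%:R + (word_length y)%:R
     - (word_length (x^-1 * y)%g)%:R) / 2.

Definition eventually_ge (N : nat) (u v : nat -> G) : Prop :=
  exists n0, forall i j, (n0 <= i)%N -> (n0 <= j)%N ->
    N%:R <= gromov_product (u i) (v j).

Definition asymptotic (u v : nat -> G) : Prop :=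
  forall N, eventually_ge N u v.

Definition gromov_sequence (u : nat -> G) : Prop := asymptotic u u.

(* For a hyperbolic group, asymptotic is an equivalence relation on Gromov
   sequences, and the points of the boundary are its classes. *)
Definition gromov_class (u : nat -> G) : set (nat -> G) :=
  [set v | gromov_sequence v /\ asymptotic u v].

Lemma word_lengthP x : spelled_with x (word_length x).
Proof. by rewrite /word_length; case: ex_minnP => n /asboolP. Qed.

Lemma word_length_le x n : spelled_with x n -> (word_length x <= n)%N.
Proof.
by move=> xn; rewrite /word_length; case: ex_minnP => m _; apply; apply/asboolP.
Qed.

Lemma word_lengthM x y : (word_length (x * y)%g <= word_length x + word_length y)%N.
Proof.
have [w [ww <- wx]] := word_lengthP x; have [w' [ww' <- wy]] := word_lengthP y.
apply: word_length_le; exists (w ++ w'); split; last by rewrite big_cat /= wx wy.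
- by move=> a; rewrite mem_cat => /orP[/ww|/ww'].
- by rewrite size_cat.
Qed.

Lemma gromov_product_mul (a x y : G) :
  gromov_product x y
    <= gromov_product (a * x)%g (a * y)%g + (word_length a^-1%g)%:R.
Proof.
rewrite /gromov_product.
have -> : ((a * x)^-1 * (a * y) = x^-1 * y)%g by rewrite invgM -mulgA mulKg.
have H z : (word_length z)%:R
    <= (word_length a^-1%g)%:R + (word_length (a * z)%g)%:R :> rat.
  by rewrite -natrD ler_nat -{1}(mulKg a z) word_lengthM.
have := H x; have := H y; lra.
Qed.

Lemma asymptotic_mul (a : G) u v :
  asymptotic u v -> asymptotic (fun i => a * u i)%g (fun i => a * v i)%g.
Proof.
move=> uv N; have [n0 Hn0] := uv (N + word_length a^-1%g)%N.
exists n0 => i j ni nj; have := Hn0 i j ni nj.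
have := gromov_product_mul a (u i) (v j); rewrite natrD; lra.
Qed.

End GromovBoundary.

Record gromov_boundary (G : fgGroup) := GromovBoundary {
  bd_class : set (nat -> G);
  bd_classP : exists2 u, gromov_sequence u & bd_class = gromov_class u }.

HB.instance Definition _ (G : fgGroup) :=
  gen_eqMixin (gromov_boundary G).
HB.instance Definition _ (G : fgGroup) :=
  gen_choiceMixin (gromov_boundary G).

(* y is in the N-th basic neighbourhood of x: for some representatives u of x
   and v of y, the liminf of the Gromov products (u_i | v_j) is at least N. *)
Definition bd_near (G : fgGroup) (N : nat) (x y : gromov_boundary G) : Prop :=
  exists u v, [/\ bd_class x u, bd_class y v & eventually_ge N u v].

Definition bd_open (G : fgGroup) (O : set (gromov_boundary G)) : Prop :=
  forall x, O x -> exists N, forall y, bd_near N x y -> O y.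

Section BoundaryTopology.
Variable G : fgGroup.

Lemma bd_near_le M N (x y : gromov_boundary G) :
  (M <= N)%N -> bd_near N x y -> bd_near M x y.
Proof.
move=> MN [u [v [xu yv [n0 H]]]]; exists u, v; split=> //; exists n0 => i j ni nj.
by apply: le_trans (H i j ni nj); rewrite ler_nat.
Qed.

Lemma bd_openT : bd_open [set: gromov_boundary G].
Proof. by move=> x _; exists 0%N. Qed.

Lemma bd_openI : setI_closed (@bd_open G).
Proof.
move=> A B oA oB x [/oA[M HM] /oB[N HN]]; exists (maxn M N) => y xy; split.
- by apply: HM; apply: bd_near_le xy; rewrite leq_maxl.
- by apply: HN; apply: bd_near_le xy; rewrite leq_maxr.
Qed.

Lemma bd_open_bigU (I : Type) (f : I -> set (gromov_boundary G)) :
  (forall i, bd_open (f i)) -> bd_open (\bigcup_i f i).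
Proof.
by move=> H x [i _ /H[N HN]]; exists N => y /HN fy; exists i.
Qed.

HB.instance Definition _ := isOpenTopological.Build (gromov_boundary G)
  bd_openT bd_openI bd_open_bigU.

Lemma bd_act_subproof (a : G) (x : gromov_boundary G) :
  exists2 u, gromov_sequence u &
    [set (fun i => a * v i)%g | v in bd_class x] = gromov_class u.
Proof.
case: x => _ /= [u gu ->]; exists (fun i => a * u i)%g; first exact: asymptotic_mul.
apply/seteqP; split=> [_ [v [gv uv] <-]|w [gw uw]].
  by split; apply: asymptotic_mul.
exists (fun i => a^-1 * w i)%g; last by apply/funext => i; rewrite mulVKg.
split; first exact: asymptotic_mul.
have := asymptotic_mul a^-1%g uw.
by under [X in asymptotic X _]eq_fun do rewrite mulKg.
Qed.

Definition bd_act (a : G) (x : gromov_boundary G) : gromov_boundary G :=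
  GromovBoundary (bd_act_subproof a x).

End BoundaryTopology.

(* The disjoint union over k of the Grassmannians Gr_k(R^n). *)
Definition grassmannian (R : realType) (n : nat) := {vspace 'cV[R]_n}.

HB.instance Definition _ (R : realType) (n : nat) :=
  Choice.on (grassmannian R n).

Definition colspan (R : realType) (n k : nat) (A : 'M[R]_(n, k)) :
  grassmannian R n := <<[seq col j A | j : 'I_k]>>%VS.

(* On Gr_k(R^n), this is the quotient topology of the space of n x k matrices
   of rank k. *)
Definition gr_open (R : realType) (n : nat) (O : set (grassmannian R n)) :=
  forall (k : nat) (A : 'M[R]_(n, k)),
    \dim (colspan A) = k -> O (colspan A) ->
    \forall B \near A, \dim (colspan B) = k -> O (colspan B).

Section GrassmannianTopology.
Variables (R : realType) (n : nat).

Lemma gr_openT : gr_open [set: grassmannian R n].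
Proof. by move=> k A _ _; apply: filterS filterT. Qed.

Lemma gr_openI : setI_closed (@gr_open R n).
Proof.
move=> O P oO oP k A dA [OA PA].
by apply: filterS2 (oO k A dA OA) (oP k A dA PA) => B HO HP dB; split; auto.
Qed.

Lemma gr_open_bigU (I : Type) (f : I -> set (grassmannian R n)) :
  (forall i, gr_open (f i)) -> gr_open (\bigcup_i f i).
Proof.
move=> H k A dA [i _ fA]; apply: filterS (H i k A dA fA) => B HB dB.
by exists i => //; exact: HB.
Qed.

HB.instance Definition _ := isOpenTopological.Build (grassmannian R n)
  gr_openT gr_openI gr_open_bigU.

End GrassmannianTopology.

Section Projective.
Context {R : realType}.
Local Notation Gr := (grassmannian R 4).

(* Points of RP^3 are the lines of R^4; RP^3 is open and closed in Gr, so
   open, closure, interior and connected have their usual meaning on subsets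
   of RP^3. *)
Definition RP3 : set Gr := [set L | \dim L = 1%N].

Definition projectivization (V : Gr) : set Gr :=
  [set L | RP3 L /\ (L <= V)%VS].

Definition full_flags : set (Gr * Gr * Gr) :=
  [set f | let: (V1, V2, V3) := f in
    [/\ \dim V1 = 1%N, \dim V2 = 2%N, \dim V3 = 3%N,
        (V1 <= V2)%VS & (V2 <= V3)%VS]].

Definition mx_act (A : 'M[R]_4) (V : Gr) : Gr := (linfun (mulmx A) @: V)%VS.

Definition flag_act (A : 'M[R]_4) (f : Gr * Gr * Gr) : Gr * Gr * Gr :=
  let: (V1, V2, V3) := f in (mx_act A V1, mx_act A V2, mx_act A V3).

(* Elements of PSL_4(R) are the cosets {A, -A} with det A = 1. *)
Definition PSL4 : set (set 'M[R]_4) :=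
  [set P | exists2 A, \det A = 1 & P = [set A; - A]].

Definition is_representation (G : groupType) (rho : G -> set 'M[R]_4) : Prop :=
  (forall x, PSL4 (rho x)) /\
  (forall x y, rho (x * y)%g = [set A *m B | A in rho x & B in rho y]).

(* xi^k, with xi^4 = R^4 (and xi^0 = 0, which is not used). *)
Definition curve_part (B : Type) (xi : B -> Gr * Gr * Gr) (k : nat) (x : B) :
    Gr :=
  match k with
  | 0 => 0%VS
  | 1 => (xi x).1.1
  | 2 => (xi x).1.2
  | 3 => (xi x).2
  | _ => fullv
  end.

Definition hyperconvex_frenet (B : topologicalType) (xi : B -> Gr * Gr * Gr) :
    Prop :=
  [/\ forall x, full_flags (xi x),
      continuous xi,
      forall (j : nat) (k : 'I_j -> nat) (x : 'I_j -> B),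
        (0 < j)%N -> (forall l, 0 < k l)%N -> (\sum_l k l <= 4)%N ->
        injective x ->
        directv (\sum_l curve_part xi (k l) (x l))%VS &
      forall (j : nat) (k : 'I_j -> nat) (x : B) (xs : nat -> 'I_j -> B),
        (0 < j)%N -> (forall l, 0 < k l)%N -> (\sum_l k l <= 4)%N ->
        (forall m, injective (xs m)) ->
        (forall l, xs m l @[m --> \oo] --> x) ->
        ((\sum_l curve_part xi (k l) (xs m l))%VS : Gr) @[m --> \oo]
          --> curve_part xi (\sum_l k l) x].

Definition equivariant (G : fgGroup) (rho : G -> set 'M[R]_4)
    (xi : gromov_boundary G -> Gr * Gr * Gr) : Prop :=
  forall (a : G) (A : 'M[R]_4) (x : gromov_boundary G),
    rho a A -> xi (bd_act a x) = flag_act A (xi x).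

Definition is_limit_map (G : fgGroup) (rho : G -> set 'M[R]_4)
    (xi : gromov_boundary G -> Gr * Gr * Gr) : Prop :=
  equivariant rho xi /\ hyperconvex_frenet xi.

Definition hitchin (G : fgGroup) (rho : G -> set 'M[R]_4) : Prop :=
  is_representation rho /\ exists xi, is_limit_map rho xi.

Definition dOmega (B : Type) (xi : B -> Gr * Gr * Gr) : set Gr :=
  \bigcup_x projectivization (curve_part xi 2 x).

(* For invertible g, a parametrization by R^3 of the complement in RP^3 of
   a plane. *)
Definition affine_chart (g : 'M[R]_4) (v : 'cV[R]_3) : Gr :=
  <[g *m (col_mx (const_mx 1 : 'cV[R]_1) v : 'cV[R]_4)]>%VS.

Definition C1_on (V : set 'cV[R]_2) (f : 'cV[R]_2 -> 'cV[R]_3) : Prop :=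
  forall s, V s -> differentiable f s /\
    forall h, {for s, continuous (fun s' => 'd f s' h)}.

(* Near q, M is the image of a C^1 immersion that is a homeomorphism onto its
   image. *)
Definition C1_surface_at (M : set 'cV[R]_3) (q : 'cV[R]_3) : Prop :=
  exists (U : set 'cV[R]_3) (V : set 'cV[R]_2) (f : 'cV[R]_2 -> 'cV[R]_3),
    [/\ open U /\ U q, open V, C1_on V f,
        forall s, V s -> injective ('d f s) &
        [/\ set_inj V f, f @` V = M `&` U &
            forall W, open W -> W `<=` V ->
              exists2 W', open W' & f @` W = f @` V `&` W']].

Definition C1_point (M : set Gr) (p : Gr) : Prop :=
  exists (g : 'M[R]_4) (q : 'cV[R]_3),
    [/\ g \in unitmx, p = affine_chart g q &
        C1_surface_at (affine_chart g @^-1` M) q].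

Definition domain (D : set Gr) : Prop :=
  [/\ D `<=` RP3, open D, D !=set0 & connected D].

Definition properly_convex (D : set Gr) : Prop :=
  exists g : 'M[R]_4,
    [/\ g \in unitmx, closure D `<=` range (affine_chart g) &
        convex_set (affine_chart g @^-1` D)].

Definition boundary (D : set Gr) : set Gr := closure D `\` D°.

End Projective.

(* Main.v *)
(* Only the Frenet curve matters, not the representation.  Fix [z] on the circle and
   coordinates adapted to the flag at [z].  Away from [z] the curve is (1, X, f, g), with
   tangent vector (0, 1, m, n) and osculating vector (0, 0, 1, G), all continuous in the
   parameter.  Hyperconvexity makes (X, f) a convex curve and the ratios of second
   differences of [g] and [f] monotone, so that [g - G x * f] is convex to the right of
   [x] and concave to its left.  Hence near a point off [xi^1] the osculating planes
   support the ruled surface: it is the graph of an upper envelope of affine functions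
   whose gradients vary continuously, so it is C^1, and the region above this graph in a
   small box is convex.
     At [xi^1 x0], since the tangent lines of (X, f) lie below this curve, the tangent
   plane of a C^1 surface would have to be [xi^2 x0 + xi^1 z], for every [z] other than
   [x0], which is absurd. *)
Require Import Defs.
From HB Require Import structures.
From mathcomp Require Import all_boot all_order all_algebra.
From mathcomp Require Import all_classical all_reals all_analysis.
From mathcomp Require Import ring lra.
Import Order.TTheory GRing.Theory Num.Theory.
Import numFieldNormedType.Exports.
Local Open Scope classical_set_scope.
Local Open Scope ring_scope.
Set Implicit Arguments.
Unset Strict Implicit.
Unset Printing Implicit Defensive.

(** * Convex curves and their osculating flags *)

(** The obstacle is that the Frenet condition provides no derivatives in the parameter: tangents are
    only limits of chords, and [G] is only a limit of ratios of second differences. Convexity is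
    therefore expressed by signs of determinants. Each of these is non-zero on distinct parameters
    because certain subspaces of total dimension 4 span R^4, so it has a constant sign on increasing
    tuples; the sign is then corrected by reversing the parameter or changing the sign of a
    coordinate. The quantitative core is [gap_bound]: it puts the osculating plane at [x] below the
    tangent line at [y] over every abscissa [u] with [u - X y > |X y - X x|]. A point off [xi^1] is
    at a positive distance from the contact point of its tangent line, so this covers all nearby
    parameters, provided that the coordinates are oriented so that the point lies on the side of
    larger [X]. The base point must also keep the given point off the plane at infinity, and remote
    parts of the surface must stay away from it; the latter follows from disjointness of tangent
    lines and compactness of the circle. *)

Section ConvexCurves.
Context {R : realType}.
Implicit Types (X h f g m n G : R -> R) (x y t a b c d l : R).

Lemma cvg_eq1 (T : Type) (U : topologicalType) (F : set_system T)
  (u v : T -> U) (l : U) : u =1 v -> u @ F --> l -> v @ F --> l.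
Proof. by move=> /funext ->. Qed.

(* Twice the signed area of the triangle with vertices [(X a, h a)], [(X b, h b)],
   [(X c, h c)]. *)
Definition area X h a b c :=
  (X b - X a) * (h c - h a) - (X c - X a) * (h b - h a).

Definition slope X h a b := (h b - h a) / (X b - X a).

(** The derivative of [h] with respect to [X], not to the parameter; it is sequential because the
    Frenet condition speaks of sequences. *)
Definition tangent X h x l := forall u : nat -> R,
  (forall k, u k != x) -> u @ \oo --> x ->
  slope X h x (u k) @[k --> \oo] --> l.

Definition incr X := forall x y, x < y -> X x < X y.

Lemma slopeC X h a b : slope X h a b = slope X h b a.
Proof. by rewrite /slope -(opprB (h a)) -(opprB (X a)) mulNr invrN mulrN opprK. Qed.

Lemma area_slopel X h a b c : incr X -> a < b -> b < c ->
  area X h a b c = (X b - X a) * (X c - X a) * (slope X h a c - slope X h a b).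
Proof.
move=> Xi ab bc; have Xab := Xi _ _ ab; have Xbc := Xi _ _ bc.
rewrite /area /slope; field; lra.
Qed.

Lemma area_sloper X h a b c : incr X -> a < b -> b < c ->
  area X h a b c = (X c - X b) * (X c - X a) * (slope X h b c - slope X h a c).
Proof.
move=> Xi ab bc; have Xab := Xi _ _ ab; have Xbc := Xi _ _ bc.
rewrite /area /slope; field; lra.
Qed.

(** The denominator [k.+2] exceeds 1 already at [k = 0], so that for [x != y] every term lies
    strictly between the two. *)
Definition approach x y (k : nat) := x + (y - x) / k.+2%:R.

Lemma approach_cvg x y : approach x y @ \oo --> x.
Proof.
rewrite /approach -[X in _ --> X]addr0; apply: cvgD; first exact: cvg_cst.
rewrite -[X in _ --> X](mulr0 (y - x)); apply: cvgM; first exact: cvg_cst.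
have -> : (fun k : nat => k.+2%:R^-1 : R) = (fun k => harmonic (k + 1)%N).
  by apply/funext => k; rewrite /harmonic /= addn1.
by have /cvgP := @cvg_harmonic R; have := @cvg_harmonic R; rewrite cvg_shiftn.
Qed.

Lemma approach_between x y k : x < y -> x < approach x y k < y.
Proof.
move=> xy; rewrite /approach; have k2 : (1 : R) < k.+2%:R by rewrite ltr1n.
have H : 0 < (k.+2%:R : R) by lra.
rewrite ltrDl divr_gt0 ?subr_gt0 //=.
by rewrite -ltrBrDl ltr_pdivrMr // ltr_pMr ?subr_gt0.
Qed.

Lemma approach_between_gt x y k : y < x -> y < approach x y k < x.
Proof.
move=> yx; rewrite /approach; have k2 : (1 : R) < k.+2%:R by rewrite ltr1n.
have H : 0 < (k.+2%:R : R) by lra.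
rewrite gtrDl pmulr_llt0 ?invr_gt0 // subr_lt0 yx andbT.
by rewrite -ltrBlDl ltr_pdivlMr // gtr_nMr ?subr_lt0.
Qed.

Lemma tangent_le X h x l y : tangent X h x l -> x != y ->
  (forall a, x < a < y \/ y < a < x -> slope X h x a <= slope X h x y) ->
  l <= slope X h x y.
Proof.
move=> th xy H.
have Hb k : x < approach x y k < y \/ y < approach x y k < x.
  have [yx|{}xy|E] := ltgtP y x; last by rewrite E eqxx in xy.
    by right; exact: approach_between_gt.
  by left; exact: approach_between.
have Hx k : approach x y k != x.
  by apply/eqP => E; case: (Hb k) => /andP[]; rewrite E ltxx.
apply: cvgr_to_le (th _ Hx (@approach_cvg x y)) _.
by near=> k; exact: H.
Unshelve. all: by end_near. Qed.

Lemma tangentN X h x l : tangent X h x l -> tangent X (fun t => - h t) x (- l).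
Proof.
move=> th u ux uc; apply: cvg_eq1 (cvgN (th u ux uc)) => k.
by rewrite /slope /= -mulNr opprD !opprK.
Qed.

Lemma tangent_lincomb X h k x l l' c : tangent X h x l -> tangent X k x l' ->
  tangent X (fun t => h t - c * k t) x (l - c * l').
Proof.
move=> th tk u ux uc.
apply: cvg_eq1 (cvgB (th u ux uc) (cvgM (cvg_cst c) (tk u ux uc))) => i.
by rewrite /slope !fctE /=; set d := (_ - _)^-1; ring.
Qed.

Lemma slopeN X h a b : slope X (fun t => - h t) a b = - slope X h a b.
Proof. by rewrite /slope -mulNr opprD !opprK. Qed.

(** Slopes from [x] to intermediate points are at most the slope of the whole chord, and [l] is a
    limit of them; reading [-h] from [y] gives the other half. Convexity is asked between [x] and
    [y] only, since it will be known on one side of a point only. *)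
Lemma convex_tangents X h x y l l' : incr X -> x < y ->
  (forall a b c, x <= a -> a < b -> b < c -> c <= y -> 0 <= area X h a b c) ->
  tangent X h x l -> tangent X h y l' -> l <= slope X h x y <= l'.
Proof.
move=> Xi xy conv tx ty; apply/andP; split.
  apply: (tangent_le tx); first by rewrite lt_eqF.
  move=> a [/andP[xa ay]|/andP[ya ax]]; last lra.
  have := conv x a y (lexx x) xa ay (lexx y).
  rewrite area_slopel // pmulr_rge0 ?subr_ge0 //.
  by rewrite mulr_gt0 // subr_gt0 Xi.
rewrite -lerN2 slopeC -slopeN; apply: (tangent_le (tangentN ty)).
  by rewrite gt_eqF.
move=> a [/andP[ya ax]|/andP[xa ay]]; first lra.
have := conv x a y (lexx x) xa ay (lexx y).
rewrite area_sloper // pmulr_rge0 ?subr_ge0 //.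
  by rewrite !slopeN lerN2 (slopeC X h y x) (slopeC X h y a).
by rewrite mulr_gt0 // subr_gt0 Xi.
Qed.

(** Strictness comes from an intermediate [c]: the slope on [[x, y]] lies strictly between those on
    [[x, c]] and [[c, y]], to which the weak bounds apply. *)
Lemma convex_tangents_lt X h (h' : R -> R) x y : incr X -> x < y ->
  (forall a b c, a < b -> b < c -> 0 < area X h a b c) ->
  (forall t, tangent X h t (h' t)) -> h' x < slope X h x y < h' y.
Proof.
move=> Xi xy conv th.
have [c /andP[xc cy]] : exists c, x < c < y by exists ((x + y) / 2); lra.
have convw a b d : a < b -> b < d -> 0 <= area X h a b d.
  by move=> ab bd; exact/ltW/conv.
have /andP[H1 _] : h' x <= slope X h x c <= h' c.
  by apply: convex_tangents => // *; exact: convw.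
have /andP[_ H2] : h' c <= slope X h c y <= h' y.
  by apply: convex_tangents => // *; exact: convw.
have H := conv x c y xc cy.
have p : 0 < (X c - X x) * (X y - X x).
  by rewrite mulr_gt0 // subr_gt0 Xi // (lt_trans xc).
have q : 0 < (X y - X c) * (X y - X x).
  by rewrite mulr_gt0 // subr_gt0 Xi // (lt_trans xc).
have := H; rewrite area_slopel // pmulr_rgt0 // subr_gt0 => H3.
have := H; rewrite area_sloper // pmulr_rgt0 // subr_gt0 => H4.
by rewrite (le_lt_trans H1 H3) (lt_le_trans H4 H2).
Qed.

End ConvexCurves.

Section FrenetChart.
Context {R : realType}.
Variables X f g m n G : R -> R.

(* The curve with [xi^1 = <(1, X, f, g)>], [xi^2 = xi^1 + <(0, 1, m, n)>] and
   [xi^3 = xi^2 + <(0, 0, 1, G)>] in coordinates adapted to the flag at a base point. *)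
Record frenet_chart : Prop := FrenetChart {
  chart_incr : incr X;
  chart_contX : continuous X;
  chart_contf : continuous f;
  chart_contg : continuous g;
  chart_contm : continuous m;
  chart_contn : continuous n;
  chart_contG : continuous G;
  chart_convex : forall a b c, a < b -> b < c -> 0 < area X f a b c;
  chart_ratio : forall a b c d, a < b -> b < c -> c < d ->
    area X f b c d * area X g a b c < area X f a b c * area X g b c d;
  chart_tangentf : forall t, tangent X f t (m t);
  chart_tangentg : forall t, tangent X g t (n t);
  chart_osculating : forall x (u v w : nat -> R),
    (forall k, u k < v k < w k) -> u @ \oo --> x -> v @ \oo --> x ->
    w @ \oo --> x ->
    area X g (u k) (v k) (w k) / area X f (u k) (v k) (w k) @[k --> \oo]
      --> G x;
  chart_transverse : forall x y, x != y ->
    g y - g x - n x * (X y - X x)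
      != G x * (f y - f x - m x * (X y - X x)) }.

(* The values of the linear form with kernel [xi^3 x] at the vectors (1, X, f, g) and
   (0, 1, m, n) of parameter [y]. *)
Definition gap x y := g y - g x - n x * (X y - X x)
  - G x * (f y - f x - m x * (X y - X x)).

Definition dgap x y := n y - n x - G x * (m y - m x).

Hypothesis C : frenet_chart.

(** The number [s] for which [g - s * f] is affine in [X] at the three parameters. *)
Let r a b c := area X g a b c / area X f a b c.

Lemma ratio_incr a b c d : a < b -> b < c -> c < d -> r a b c < r b c d.
Proof.
move=> ab bc cd; have p1 := chart_convex C ab bc; have p2 := chart_convex C bc cd.
by rewrite /r ltr_pdivrMr // mulrAC ltr_pdivlMr // mulrC [ltRHS]mulrC
  chart_ratio.
Qed.

Lemma ratio_incr3 a b c x y z : a < b -> b < c -> c < x -> x < y -> y < z ->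
  r a b c < r x y z.
Proof.
move=> ab bc cx xy yz; apply: lt_trans (ratio_incr ab bc cx) _.
by apply: lt_trans (ratio_incr bc cx xy) (ratio_incr cx xy yz).
Qed.

Lemma approach_lt (x y y' : R) k : y < y' -> approach x y k < approach x y' k.
Proof. by move=> yy; rewrite /approach ltrD2l ltr_pM2r ?invr_gt0 // ltrD2r. Qed.

(** [G x] is a limit of ratios of triples tending to [x] from the left, and these stay below the
    ratio of any triple to the right. The offsets 3, 2, 1 only order the triple. *)
Lemma osculating_le x a b c : x <= a -> a < b -> b < c -> G x <= r a b c.
Proof.
move=> xa ab bc.
have H k : approach x (x - 3) k < approach x (x - 2) k < approach x (x - 1) k.
  by apply/andP; split; apply: approach_lt; lra.
apply: cvgr_to_le (chart_osculating C H _ _ _) _; try exact: approach_cvg.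
apply: nearW => k; have /andP[H1 H2] := H k; apply/ltW/ratio_incr3 => //.
have : x - 1 < x by lra.
by move=> /(approach_between_gt k) /andP[_ /lt_le_trans]; apply.
Qed.

Lemma osculating_ge x a b c : a < b -> b < c -> c <= x -> r a b c <= G x.
Proof.
move=> ab bc cx.
have H k : approach x (x + 1) k < approach x (x + 2) k < approach x (x + 3) k.
  by apply/andP; split; apply: approach_lt; lra.
apply: cvgr_to_ge (chart_osculating C H _ _ _) _; try exact: approach_cvg.
apply: nearW => k; have /andP[H1 H2] := H k; apply/ltW/ratio_incr3 => //.
have : x < x + 1 by lra.
by move=> /(approach_between k) /andP[/(le_lt_trans cx)].
Qed.

Lemma area_lincomb s a b c :
  area X (fun t => g t - s * f t) a b c = area X g a b c - s * area X f a b c.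
Proof. by rewrite /area; ring. Qed.

Lemma areaN h a b c : area X (fun t => - h t) a b c = - area X h a b c.
Proof. by rewrite /area; ring. Qed.

(* [g - G x * f] is convex to the right of [x] and concave to its left. *)
Lemma gap_bound x y : x != y ->
  0 < dgap x y /\ `|gap x y| <= `|X y - X x| * dgap x y.
Proof.
move=> xy; pose e t := g t - G x * f t.
have te t : tangent X e t (n t - G x * m t).
  by apply: tangent_lincomb; [exact: chart_tangentg C t|exact: chart_tangentf C t].
have gap0 : gap x y != 0 by rewrite /gap subr_eq0 chart_transverse.
have Xi := chart_incr C.
pose s := slope X e x y.
have XX : X y - X x != 0.
  rewrite subr_eq0; move: xy; case: ltgtP => // /Xi H _; first by rewrite gt_eqF.
  by rewrite lt_eqF.
have gE : gap x y = (s - (n x - G x * m x)) * (X y - X x).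
  by rewrite /gap /s /slope /e; field.
suff: 0 <= (s - (n x - G x * m x)) <= dgap x y.
  move=> /andP[s0 s1].
  (* Transversality excludes a zero gap; this makes the lower bound strict and yields
     [0 < dgap x y]. *)
  have : s - (n x - G x * m x) != 0.
    by apply: contra gap0 => /eqP E; rewrite gE E mul0r.
  move: s0; rewrite le_eqVlt eq_sym => /orP[->//|s0] _.
  split; first exact: lt_le_trans s1.
  by rewrite gE normrM (gtr0_norm s0) mulrC ler_wpM2l.
have dgapE : dgap x y = (n y - G x * m y) - (n x - G x * m x).
  by rewrite /dgap; ring.
rewrite dgapE subr_ge0 lerD2r.
move: xy; case: (ltgtP x y) => // [xy|yx] _.
  apply: convex_tangents => // a b c xa ab bc cy.
  rewrite area_lincomb subr_ge0 -ler_pdivlMr ?(chart_convex C) //.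
  exact: osculating_le.
(* To the left of [x] it is [-e] that is convex, on [[y, x]]; the sign change swaps the two
   inequalities. *)
rewrite /s slopeC -[_ <= slope _ _ _ _]lerN2 -[slope _ _ _ _ <= _]lerN2 andbC.
rewrite -slopeN; apply: convex_tangents => // [a b c ya ab bc cx||].
- rewrite areaN area_lincomb opprB subr_ge0 -ler_pdivrMr ?(chart_convex C) //.
  exact: osculating_ge.
- exact: tangentN.
- exact: tangentN.
Qed.

Lemma chart_chord x y : x < y -> m x < slope X f x y < m y.
Proof.
move=> xy; apply: convex_tangents_lt => //; first exact: chart_incr.
- exact: chart_convex.
- exact: chart_tangentf.
Qed.

Lemma chart_m_incr : incr m.
Proof. by move=> x y /chart_chord /andP[]; exact: lt_trans. Qed.

Lemma chart_above_tangent x y : x != y -> f x + m x * (X y - X x) < f y.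
Proof.
rewrite neq_lt => /orP[] xy; have := chart_chord xy; have := chart_incr C xy.
  move=> Xxy /andP[+ _]; rewrite /slope ltr_pdivlMr ?subr_gt0 //; lra.
move=> Xxy /andP[_ +]; rewrite /slope ltr_pdivrMr ?subr_gt0 //; lra.
Qed.

End FrenetChart.

(** * Continuity of matrix operations, and C^1 graphs *)

Lemma cvg_mx (R : numFieldType) p q (T : Type) (F : set_system T)
    (FF : Filter F) (u : T -> 'M[R]_(p, q)) (A : 'M[R]_(p, q)) :
  (forall i j, u x i j @[x --> F] --> A i j) -> u @ F --> A.
Proof.
move=> uA B [P AP PB]; rewrite /nbhs /=.
apply: (@filterS _ F FF (fun x => forall i j, P i j (u x i j))).
  by move=> x H; exact: PB.
by apply: filter_forall => i; apply: filter_forall => j; exact: uA.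
Qed.

Lemma cvg_sum (R : numFieldType) (V : normedModType R) (I : Type) (r : seq I)
    (P : pred I) (T : Type) (F : set_system T) (FF : Filter F)
    (u : I -> T -> V) (a : I -> V) :
  (forall i, u i x @[x --> F] --> a i) ->
  (\sum_(i <- r | P i) u i x) @[x --> F] --> \sum_(i <- r | P i) a i.
Proof. by move=> ua; apply: cvg_big => //; exact: add_continuous. Qed.

Lemma cvg_prod (R : numFieldType) (I : Type) (r : seq I)
    (P : pred I) (T : Type) (F : set_system T) (FF : Filter F)
    (u : I -> T -> R) (a : I -> R) :
  (forall i, u i x @[x --> F] --> a i) ->
  (\prod_(i <- r | P i) u i x) @[x --> F] --> \prod_(i <- r | P i) a i.
Proof. by move=> ua; apply: cvg_big => //; exact: mul_continuous. Qed.

Lemma cvg_entry (R : numFieldType) p q (T : Type) (F : set_system T)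
    (FF : Filter F) (u : T -> 'M[R]_(p, q)) (A : 'M[R]_(p, q)) i j :
  u @ F --> A -> u x i j @[x --> F] --> A i j.
Proof. move=> uA.
by apply: (@cvg_comp _ _ _ u (fun B : 'M[R]_(p, q) => B i j) F _ _ uA);
  exact: coord_continuous. Qed.

Lemma cvg_mulmx (R : numFieldType) p q r (T : Type) (F : set_system T)
    (FF : Filter F) (u : T -> 'M[R]_(p, q)) (v : T -> 'M[R]_(q, r))
    (A : 'M[R]_(p, q)) (B : 'M[R]_(q, r)) :
  u @ F --> A -> v @ F --> B -> u x *m v x @[x --> F] --> A *m B.
Proof.
move=> uA vB; apply: cvg_mx => i j; rewrite mxE.
under eq_fun do rewrite mxE; apply: cvg_sum => k.
by apply: cvgM; exact: cvg_entry.
Qed.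

Lemma det_continuous (R : numFieldType) n : continuous (fun A : 'M[R]_n => \det A).
Proof.
move=> A; rewrite /determinant; apply: (@cvg_sum _ _ _ _ _ _ (nbhs A)) => s.
apply: cvgM; first exact: cvg_cst.
by apply: cvg_prod => i; exact: coord_continuous.
Qed.

Lemma entry_le_norm (R : realType) p q (A : 'M[R]_(p.+1, q.+1)) i j :
  `|A i j| <= `|A|.
Proof.
rewrite -[leRHS]/(mx_norm A) mx_normrE.
exact: (le_bigmax _ (fun k : 'I_p.+1 * 'I_q.+1 => `|A k.1 k.2|) (i, j)).
Qed.

Lemma mx_norm_le (R : realType) p q (A : 'M[R]_(p.+1, q.+1)) e :
  0 <= e -> (forall i j, `|A i j| <= e) -> `|A| <= e.
Proof.
move=> e0 Ae; rewrite -[leLHS]/(mx_norm A) mx_normrE; apply/bigmax_leP.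
by split => // -[i j] _; exact: Ae.
Qed.

Lemma cvg_addl (R : numFieldType) (V : normedModType R) (w : V) :
  w + v @[v --> 0] --> w.
Proof.
have H : continuous (fun v : V => w + v).
  by move=> v; apply: cvgD; [exact: cvg_cst|exact: cvg_id].
by have := H 0; rewrite /continuous_at addr0.
Qed.

Section Vectors.
Context {R : realType}.

Definition vec2 (a b : R) : 'cV[R]_2 := \col_i [:: a; b]`_i.
Definition vec3 (a b c : R) : 'cV[R]_3 := \col_i [:: a; b; c]`_i.
Definition vec4 (a b c d : R) : 'cV[R]_4 := \col_i [:: a; b; c; d]`_i.

Lemma vec2_eta (v : 'cV[R]_2) : v = vec2 (v 0 0) (v 1 0).
Proof.
by apply/colP => -[[|[|//]] i]; rewrite mxE /=; congr (v _ _); exact: val_inj.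
Qed.

Lemma vec3_eta (v : 'cV[R]_3) : v = vec3 (v 0 0) (v 1 0) (v 2 0).
Proof.
by apply/colP => -[[|[|[|//]]] i]; rewrite mxE /=; congr (v _ _); exact: val_inj.
Qed.

Lemma vec4_eta (v : 'cV[R]_4) : v = vec4 (v 0 0) (v 1 0) (v 2 0) (v 3 0).
Proof.
by apply/colP => -[[|[|[|[|//]]]] i]; rewrite mxE /=; congr (v _ _); exact: val_inj.
Qed.

Lemma cvg_vec2 (T : Type) (F : set_system T) (FF : Filter F) (u v : T -> R) a b :
  u @ F --> a -> v @ F --> b -> vec2 (u x) (v x) @[x --> F] --> vec2 a b.
Proof.
move=> ua vb; apply: cvg_mx => -[[|[|//]] i] j; rewrite !mxE /=;
  by under eq_fun do rewrite mxE.
Qed.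

Lemma cvg_vec3 (T : Type) (F : set_system T) (FF : Filter F) (u v w : T -> R) a b c :
  u @ F --> a -> v @ F --> b -> w @ F --> c ->
  vec3 (u x) (v x) (w x) @[x --> F] --> vec3 a b c.
Proof.
move=> ua vb wc; apply: cvg_mx => -[[|[|[|//]]] i] j; rewrite !mxE /=;
  by under eq_fun do rewrite mxE.
Qed.

End Vectors.

(** * Functions with a continuous field of subgradients are C^1 *)

Section C1Graph.
Context {R : realType}.
Variables (V : set 'cV[R]_2) (h k0 k1 : 'cV[R]_2 -> R).
Hypotheses (oV : open V)
  (k0c : forall w, V w -> {for w, continuous k0})
  (k1c : forall w, V w -> {for w, continuous k1})
  (subgrad : forall w w', V w -> V w' ->
     k0 w * (w' 0 0 - w 0 0) + k1 w * (w' 1 0 - w 1 0) <= h w' - h w).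

Definition graph_map (w : 'cV[R]_2) : 'cV[R]_3 := vec3 (w 0 0) (w 1 0) (h w).

Definition graph_jacobian (w : 'cV[R]_2) : 'M[R]_(3, 2) :=
  \matrix_(i, j) (nth [::] [:: [:: 1; 0]; [:: 0; 1]; [:: k0 w; k1 w]] i)`_j.

Lemma graph_jacobianE w v :
  graph_jacobian w *m v = vec3 (v 0 0) (v 1 0) (k0 w * v 0 0 + k1 w * v 1 0).
Proof.
have -> : v = vec2 (v 0 0) (v 1 0) by exact: vec2_eta.
apply/colP => -[[|[|[|//]]] i]; rewrite !mxE !big_ord_recl big_ord0 /= !mxE /=;
  by rewrite ?mul1r ?mul0r ?addr0 ?add0r.
Qed.

(* Comparing the subgradient inequalities at [w] and at [w + v] traps the
   remainder between [0] and [(k (w + v) - k w) . v]. *)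
Lemma graph_diff_near w (e : R) : V w -> 0 < e ->
  \forall v \near (0 : 'cV[R]_2),
    `|graph_map (w + v) - graph_map w - graph_jacobian w *m v| <= e * `|v|.
Proof.
move=> Vw e0; have e20 : 0 < e / 2 by lra.
have addc : w + v @[v --> (0 : 'cV[R]_2)] --> w.
  exact: cvg_addl.
have nV : \forall v \near (0 : 'cV[R]_2), V (w + v).
  by apply: addc; exact: open_nbhs_nbhs.
have n0 : \forall v \near (0 : 'cV[R]_2), `|k0 (w + v) - k0 w| < e / 2.
  have : k0 (w + v) @[v --> (0 : 'cV[R]_2)] --> k0 w.
    by apply: cvg_comp addc _; exact: k0c.
  by move=> /cvgr_dist_lt /(_ _ e20); apply: filterS => v; rewrite distrC.
have n1 : \forall v \near (0 : 'cV[R]_2), `|k1 (w + v) - k1 w| < e / 2.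
  have : k1 (w + v) @[v --> (0 : 'cV[R]_2)] --> k1 w.
    by apply: cvg_comp addc _; exact: k1c.
  by move=> /cvgr_dist_lt /(_ _ e20); apply: filterS => v; rewrite distrC.
near=> v.
have Vv : V (w + v) by near: v.
have H0 : `|k0 (w + v) - k0 w| < e / 2 by near: v.
have H1 : `|k1 (w + v) - k1 w| < e / 2 by near: v.
have v0 := entry_le_norm v 0 0; have v1 := entry_le_norm v 1 0.
have ev0 : 0 <= e * `|v| by rewrite mulr_ge0 // ltW.
apply: mx_norm_le => // i j; rewrite graph_jacobianE.
have := subgrad Vv Vw; have := subgrad Vw Vv.
rewrite !mxE => S1 S2.
have T0 : `|(k0 (w + v) - k0 w) * v 0 0| <= e / 2 * `|v|.
  by rewrite normrM ler_pM // ltW.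
have T1 : `|(k1 (w + v) - k1 w) * v 1 0| <= e / 2 * `|v|.
  by rewrite normrM ler_pM // ltW.
move: T0 T1; rewrite !ler_norml => /andP[T0 T0'] /andP[T1 T1'].
case: i => -[|[|[|//]]] i /=; last by apply/andP; split; lra.
- by rewrite [w 0 0 + _]addrC addrK subrr; apply/andP; split; lra.
- by rewrite [w 1 0 + _]addrC addrK subrr; apply/andP; split; lra.
Unshelve. all: by end_near. Qed.

Lemma graph_is_diff w : V w ->
  differentiable graph_map w /\
  'd graph_map w = mulmx (graph_jacobian w) :> ('cV[R]_2 -> 'cV[R]_3).
Proof.
move=> Vw.
have cJ : continuous (mulmx (graph_jacobian w) : 'cV[R]_2 -> 'cV[R]_3).
  move=> v; apply: (@cvg_mulmx _ _ _ _ _ (nbhs v) _ (fun=> graph_jacobian w) id).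
    exact: cvg_cst.
  exact: cvg_id.
have E : graph_map \o shift w =
    cst (graph_map w) + (mulmx (graph_jacobian w) : 'cV[R]_2 -> 'cV[R]_3) +o_ (0 : 'cV[R]_2) id.
  apply/eqaddoP => e e0; near=> v.
  suff: `|graph_map (w + v) - graph_map w - graph_jacobian w *m v| <= e * `|v|.
    by rewrite !fctE /= opprD addrA [v + w]addrC.
  by near: v; exact: graph_diff_near.
have dE := diff_unique cJ E.
by split=> //; apply/diff_locallyP; rewrite dE; split.
Unshelve. all: by end_near. Qed.

Lemma graph_jacobian_inj w : injective (mulmx (graph_jacobian w) : 'cV[R]_2 -> 'cV[R]_3).
Proof.
move=> u v; rewrite !graph_jacobianE => /colP E.
rewrite (vec2_eta u) (vec2_eta v); have := E 0; have := E 1.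
by rewrite !mxE /= => -> ->.
Qed.

Lemma graph_C1 : C1_on V graph_map.
Proof.
move=> w Vw; split; first by case: (graph_is_diff Vw).
move=> v.
have dE u : V u -> 'd graph_map u v = graph_jacobian u *m v.
  by move=> Vu; rewrite (graph_is_diff Vu).2.
suff H : graph_jacobian u *m v @[u --> w] --> 'd graph_map w v.
  have Hn : \forall u \near w, graph_jacobian u *m v = 'd graph_map u v.
    have : nbhs w V by exact: open_nbhs_nbhs.
    by apply: filterS => u Vu; rewrite dE.
  exact: cvg_trans (near_eq_cvg Hn) H.
rewrite dE //.
under eq_fun do rewrite graph_jacobianE; rewrite graph_jacobianE.
apply: (@cvg_vec3 _ _ (nbhs w)); try exact: cvg_cst.
apply: (@cvgD _ _ _ (nbhs w)); apply: (@cvgM _ _ (nbhs w)); try exact: cvg_cst.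
  exact: (k0c Vw).
exact: (k1c Vw).
Qed.

End C1Graph.

(** * The ruled surface near a point off the curve *)

Section Sheet.
Context {R : realType}.
Variables X f g m n G : R -> R.
Hypothesis C : frenet_chart X f g m n G.

(* In the affine chart, the tangent line at [y] is the graph of
   [u |-> (ruleY y u, ruleZ y u)] and the osculating plane at [x] that of [osc x]. *)
Definition ruleY y u := f y + (u - X y) * m y.
Definition ruleZ y u := g y + (u - X y) * n y.

Definition osc x u v :=
  g x + n x * (u - X x) + G x * (v - f x - m x * (u - X x)).

Lemma osc_rule x u : osc x u (ruleY x u) = ruleZ x u.
Proof. by rewrite /osc /ruleY /ruleZ; ring. Qed.

(** The point of abscissa [u] on the tangent line at [y] is (1, X, f, g) plus [u - X y] times (0, 1,
    m, n), and the form defining the osculating plane is linear. *)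
Lemma osc_gap x y u :
  ruleZ y u - osc x u (ruleY y u)
    = gap X f g m n G x y + (u - X y) * dgap m n G x y.
Proof. by rewrite /osc /ruleY /ruleZ /gap /dgap; ring. Qed.

(** By [gap_bound], a negative [gap x y] is outweighed by the term in [dgap x y] as soon as the
    distance to the contact point exceeds the variation of [X]. *)
Lemma osc_lt x y u : x != y -> `|X y - X x| < u - X y ->
  osc x u (ruleY y u) < ruleZ y u.
Proof.
move=> xy yu; rewrite -subr_gt0 osc_gap.
have [d0] := gap_bound C xy; rewrite ler_norml => /andP[gd _].
have : 0 < (u - X y - `|X y - X x|) * dgap m n G x y.
  by apply: mulr_gt0 => //; rewrite subr_gt0.
lra.
Qed.

Lemma ruleY_sub x y u : ruleY y u - ruleY x u =
  f y - f x - m x * (X y - X x) + (u - X y) * (m y - m x).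
Proof. by rewrite /ruleY; ring. Qed.

Lemma ruleY_lt x y u : x < y -> X y < u -> ruleY x u < ruleY y u.
Proof.
move=> xy yu; rewrite -subr_gt0 ruleY_sub.
have := @chart_above_tangent _ _ _ _ _ _ _ C x y; rewrite lt_eqF // => /(_ isT).
have : 0 < (u - X y) * (m y - m x).
  by rewrite mulr_gt0 // subr_gt0 // (chart_m_incr C).
lra.
Qed.

(** The tangent at [y] is below the convex curve at both ends of the chord, hence below the chord in
    between, wherever [y] is. *)
Lemma ruleY_chord x y t u : x < t -> X x <= u -> u <= X t ->
  ruleY y u <= f x + slope X f x t * (u - X x).
Proof.
move=> xt xu ut.
have T z : f y + m y * (X z - X y) <= f z.
  have [->|yz] := eqVneq y z; first by rewrite subrr mulr0 addr0.
  exact/ltW/(chart_above_tangent C).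
have Xt : 0 < X t - X x by rewrite subr_gt0 (chart_incr C).
have E : f x + slope X f x t * (u - X x) =
    ((X t - u) * f x + (u - X x) * f t) / (X t - X x).
  by rewrite /slope; field; lra.
rewrite E ler_pdivlMr //; have := T x; have := T t; rewrite /ruleY => Tt Tx.
have H1 : 0 <= (u - X x) * (f t - (f y + m y * (X t - X y))) by rewrite mulr_ge0; lra.
have H2 : 0 <= (X t - u) * (f x - (f y + m y * (X x - X y))) by rewrite mulr_ge0; lra.
lra.
Qed.

Lemma ruleY_cvg (T : Type) (F : set_system T) (FF : Filter F) (a b : T -> R) y u :
  a @ F --> y -> b @ F --> u -> ruleY (a t) (b t) @[t --> F] --> ruleY y u.
Proof.
move=> ay bu; apply: cvgD; first by apply: continuous_cvg ay; exact: (chart_contf C).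
apply: cvgM; last by apply: continuous_cvg ay; exact: (chart_contm C).
by apply: cvgB => //; apply: continuous_cvg ay; exact: (chart_contX C).
Qed.

Variables x0 b0 d : R.
Hypothesis small : forall t, `|t - x0| <= d -> `|X t - X x0| < b0 / 4.

Let range u := `|u - X x0 - b0| < b0 / 4.

(** Origin of the quarters: [X x] and [X y] differ by less than [b0 / 2], while [u - X y] exceeds
    [3 * b0 / 4 - b0 / 4]. *)
Lemma small_gap x y u : `|x - x0| <= d -> `|y - x0| <= d -> range u ->
  `|X y - X x| < u - X y.
Proof.
move=> /small + /small; rewrite /range !ltr_norml.
by move=> /andP[? ?] /andP[? ?] /andP[? ?]; apply/andP; split; lra.
Qed.

Lemma small_above y u : `|y - x0| <= d -> range u -> X y < u.
Proof.
move=> /small; rewrite /range !ltr_norml.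
by move=> /andP[? ?] /andP[? ?]; lra.
Qed.

Lemma sheet_osc_lt x y u : `|x - x0| <= d -> `|y - x0| <= d -> range u ->
  x != y -> osc x u (ruleY y u) < ruleZ y u.
Proof. by move=> xd yd ru xy; apply: osc_lt => //; exact: small_gap ru. Qed.

Lemma sheet_osc_le x y u : `|x - x0| <= d -> `|y - x0| <= d -> range u ->
  osc x u (ruleY y u) <= ruleZ y u.
Proof.
move=> xd yd ru; have [->|xy] := eqVneq x y; first by rewrite osc_rule.
exact/ltW/sheet_osc_lt.
Qed.

Lemma ruleY_inj x y u : `|x - x0| <= d -> `|y - x0| <= d -> range u ->
  ruleY x u = ruleY y u -> x = y.
Proof.
move=> xd yd ru E; case: (ltgtP x y) => // xy.
  by have := ruleY_lt xy (small_above yd ru); rewrite E ltxx.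
by have := ruleY_lt xy (small_above xd ru); rewrite E ltxx.
Qed.

Definition sheet_dom : set 'cV[R]_2 := [set w | range (w 0 0) /\
  exists2 y, `|y - x0| < d & ruleY y (w 0 0) = w 1 0].

(** On [sheet_dom] the choice is unambiguous by [ruleY_inj]; [x0] is the default when no parameter
    fits. *)
Definition sheet_param (w : 'cV[R]_2) : R :=
  xget x0 [set y | `|y - x0| < d /\ ruleY y (w 0 0) = w 1 0].

Lemma sheet_paramP w : sheet_dom w ->
  `|sheet_param w - x0| < d /\ ruleY (sheet_param w) (w 0 0) = w 1 0.
Proof.
move=> [_ [y yd yw]]; rewrite /sheet_param; case: xgetP => [z -> //|/(_ y)].
by case.
Qed.

Lemma sheet_paramE (w : 'cV[R]_2) y : range (w 0 0) -> `|y - x0| < d ->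
  ruleY y (w 0 0) = w 1 0 -> sheet_param w = y.
Proof.
move=> rw yd yw; have /sheet_paramP [sd sw] : sheet_dom w by split => //; exists y.
by apply: (@ruleY_inj _ _ (w 0 0)); rewrite ?ltW // sw.
Qed.

(** [ruleY] increases with the parameter, so the tangents at [y - k] and [y + k] pass strictly below
    and above [w], and still do so for points near [w]; the intermediate value theorem finds a
    tangent through such a point. Openness of the domain and continuity of the parameter come
    together. *)
Lemma sheet_param_near w (e : R) : sheet_dom w -> 0 < e ->
  \forall w' \near w, sheet_dom w' /\ `|sheet_param w' - sheet_param w| < e.
Proof.
move=> Dw e0; have [yd yw] := sheet_paramP Dw; set y := sheet_param w in yd yw *.
have [rw _] := Dw.
(* Half of the smaller margin, so that [k < e] and [y - k], [y + k] stay in the open window of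
   radius [d]. *)
pose k := Num.min e (d - `|y - x0|) / 2.
have k0 : 0 < k by rewrite divr_gt0 // lt_min e0 subr_gt0.
have ke : k < e by rewrite ltr_pdivrMr // gt_min (_ : e < e * 2) //; lra.
have kd z : `|z - y| <= k -> `|z - x0| < d.
  move=> zk; have : k < d - `|y - x0|.
    rewrite ltr_pdivrMr // gt_min; apply/orP; right.
    by have : 0 < d - `|y - x0|; [rewrite subr_gt0|lra].
  have : `|z - x0| <= `|z - y| + `|y - x0|.
    by rewrite (le_trans _ (ler_normD _ _)) // addrA subrK.
  lra.
have c00 : (fun w' : 'cV[R]_2 => w' 0 0) @ w --> w 0 0 by exact: coord_continuous.
have c10 : (fun w' : 'cV[R]_2 => w' 1 0) @ w --> w 1 0 by exact: coord_continuous.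
have cY z : (fun w' : 'cV[R]_2 => ruleY z (w' 0 0) - w' 1 0) @ w --> ruleY z (w 0 0) - w 1 0.
  apply: (@cvgB _ _ _ (nbhs w)) => //.
  by apply: (@ruleY_cvg _ (nbhs w)) => //; exact: cvg_cst.
have kk z : z = y - k \/ z = y + k -> `|z - y| <= k.
  by case=> ->; rewrite addrAC subrr add0r ?normrN gtr0_norm.
have up : 0 < ruleY (y + k) (w 0 0) - w 1 0.
  rewrite subr_gt0 -yw; apply: ruleY_lt; first lra.
  by apply: small_above => //; apply/ltW/kd/kk; right.
have dn : ruleY (y - k) (w 0 0) - w 1 0 < 0.
  rewrite subr_lt0 -yw; apply: ruleY_lt; first lra.
  by apply: small_above => //; exact: ltW.
have nr : \forall w' \near w, range ((w' : 'cV[R]_2) 0 0).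
  have H : (fun w' : 'cV[R]_2 => `|w' 0 0 - X x0 - b0|) @ w --> `|w 0 0 - X x0 - b0|.
    apply: (@cvg_norm _ _ _ (nbhs w)).
    apply: (@cvgB _ _ _ (nbhs w)); last exact: cvg_cst.
    by apply: (@cvgB _ _ _ (nbhs w)) => //; exact: cvg_cst.
  by move: H => /cvgr_lt; apply.
have nup : \forall w' \near w, 0 < ruleY (y + k) ((w' : 'cV[R]_2) 0 0) - w' 1 0.
  by move: (cY (y + k)) => /cvgr_gt; apply.
have ndn : \forall w' \near w, ruleY (y - k) ((w' : 'cV[R]_2) 0 0) - w' 1 0 < 0.
  by move: (cY (y - k)) => /cvgr_lt; apply.
apply: filterS3 nr nup ndn => w' rw' up' dn'.
have [z] : exists2 z, z \in `[y - k, y + k] & ruleY z (w' 0 0) = w' 1 0.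
  apply: IVT; first lra.
    apply: continuous_subspaceT => z.
    by apply: (@ruleY_cvg _ (nbhs z)); [exact: cvg_id|exact: cvg_cst].
  by rewrite ge_min le_max; apply/andP; split; apply/orP; [left|right]; lra.
rewrite in_itv /= => /andP[zl zr] zw'.
have zk : `|z - y| <= k by rewrite ler_norml; apply/andP; split; lra.
have E := sheet_paramE rw' (kd _ zk) zw'.
split; first by split => //; exists z => //; exact: kd.
by rewrite E (le_lt_trans zk).
Qed.

Lemma open_sheet_dom : open sheet_dom.
Proof.
rewrite openE => w Dw; rewrite /interior.
by apply: filterS (sheet_param_near Dw ltr01) => w' [].
Qed.

Lemma sheet_param_cont w : sheet_dom w -> {for w, continuous sheet_param}.
Proof.
move=> Dw; apply/(@cvgrPdist_lt _ _ _ (nbhs w)) => e e0.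
by apply: filterS (sheet_param_near Dw e0) => w' [_]; rewrite distrC.
Qed.

Definition sheet (w : 'cV[R]_2) : R := ruleZ (sheet_param w) (w 0 0).

(** The osculating plane at the parameter of [w] touches the graph at [w] and is nowhere above it;
    the coefficients are the two slopes of [osc]. *)
Lemma sheet_subgrad w w' : sheet_dom w -> sheet_dom w' ->
  (n (sheet_param w) - G (sheet_param w) * m (sheet_param w)) * (w' 0 0 - w 0 0)
    + G (sheet_param w) * (w' 1 0 - w 1 0) <= sheet w' - sheet w.
Proof.
move=> Dw Dw'; have [sd sw] := sheet_paramP Dw; have [sd' sw'] := sheet_paramP Dw'.
have := sheet_osc_le (ltW sd) (ltW sd') Dw'.1.
rewrite /sheet -[X in _ <= _ - X]osc_rule sw sw'.
rewrite /osc; lra.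
Qed.

Let slopeX x := n x - G x * m x.

Let slopeX_cont w : sheet_dom w -> {for w, continuous (slopeX \o sheet_param)}.
Proof.
move=> Dw; apply: continuous_comp; first exact: sheet_param_cont.
apply: (@cvgB _ _ _ (nbhs (sheet_param w))); first exact: chart_contn C _.
by apply: (@cvgM _ _ (nbhs (sheet_param w))); [exact: chart_contG C _|exact: chart_contm C _].
Qed.

Let slopeY_cont w : sheet_dom w -> {for w, continuous (G \o sheet_param)}.
Proof.
by move=> Dw; apply: continuous_comp; [exact: sheet_param_cont|exact: chart_contG C _].
Qed.

Lemma sheet_C1 : C1_on sheet_dom (graph_map sheet).
Proof.
exact: (@graph_C1 _ _ _ (slopeX \o sheet_param) (G \o sheet_param)
  open_sheet_dom slopeX_cont slopeY_cont sheet_subgrad).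
Qed.

Lemma sheet_diff_inj w : sheet_dom w -> injective ('d (graph_map sheet) w).
Proof.
move=> Dw; rewrite (graph_is_diff (k0 := slopeX \o sheet_param)
  (k1 := G \o sheet_param) open_sheet_dom slopeX_cont slopeY_cont sheet_subgrad Dw).2.
exact: graph_jacobian_inj.
Qed.

End Sheet.

(** * Topology of Grassmannians and affine charts *)

Section ColSpan.
Context {R : realType} {n : nat}.

Let cols k (B : 'M[R]_(n, k)) := [tuple col j B | j < k].

Lemma colspanE k (B : 'M[R]_(n, k)) : colspan B = <<cols B>>%VS.
Proof. by []. Qed.

Lemma mulmx_cols k (B : 'M[R]_(n, k)) (w : 'cV[R]_k) :
  B *m w = \sum_(j < k) w j 0 *: (cols B)`_j.
Proof.
apply/colP => i; rewrite mxE summxE; apply: eq_bigr => j _.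
by rewrite -tnth_nth tnth_mktuple !mxE mulrC.
Qed.

Lemma mem_colspan k (B : 'M[R]_(n, k)) v :
  (v \in colspan B) <-> exists w, v = B *m w.
Proof.
rewrite colspanE; split=> [/coord_span vB|[w ->]].
  exists (\col_j coord (cols B) j v); rewrite mulmx_cols {1}vB.
  by apply: eq_bigr => j _; rewrite mxE.
rewrite mulmx_cols; apply: memv_suml => j _; apply: memvZ; apply: memv_span.
by apply: mem_nth; rewrite size_tuple.
Qed.

Lemma dim_colspan k (B : 'M[R]_(n, k)) :
  \dim (colspan B) = k <-> forall w : 'cV_k, B *m w = 0 -> w = 0.
Proof.
have E : (\dim (colspan B) = k) <-> free (cols B).
  by rewrite /free size_tuple colspanE; split => /eqP.
rewrite E; split=> [/freeP H w Bw|H].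
  apply/colP => j; rewrite [RHS]mxE; apply: (H (fun j => w j 0)).
  by rewrite -mulmx_cols.
apply/freeP => c cB j; have : \col_j c j = 0 :> 'cV_k.
  by apply: H; rewrite mulmx_cols -[RHS]cB; apply: eq_bigr => i _; rewrite mxE.
by move=> /colP/(_ j); rewrite !mxE.
Qed.

Lemma dim_colspan_det k (B : 'M[R]_(n, k)) (P : 'M[R]_(k, n)) :
  \det (P *m B) != 0 -> \dim (colspan B) = k.
Proof.
move=> PB; apply/dim_colspan => w Bw.
have U : P *m B \in unitmx by rewrite unitmxE unitfE.
by rewrite -(mulKmx U w) -mulmxA Bw !mulmx0.
Qed.

Lemma colspan_sub k (B : 'M[R]_(n, k)) (V : grassmannian R n) :
  (forall w, B *m w \in V) -> (colspan B <= V)%VS.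
Proof. by move=> BV; apply/subvP => v /mem_colspan[w ->]. Qed.

Lemma colspan_eq k (B : 'M[R]_(n, k)) (V : grassmannian R n) :
  \dim (colspan B) = k -> \dim V = k -> (forall w, B *m w \in V) ->
  colspan B = V.
Proof.
by move=> dB dV BV; apply/eqP; rewrite eqEdim dB dV leqnn andbT colspan_sub.
Qed.

Lemma colspan_ex k (V : grassmannian R n) :
  \dim V = k -> exists B : 'M[R]_(n, k), colspan B = V.
Proof.
move=> <-; exists (\matrix_(i, j) (vbasis V)`_j i 0).
rewrite colspanE -[RHS](span_basis (vbasisP V)); congr (<<_>>%VS).
congr tval; apply: eq_from_tnth => j.
by rewrite tnth_mktuple; apply/colP => i; rewrite !mxE -tnth_nth.
Qed.

Lemma colspan_change k (B B' : 'M[R]_(n, k)) :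
  colspan B = colspan B' -> \dim (colspan B) = k ->
  exists2 C, C \in unitmx & B' = B *m C.
Proof.
have factor (D D' : 'M[R]_(n, k)) : colspan D = colspan D' -> exists C, D' = D *m C.
  move=> E; have /choice[c cE] j : exists w, col j D' = D *m w.
    apply/mem_colspan; rewrite E; apply/mem_colspan.
    by exists (delta_mx j 0); rewrite colE.
  exists (\matrix_(i, j) c j i 0); apply/matrixP => i j.
  have /colP/(_ i) := cE j; rewrite !mxE => ->.
  by apply: eq_bigr => l _; rewrite !mxE.
move=> E dB; have [C BC] := factor _ _ E; have [C' BC'] := factor _ _ (esym E).
exists C => //; suff /mulmx1_unit[] : C *m C' = 1%:M by [].
apply/matrixP => i j; apply/eqP; rewrite -subr_eq0; apply/eqP.
have /dim_colspan/(_ (col j (C *m C' - 1%:M))) := dB.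
rewrite colE mulmxA mulmxBr mulmx1 mulmxA -BC -BC' subrr mul0mx => /(_ erefl).
by move=> /colP/(_ i); rewrite -colE !mxE.
Qed.

Definition gr_basis k (V : grassmannian R n) : 'M[R]_(n, k) :=
  xget 0 [set B | colspan B = V].

Lemma gr_basisK k (V : grassmannian R n) : \dim V = k -> colspan (gr_basis k V) = V.
Proof.
move=> /colspan_ex[B BV]; apply: (@xgetPex _ 0 [set B' | colspan B' = V]).
by exists B.
Qed.

(* A ratio of Pluecker coordinates of [V], independent of the basis; it is meaningful
   only if [\dim V = k] and the denominator does not vanish. *)
Definition plucker k (P' P : 'M[R]_(k, n)) (V : grassmannian R n) : R :=
  \det (P' *m gr_basis k V) / \det (P *m gr_basis k V).

Lemma gr_basis_change k (B : 'M[R]_(n, k)) : \dim (colspan B) = k ->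
  exists2 C, C \in unitmx & gr_basis k (colspan B) = B *m C.
Proof. by move=> dB; apply: colspan_change => //; rewrite gr_basisK. Qed.

Lemma pluckerE k (P' P : 'M[R]_(k, n)) (B : 'M[R]_(n, k)) :
  \dim (colspan B) = k ->
  plucker P' P (colspan B) = \det (P' *m B) / \det (P *m B).
Proof.
move=> /gr_basis_change[C]; rewrite unitmxE unitfE => C0 E.
by rewrite /plucker E !mulmxA !det_mulmx -mulf_div divff // mulr1.
Qed.

(** The quotient map from full-rank matrices is open: two bases of a span differ by an invertible
    [C], and right multiplication by [C] is continuous. *)
Lemma nbhs_colspan k (B : 'M[R]_(n, k)) (S : set 'M[R]_(n, k)) :
  \dim (colspan B) = k -> nbhs B S -> nbhs (colspan B) (@colspan R n k @` S).
Proof.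
move=> dB; rewrite nbhsE => -[S0 [oS SB] S0S].
pose Q := [set U : grassmannian R n | exists2 D, \dim U = k /\ S0 D & colspan D = U].
have oQ : open Q.
  move=> l A dA [D [AD SD] DA].
  have kl : k = l by rewrite -dA -AD.
  subst l; have [C CU DE] := colspan_change (esym DA) dA.
  have H : (fun A' => A' *m C) @ A --> D.
    by rewrite DE; apply: (@cvg_mulmx _ _ _ _ _ (nbhs A)); [exact: cvg_id|exact: cvg_cst].
  have : nbhs D S0 by exact: open_nbhs_nbhs.
  move=> /H; apply: (@filterS _ (nbhs A)) => A' SA' dA'; exists (A' *m C) => //.
  apply: colspan_eq => //; last first.
    by move=> w; apply/mem_colspan; exists (C *m w); rewrite mulmxA.
  apply/dim_colspan => w; rewrite -mulmxA => Cw.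
  have Cw0 := (dim_colspan A').1 dA' _ Cw.
  by rewrite -(mulKmx CU w) Cw0 mulmx0.
have : nbhs (colspan B) Q by apply: open_nbhs_nbhs; split => //; exists B.
by apply: filterS => _ [D [_ SD] <-]; exists D => //; exact: S0S.
Qed.

Lemma plucker_continuous k (P' P : 'M[R]_(k, n)) (B : 'M[R]_(n, k)) :
  \det (P *m B) != 0 -> {for colspan B, continuous (plucker P' P)}.
Proof.
move=> PB; have dB := dim_colspan_det PB.
rewrite /prop_for /continuous_at pluckerE // => W WB.
have cdet (Q : 'M[R]_(k, n)) : (fun D => \det (Q *m D)) @ B --> \det (Q *m B).
  apply: (@continuous_cvg _ _ _ (nbhs B)); first exact: det_continuous.
  by apply: (@cvg_mulmx _ _ _ _ _ (nbhs B)); [exact: cvg_cst|exact: cvg_id].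
have nP : \forall D \near B, \det (P *m (D : 'M[R]_(n, k))) != 0.
  by move: (cdet P) => /cvgr_neq0; apply.
have nW : \forall D \near B, W (\det (P' *m (D : 'M[R]_(n, k))) / \det (P *m D)).
  have H : (fun D => \det (P' *m D) / \det (P *m D)) @ B -->
      \det (P' *m B) / \det (P *m B).
    by apply: (@cvgM _ _ (nbhs B)) => //; apply: (@cvgV _ _ (nbhs B)).
  exact: H.
apply: filterS (nbhs_colspan dB (filterI nP nW)) => _ [D [PD WD] <-].
by rewrite /= pluckerE // (dim_colspan_det PD).
Qed.

End ColSpan.

Section AffineChart.
Context {R : realType}.
Local Notation Gr := (grassmannian R 4).

Lemma colspan_line n (u : 'cV[R]_n) : colspan u = <[u]>%VS.
Proof.
apply/eqP; rewrite eqEsubv; apply/andP; split; apply/subvP => v.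
  move=> /mem_colspan[w ->]; apply/vlineP; exists (w 0 0).
  apply/colP => i; rewrite !mxE big_ord_recl big_ord0 addr0 mulrC.
  by congr (_ * u _ _); exact: val_inj.
move=> /vlineP[c ->]; apply/mem_colspan; exists c%:M.
by rewrite mul_mx_scalar.
Qed.

Lemma dim1_line n (V : grassmannian R n) (u : 'cV[R]_n) :
  \dim V = 1%N -> u \in V -> u != 0 -> V = <[u]>%VS.
Proof.
move=> dV uV u0; apply/eqP; rewrite eq_sym eqEdim dim_vline u0 dV leqnn andbT.
by rewrite -memvE.
Qed.

Definition aff (v : 'cV[R]_3) : 'cV[R]_4 := vec4 1 (v 0 0) (v 1 0) (v 2 0).

Lemma affE (v : 'cV[R]_3) : col_mx (const_mx 1 : 'cV[R]_1) v = aff v.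
Proof.
apply/colP => i; rewrite !mxE; case: splitP => j ij; rewrite ?mxE ij.
  by rewrite ord1.
by rewrite [v in LHS]vec3_eta mxE; case: j {ij} => -[|[|[|]]].
Qed.

Lemma aff_normalize (z : 'cV[R]_4) : z 0 0 != 0 ->
  exists v, aff v = (z 0 0)^-1 *: z.
Proof.
move=> z0; exists (vec3 (z 1 0 / z 0 0) (z 2 0 / z 0 0) (z 3 0 / z 0 0)).
rewrite /aff [X in _ = _ *: X]vec4_eta; apply/colP => -[[|[|[|[|//]]]] i];
  by rewrite !mxE /= ?mulVf // mulrC.
Qed.

Variable M : 'M[R]_4.
Hypothesis MU : M \in unitmx.

Lemma affine_chartE v : affine_chart (invmx M) v = <[invmx M *m aff v]>%VS.
Proof. by rewrite /affine_chart affE. Qed.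

Lemma aff_neq0 v : invmx M *m aff v != 0.
Proof.
apply/eqP => /(congr1 (mulmx M)); rewrite mulmx0 mulKVmx // => /colP/(_ 0).
by rewrite !mxE /= => /eqP; rewrite oner_eq0.
Qed.

Lemma chart_RP3 v : RP3 (affine_chart (invmx M) v).
Proof. by rewrite /RP3 /= affine_chartE dim_vline aff_neq0. Qed.

Lemma chart_mem v (L : Gr) : \dim L = 1%N -> invmx M *m aff v \in L ->
  L = affine_chart (invmx M) v.
Proof. by move=> dL vL; rewrite affine_chartE; apply: dim1_line => //; exact: aff_neq0. Qed.

Lemma chart_ex u (L : Gr) : \dim L = 1%N -> u \in L -> (M *m u) 0 0 != 0 ->
  exists2 v, L = affine_chart (invmx M) v & aff v = ((M *m u) 0 0)^-1 *: (M *m u).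
Proof.
move=> dL uL Mu0; set z := M *m u in Mu0 *.
have [v E] := aff_normalize Mu0.
exists v => //; apply: chart_mem => //.
by rewrite E -scalemxAr mulKmx // memvZ.
Qed.

(** The inverse of the chart, written with Pluecker ratios so that its continuity is that of
    [plucker]. *)
Definition chart_coord (L : Gr) : 'cV[R]_3 :=
  \col_i plucker (row (lift 0 i) M) (row 0 M) L.

Lemma det_row_mul i (u : 'cV[R]_4) : \det (row i M *m u) = (M *m u) i 0.
Proof. by rewrite det_mx11 -row_mul mxE. Qed.

Lemma chart_coordK : cancel (affine_chart (invmx M)) chart_coord.
Proof.
move=> v; apply/colP => i; rewrite mxE affine_chartE -colspan_line pluckerE; last first.
  by rewrite colspan_line dim_vline aff_neq0.
rewrite !det_row_mul mulKVmx // [aff v 0 0]mxE divr1 [v in RHS]vec3_eta !mxE.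
by case: i => -[|[|[|]]].
Qed.

Lemma affine_chart_continuous : continuous (affine_chart (invmx M)).
Proof.
move=> v W; rewrite nbhsE => -[U [oU Uv] UW].
have := oU 1%N (invmx M *m aff v).
rewrite colspan_line -affine_chartE => /(_ (chart_RP3 v) Uv).
have H : (fun w => invmx M *m aff w) @ v --> invmx M *m aff v.
  apply: (@cvg_mulmx _ _ _ _ _ (nbhs v)); first exact: cvg_cst.
  apply: (@cvg_mx _ _ _ _ (nbhs v)) => i j; rewrite mxE.
  under eq_fun do rewrite mxE.
  case: i => -[|[|[|[|//]]]] i /=; first exact: cvg_cst.
  - exact: (@coord_continuous R 3 1 0 0 v).
  - exact: (@coord_continuous R 3 1 1 0 v).
  - exact: (@coord_continuous R 3 1 2 0 v).
move=> /H; apply: (@filterS _ (nbhs v)) => w Hw; apply: UW; rewrite affine_chartE -colspan_line.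
by apply: Hw; rewrite colspan_line -affine_chartE; exact: chart_RP3.
Qed.

Lemma chart_coord_continuous v :
  {for affine_chart (invmx M) v, continuous chart_coord}.
Proof.
rewrite /prop_for /continuous_at.
apply: (@cvg_mx _ _ _ _ (nbhs (affine_chart (invmx M) v))) => i j; rewrite mxE.
under eq_fun do rewrite mxE.
rewrite affine_chartE -colspan_line; apply: plucker_continuous.
by rewrite det_row_mul mulKVmx // mxE oner_eq0.
Qed.

Lemma near_chart v : \forall L \near affine_chart (invmx M) v,
  \dim L = 1%N -> range (affine_chart (invmx M)) L.
Proof.
(* The ratio of coordinate 0 to itself is 1 where this coordinate is non-zero and 0 elsewhere, since
   division by zero gives 0; continuity of the ratio thus shows that the coordinate stays
   non-zero. *)
have : nbhs (affine_chart (invmx M) v) [set L : Gr | plucker (row 0 M) (row 0 M) L != 0].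
  have := @plucker_continuous _ _ _ (row 0 M) (row 0 M) (invmx M *m aff v).
  rewrite colspan_line -affine_chartE.
  have d0 : \det (row 0 M *m (invmx M *m aff v)) != 0.
    by rewrite det_row_mul mulKVmx // mxE oner_eq0.
  move=> /(_ d0) /cvgr_neq0; apply.
  rewrite affine_chartE -colspan_line pluckerE ?divff ?oner_eq0 //.
  exact: dim_colspan_det d0.
apply: filterS => L L0 dL; have [u uL] := colspan_ex dL.
move: L0; rewrite /= -uL pluckerE ?uL // det_row_mul => L0.
have [||v' -> _] := @chart_ex u L dL.
- by rewrite -uL colspan_line memv_line.
- by apply: contra L0 => /eqP ->; rewrite mul0r.
- by exists v'.
Qed.

Lemma open_chart_image (O : set 'cV[R]_3) :
  open O -> open (affine_chart (invmx M) @` O).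
Proof.
move=> oO; rewrite openE => _ [v Ov <-].
have oR : open (RP3 : set Gr).
  move=> k A dA /= A1; apply: (@nearW _ (nbhs A)) => B dB.
  exact: etrans dB (etrans (esym dA) A1).
rewrite /interior.
have n1 : \forall L \near affine_chart (invmx M) v, RP3 L.
  by apply: open_nbhs_nbhs; split => //; exact: chart_RP3.
have n2 : \forall L \near affine_chart (invmx M) v, O (chart_coord L).
  apply: (@chart_coord_continuous v); rewrite chart_coordK.
  exact: open_nbhs_nbhs.
apply: filterS3 n1 n2 (near_chart v) => L dL + /(_ dL)[w _ wL].
by rewrite -wL chart_coordK => Ow; exists w.
Qed.

End AffineChart.

Section Incidence.
Context {R : realType}.
Local Notation Gr := (grassmannian R 4).

Lemma injmx_left_inverse n k (D : 'M[R]_(n, k)) :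
  (forall w : 'cV_k, D *m w = 0 -> w = 0) -> exists N, N *m D = 1%:M.
Proof.
move=> Dinj; apply/row_fullP; rewrite -cokermx_eq0; apply/eqP/matrixP => i j.
have /Dinj/colP/(_ i) : D *m col j (cokermx D) = 0.
  by rewrite colE mulmxA mulmx_coker mul0mx.
by rewrite !mxE.
Qed.

Lemma row_mx_inj n k (D : 'M[R]_(n, k)) (u : 'cV[R]_n) :
  (forall w : 'cV_k, D *m w = 0 -> w = 0) -> u \notin colspan D ->
  forall w : 'cV_(k + 1), row_mx D u *m w = 0 -> w = 0.
Proof.
move=> Dinj uD w; rewrite -(vsubmxK w) mul_row_col => E.
have d0 : dsubmx w = 0.
  rewrite [dsubmx w]mx11_scalar; set s := dsubmx w 0 0.
  have [->|s0] := eqVneq s 0; first by rewrite raddf0.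
  case/negP: uD; apply/mem_colspan.
  exists (- s^-1 *: usubmx w); rewrite -scalemxAr scaleNr.
  move: E; rewrite [dsubmx w]mx11_scalar -/s mul_mx_scalar => /eqP.
  by rewrite addr_eq0 => /eqP ->; rewrite scalerN opprK scalerA mulVf // scale1r.
move: E; rewrite d0 mulmx0 addr0 => /Dinj ->.
by rewrite col_mx0.
Qed.

(** Let [N] be a left inverse of the 4 x 3 matrix made of a basis of [V] and a vector of [L].
    Invertibility of [N] times a nearby matrix is an open condition, and it keeps the last column
    out of the span of the first two. *)
Lemma line_notin_near (L V : Gr) : \dim L = 1%N -> \dim V = 2%N ->
  ~ (L <= V)%VS ->
  \forall V' \near V & L' \near L, ~ (L' <= V')%VS.
Proof.
move=> dL dV LV; have [u uL] := colspan_ex dL; have [B BV] := colspan_ex dV.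
have dB : \dim (colspan B) = 2%N by rewrite BV.
have du : \dim (colspan u) = 1%N by rewrite uL.
have uB : u \notin colspan B.
  by apply/negP => uB; apply: LV; rewrite -uL colspan_line -memvE -BV.
have [N NE] := injmx_left_inverse (row_mx_inj ((dim_colspan B).1 dB) uB).
have nz : \forall B' \near B & u' \near u,
    \det (N *m row_mx (B' : 'M[R]_(4, 2)) (u' : 'cV[R]_4)) != 0.
  have H : (fun z : 'M[R]_(4, 2) * 'cV[R]_4 => \det (N *m row_mx z.1 z.2))
      @ filter_prod (nbhs B) (nbhs u) --> (1 : R).
    rewrite -(det1 _ 3) -NE.
    apply: (@continuous_cvg _ _ _ (filter_prod (nbhs B) (nbhs u))).
      exact: det_continuous.
    apply: (@cvg_mulmx _ _ _ _ _ (filter_prod (nbhs B) (nbhs u))).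
      exact: cvg_cst.
    apply: (@cvg_mx _ _ _ _ (filter_prod (nbhs B) (nbhs u))) => i j.
    rewrite mxE; under eq_fun do rewrite mxE.
    case: splitP => l _.
      apply: (@cvg_entry _ _ _ _ (filter_prod (nbhs B) (nbhs u)) _ fst).
      exact: cvg_fst.
    apply: (@cvg_entry _ _ _ _ (filter_prod (nbhs B) (nbhs u)) _ snd).
    exact: cvg_snd.
  by move: H => /cvgr_neq0; apply; exact: oner_neq0.
case: nz => -[S1 S2] /= [SB Su] S12; rewrite -BV -uL.
exists (@colspan R 4 2 @` S1, @colspan R 4 1 @` S2).
  by split; apply: nbhs_colspan.
move=> [_ _] /= [[B' SB' <-] [u' Su' <-]] /= sub.
have /negP := S12 (B', u') (conj SB' Su'); apply => /=.
have /mem_colspan[w u'E] : u' \in colspan B'.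
  by apply: (subvP sub); rewrite colspan_line memv_line.
apply/eqP; set D := N *m _.
have [//|D0] := eqVneq (\det D) 0.
have DU : D \in unitmx by rewrite unitmxE unitfE.
have : col_mx w (- 1%:M) = 0 :> 'cV[R]_(2 + 1).
  rewrite -(mulKmx DU (col_mx w _)) /D -mulmxA mul_row_col -u'E mulmxN mulmx1.
  by rewrite subrr !mulmx0.
move=> /(congr1 dsubmx); rewrite col_mxKd linear0 => /colP/(_ 0)/eqP.
by rewrite !mxE /= oppr_eq0 oner_eq0.
Qed.

End Incidence.

(** * Charts of the circle *)

Section Circle.
Context {R : realType}.

Lemma unit_circle_compact : compact (@unit_circle R).
Proof.
have sub : @unit_circle R `<=` `[-1, 1]%classic `*` `[-1, 1]%classic.
  move=> [a b]; rewrite /unit_circle /= => ab.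
  have a2 := sqr_ge0 a; have b2 := sqr_ge0 b.
  by split; rewrite /= in_itv /=; apply/andP; split; nra.
apply: (subclosed_compact _ (compact_setX (@segment_compact _ _ _) (@segment_compact _ _ _)) sub).
have c : continuous (fun z : R * R => z.1 ^+ 2 + z.2 ^+ 2).
  move=> z; apply: cvgD; apply: (@cvgM _ _ (nbhs z)); by [exact: cvg_fst|exact: cvg_snd].
have -> : @unit_circle R = (fun z : R * R => z.1 ^+ 2 + z.2 ^+ 2) @^-1` [set 1] by [].
by apply: closed_comp; [move=> z _; exact: c|exact: closed_eq].
Qed.

Variable B : topologicalType.

(** The last clause states both that the complement of [z] is open and that [t] is continuous there;
    the value of [t] at [z] is unspecified. *)
Definition param_chart (z : B) (c : R -> B) (t : B -> R) :=
  [/\ continuous c, cancel c t, forall s, c s != z,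
      forall y, y != z -> c (t y) = y &
      forall s (e : R), 0 < e -> \forall y \near c s, y != z /\ `|t y - s| < e].

Hypothesis circleB : is_topological_circle (R := R) B.

(** Compactness of the circle as a tube lemma: properties that hold locally in [x] near [F] hold
    near [F] for all [x] at once. *)
Lemma circle_near_covering (I : Type) (F : set_system I) (P : I -> B -> Prop) :
  Filter F -> (forall x : B, \forall x' \near x & i \near F, P i x') ->
  \forall i \near F, forall x, P i x.
Proof.
move=> FF H; have [f [finj fim fO]] := circleB.
have /compact_near_coveringP cov := unit_circle_compact.
have : \near F, unit_circle `<=` (fun i z => forall x, f x = z -> P i x) F.
  apply: cov => z; rewrite -fim => -[x _ <-].
  have [[S T] /= [xS FT] ST] := H x.
  have [U [oU Ux US]] : exists U : set B, [/\ open U, U x & U `<=` S].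
    by move: xS; rewrite nbhsE => -[U [oU Ux] US]; exists U.
  have /fO[W oW UE] := oU.
  exists (W, T) => /=; first split => //.
    by apply: open_nbhs_nbhs; split => //; have := Ux; rewrite UE.
  move=> [w i] /= [Ww Ti] y yE; apply: (ST (y, i)); split => //=.
  by apply: US; rewrite UE /= yE.
apply: filterS => i Hi x; apply: (Hi (f x)) => //.
by rewrite -fim; exists x.
Qed.

(* Stereographic projection from [z]. *)
Lemma circle_chart (z : B) : exists c t, param_chart z c t.
Proof.
have [f [finj fim fO]] := circleB.
case fz : (f z) => [p q].
have pq : p ^+ 2 + q ^+ 2 = 1.
  by have : unit_circle (f z); [rewrite -fim; exists z|rewrite fz].
(* [A] and [D] are the coordinates in the orthonormal frame of [f z] and its quarter turn; (a, b) is
   the rational parametrization of the circle that reaches (1, 0), that is [f z], only at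
   infinity. *)
pose A (w : R * R) := p * w.1 + q * w.2.
pose D (w : R * R) := p * w.2 - q * w.1.
pose st (w : R * R) := D w / (1 - A w).
pose a (s : R) := (s ^+ 2 - 1) / (s ^+ 2 + 1).
pose b (s : R) := 2 * s / (s ^+ 2 + 1).
pose sg s : R * R := (p * a s - q * b s, q * a s + p * b s).
have s1 (s : R) : s ^+ 2 + 1 != 0 by rewrite gt_eqF //; have := sqr_ge0 s; lra.
have ab s : a s ^+ 2 + b s ^+ 2 = 1 by rewrite /a /b; field.
have Asg s : A (sg s) = a s.
  by rewrite -[RHS]mul1r -pq /A /sg /=; ring.
have Dsg s : D (sg s) = b s.
  by rewrite -[RHS]mul1r -pq /D /sg /=; ring.
have sg_circ s : unit_circle (sg s).
  by rewrite /unit_circle /sg /= -[RHS]mul1r -{1}pq -(ab s); ring.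
have a1 s : 1 - a s = 2 / (s ^+ 2 + 1) by rewrite /a; field.
have st_sg s : st (sg s) = s.
  by rewrite /st Asg Dsg a1 /b; field.
have AD w : unit_circle w -> A w ^+ 2 + D w ^+ 2 = 1.
  by move=> cw; rewrite -[RHS]mul1r -{1}pq -cw /A /D; ring.
have inv w : (p * A w - q * D w, q * A w + p * D w) = w.
  case: w => w1 w2; rewrite /A /D /=; congr (_, _).
    by rewrite -[RHS]mul1r -pq; ring.
  by rewrite -[RHS]mul1r -pq; ring.
have A1 w : unit_circle w -> A w = 1 -> w = (p, q).
  move=> cw Aw; have /eqP := AD _ cw.
  rewrite Aw expr1n -subr_eq0 addrAC subrr add0r sqrf_eq0 => /eqP D0.
  by rewrite -[LHS]inv Aw D0 !mulr1 !mulr0 subr0 addr0.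
have sg_st w : unit_circle w -> A w != 1 -> sg (st w) = w.
  move=> cw Aw; have Aw1 : 1 - A w != 0 by rewrite subr_eq0 eq_sym.
  have E := AD _ cw.
  have H2 : D w ^+ 2 = 1 - A w ^+ 2 by rewrite -E addrAC subrr add0r.
  have H : st w ^+ 2 + 1 = 2 / (1 - A w).
    by rewrite /st expr_div_n H2; field.
  have H' : st w ^+ 2 - 1 = 2 * A w / (1 - A w).
    by rewrite /st expr_div_n H2; field.
  have aE : a (st w) = A w by rewrite /a H H'; field.
  have bE : b (st w) = D w by rewrite /b H /st; field.
  by rewrite /sg aE bE inv.
have /choice[c cE] s : exists x, f x = sg s.
  by have := sg_circ s; rewrite -fim => -[x _ <-]; exists x.
have cf y : unit_circle (f y) by rewrite -fim; exists y.
have yA y : y != z -> A (f y) != 1.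
  by apply: contra => /eqP /(A1 _ (cf y)) E; apply/eqP/finj; rewrite E fz.
have Az : A (f z) = 1 by rewrite fz /A /= -!expr2.
exists c, (st \o f); split.
- move=> s W; rewrite nbhsE => -[U [oU Us] UW]; have /fO[V oV UE] := oU.
  have csg : continuous sg.
    have c1 : continuous (fun s : R => s ^+ 2) by exact: exprn_continuous.
    have cd : continuous (fun s : R => (s ^+ 2 + 1)^-1).
      move=> r; apply: (@cvgV _ _ (nbhs r)); first exact: s1.
      by apply: (@cvgD _ _ _ (nbhs r)); [exact: c1|exact: cvg_cst].
    have ca : continuous a.
      move=> r; apply: (@cvgM _ _ (nbhs r)); last exact: cd.
      by apply: (@cvgB _ _ _ (nbhs r)); [exact: c1|exact: cvg_cst].
    have cb : continuous b.
      move=> r; apply: (@cvgM _ _ (nbhs r)); last exact: cd.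
      by apply: (@cvgM _ _ (nbhs r)); [exact: cvg_cst|exact: cvg_id].
    move=> r; apply: (@cvg_pair _ _ _ (nbhs r) (nbhs (p * a r - q * b r))
      (nbhs (q * a r + p * b r))).
      by apply: (@cvgB _ _ _ (nbhs r)); apply: (@cvgM _ _ (nbhs r));
        by [exact: cvg_cst|exact: ca|exact: cb].
    by apply: (@cvgD _ _ _ (nbhs r)); apply: (@cvgM _ _ (nbhs r));
      by [exact: cvg_cst|exact: ca|exact: cb].
  have : nbhs (sg s) V.
    by apply: open_nbhs_nbhs; split => //; have := Us; rewrite UE /= cE.
  move=> /csg; apply: (@filterS _ (nbhs s)) => r Vr; apply: UW.
  by rewrite UE /= cE.
- by move=> s; rewrite /= cE st_sg.
- move=> s; apply/eqP => E; have := Asg s; rewrite -cE E Az => a1E.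
  have := a1 s; rewrite -a1E subrr => /esym/eqP.
  by rewrite mulf_eq0 invr_eq0 (negPf (s1 s)) orbF pnatr_eq0.
- by move=> y /yA Ay; apply: finj; rewrite cE sg_st.
- move=> s e e0.
  have fc : f @ c s --> f (c s).
    move=> W Ws; have : nbhs (c s) (f @^-1` W°).
      apply: open_nbhs_nbhs; split => //.
      by apply/fO; exists W° => //; exact: open_interior.
    by apply: filterS => y; exact: interior_subset.
  have A1s : A (f (c s)) != 1.
    rewrite cE Asg; apply/eqP => a1E; have := a1 s; rewrite a1E subrr => /esym/eqP.
    by rewrite mulf_eq0 invr_eq0 (negPf (s1 s)) orbF pnatr_eq0.
  have cA : continuous A.
    move=> w; apply: (@cvgD _ _ _ (nbhs w)); apply: (@cvgM _ _ (nbhs w));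
      by [exact: cvg_cst|exact: cvg_fst|exact: cvg_snd].
  have cD : continuous D.
    move=> w; apply: (@cvgB _ _ _ (nbhs w)); apply: (@cvgM _ _ (nbhs w));
      by [exact: cvg_cst|exact: cvg_fst|exact: cvg_snd].
  have cAf : A (f y) @[y --> c s] --> A (f (c s)).
    by apply: (@continuous_cvg _ _ _ (nbhs (c s))); [exact: cA|exact: fc].
  have cDf : D (f y) @[y --> c s] --> D (f (c s)).
    by apply: (@continuous_cvg _ _ _ (nbhs (c s))); [exact: cD|exact: fc].
  have n1 : \forall y \near c s, A (f y) != 1.
    have H : A (f y) - 1 @[y --> c s] --> A (f (c s)) - 1.
      by apply: (@cvgB _ _ _ (nbhs (c s))) => //; exact: cvg_cst.
    have : A (f (c s)) - 1 != 0 by rewrite subr_eq0.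
    by move: H => /cvgr_neq0 H /H; apply: filterS => y; rewrite subr_eq0.
  have n2 : \forall y \near c s, `|st (f y) - s| < e.
    have : st (f y) @[y --> c s] --> s.
      rewrite -{2}(st_sg s) -cE; apply: (@cvgM _ _ (nbhs (c s))) => //.
      apply: (@cvgV _ _ (nbhs (c s))); first by rewrite subr_eq0 eq_sym.
      by apply: (@cvgB _ _ _ (nbhs (c s))) => //; exact: cvg_cst.
    by move=> /cvgr_dist_lt/(_ _ e0); apply: filterS => y; rewrite distrC.
  apply: filterS2 n1 n2 => y Ay ye; split => //.
  by apply: contra Ay => /eqP ->; rewrite Az.
Qed.

End Circle.

(** * Frenet curves in adapted coordinates *)

Section Frenet.
Context {R : realType} {B : topologicalType}.
Local Notation Gr := (grassmannian R 4).
Variable xi : B -> Gr * Gr * Gr.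
Hypothesis xiF : hyperconvex_frenet xi.
Local Notation xk := (curve_part xi).

Lemma dim_fullv4 : \dim (fullv : Gr) = 4%N.
Proof. by rewrite dimvf /dim /= muln1. Qed.

Lemma dim_curve k x : (k <= 4)%N -> \dim (xk k x) = k.
Proof.
have [/(_ x) + _ _ _] := xiF; rewrite /full_flags /=.
case E : (xi x) => [[V1 V2] V3] [d1 d2 d3 _ _].
by case: k => [|[|[|[|[|//]]]]] _ /=; rewrite ?E ?dimv0 ?dim_fullv4.
Qed.

Lemma curve_sub12 x : (xk 1 x <= xk 2 x)%VS.
Proof.
by have [/(_ x) + _ _ _] := xiF; rewrite /full_flags /=; case: (xi x) => [[? ?] ?] [].
Qed.

Lemma curve_sub23 x : (xk 2 x <= xk 3 x)%VS.
Proof.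
by have [/(_ x) + _ _ _] := xiF; rewrite /full_flags /=; case: (xi x) => [[? ?] ?] [].
Qed.

Lemma curve_continuous k : continuous (xk k).
Proof.
have [_ xc _ _] := xiF.
case: k => [|[|[|[|k]]]] x /=; try exact: cvg_cst.
- apply: (@continuous_comp _ _ _ xi (fun p : Gr * Gr * Gr => p.1.1) x); first exact: xc.
  apply: (@continuous_comp _ _ _ fst fst); exact: cvg_fst.
- apply: (@continuous_comp _ _ _ xi (fun p : Gr * Gr * Gr => p.1.2) x); first exact: xc.
  by apply: (@continuous_comp _ _ _ fst snd); [exact: cvg_fst|exact: cvg_snd].
- apply: (@continuous_comp _ _ _ xi (fun p : Gr * Gr * Gr => p.2) x); first exact: xc.
  exact: cvg_snd.
Qed.

(** When the dimensions add up to 4, the direct sum is R^4 and a form that vanishes on the summands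
    is zero. All uses of transversality pass through this statement, with a list of pairs
    (dimension, point). *)
Lemma annihilator (s : seq (nat * B)) (q : 'rV[R]_4) :
  uniq (unzip2 s) -> all (leq 1) (unzip1 s) -> sumn (unzip1 s) = 4%N ->
  (forall p u, p \in s -> u \in xk p.1 p.2 -> q *m u = 0) -> q = 0.
Proof.
move=> us ps ss qs; have [_ _ hyp _] := xiF.
pose k l := (tnth (in_tuple s) l).1; pose x l := (tnth (in_tuple s) l).2.
have kE : (\sum_l k l = 4)%N.
  by rewrite -ss sumnE big_map (big_tnth _ _ s).
have s0 : (0 < size s)%N by case: s ss {us ps qs k x kE}.
have kpos l : (0 < k l)%N.
  by move/allP : ps; apply; apply/mapP; exists (tnth (in_tuple s) l); rewrite ?mem_tnth.
have xinj : injective x.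
  move=> i j; have p0 : nat * B := tnth (in_tuple s) i.
  rewrite /x !(tnth_nth p0) /= => E.
  apply/val_inj/eqP; rewrite -(nth_uniq p0.2 _ _ us) ?size_map ?ltn_ord //.
  by rewrite !(nth_map p0) ?ltn_ord //; apply/eqP; exact: E.
have := hyp _ k x s0 kpos; rewrite kE => /(_ (leqnn _) xinj).
rewrite directvE /= => /eqP dS.
have full : (\sum_l xk (k l) (x l))%VS = fullv.
  apply/eqP; rewrite eqEdim subvf dim_fullv4 dS -[X in (X <= _)%N]kE.
  apply: leq_sum => l _; rewrite dim_curve // -kE (bigD1 l) //= leq_addr //.
apply/row_matrixP => i; rewrite row0 [i]ord1 row_id; apply/rowP => j; rewrite [RHS]mxE.
have : delta_mx j 0 \in (\sum_l xk (k l) (x l))%VS by rewrite full memvf.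
move=> /memv_sumP[v vx dE].
have := congr1 (fun u => (q *m u) 0 0) dE.
rewrite mulmx_sumr summxE -colE [col _ _ _ _]mxE => ->.
rewrite big1 // => l _.
by rewrite (qs (tnth (in_tuple s) l)) ?mxE ?mem_tnth // vx.
Qed.

Lemma frenet_cvg2 (u v : nat -> B) x : (forall k, u k != v k) ->
  u @ \oo --> x -> v @ \oo --> x ->
  ((xk 1 (u k) + xk 1 (v k))%VS : Gr) @[k --> \oo] --> xk 2 x.
Proof.
move=> uv ux vx; have [_ _ _ lim] := xiF.
pose w k (l : 'I_2) := nth x [:: u k; v k] l.
have := lim 2%N (fun=> 1%N) x w isT (fun=> isT).
rewrite sum_nat_const card_ord => /(_ isT) H.
have : forall k, injective (w k).
  move=> k; rewrite /w => -[[|[|//]] i] [[|[|//]] j] /= E; apply/val_inj => //=.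
    by have := uv k; rewrite E eqxx.
  by have := uv k; rewrite E eqxx.
move=> /H {}H; have /H : forall l, w k l @[k --> \oo] --> x.
  by move=> [[|[|//]] i]; rewrite /w /=.
by under eq_fun do rewrite !big_ord_recl big_ord0 addv0.
Qed.

Lemma frenet_cvg3 (u v w : nat -> B) x :
  (forall k, uniq [:: u k; v k; w k]) ->
  u @ \oo --> x -> v @ \oo --> x -> w @ \oo --> x ->
  ((xk 1 (u k) + (xk 1 (v k) + xk 1 (w k)))%VS : Gr) @[k --> \oo] --> xk 3 x.
Proof.
move=> uvw ux vx wx; have [_ _ _ lim] := xiF.
pose y k (l : 'I_3) := nth x [:: u k; v k; w k] l.
have := lim 3%N (fun=> 1%N) x y isT (fun=> isT).
rewrite sum_nat_const card_ord => /(_ isT) H.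
have : forall k, injective (y k).
  move=> k i j /eqP; rewrite /y nth_uniq // => /eqP; exact: val_inj.
move=> /H {}H; have /H : forall l, y k l @[k --> \oo] --> x.
  by move=> [[|[|[|//]]] i]; rewrite /y /=.
by under eq_fun do rewrite !big_ord_recl big_ord0 addv0.
Qed.

End Frenet.

(** * Minors of matrices given by their columns *)

Section Determinants.
Context {R : realType}.

Lemma det2E (A : 'M[R]_2) : \det A = A 0 0 * A 1 1 - A 0 1 * A 1 0.
Proof.
rewrite (expand_det_row _ 0) !big_ord_recl big_ord0 addr0 /cofactor !det_mx11 !mxE /=.
rewrite expr0 mul1r expr1 mulN1r mulrN.
by congr (_ * A _ _ - A _ _ * A _ _); exact: val_inj.
Qed.

Lemma det3E (A : 'M[R]_3) : \det A =
  A 0 0 * (A 1 1 * A 2 2 - A 1 2 * A 2 1) - A 0 1 * (A 1 0 * A 2 2 - A 1 2 * A 2 0)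
  + A 0 2 * (A 1 0 * A 2 1 - A 1 1 * A 2 0).
Proof.
rewrite (expand_det_row _ 0) !big_ord_recl big_ord0 addr0 /cofactor !det2E !mxE /=.
rewrite expr0 mul1r expr1 mulN1r mulrN -signr_odd /= expr0 mul1r addrA.
by congr (A _ _ * (A _ _ * A _ _ - A _ _ * A _ _)
  - A _ _ * (A _ _ * A _ _ - A _ _ * A _ _)
  + A _ _ * (A _ _ * A _ _ - A _ _ * A _ _)); exact: val_inj.
Qed.

Definition vecs k (us : seq 'cV[R]_4) : 'M[R]_(4, k) := \matrix_(i, j) us`_j i 0.

Definition rows k (h : seq 'I_4) (M : 'M[R]_4) : 'M[R]_(k, 4) :=
  rowsub (fun l : 'I_k => nth 0 h l) M.

Lemma rows_vecs k h M us i j :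
  (rows k h M *m vecs k us) i j = (M *m us`_j) (nth 0 h i) 0.
Proof. by rewrite !mxE; apply: eq_bigr => l _; rewrite !mxE. Qed.

Lemma vecs_mul k us (w : 'cV[R]_k) : vecs k us *m w = \sum_j w j 0 *: us`_j.
Proof.
apply/colP => i; rewrite mxE summxE; apply: eq_bigr => j _.
by rewrite !mxE mulrC.
Qed.

Lemma colspan_vecs k h M us (V : grassmannian R 4) :
  \det (rows k h M *m vecs k us) != 0 -> (\dim V <= k)%N ->
  (forall j, (j < k)%N -> us`_j \in V) -> colspan (vecs k us) = V.
Proof.
move=> d0 dV uV; apply/eqP; rewrite eqEdim (dim_colspan_det d0) dV andbT.
apply: colspan_sub => w; rewrite vecs_mul; apply: memv_suml => j _.
by apply: memvZ; exact: uV.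
Qed.

Lemma rows_vecs_det1 h M us : \det (rows 1 h M *m vecs 1 us) = (M *m us`_0) (nth 0 h 0) 0.
Proof. by rewrite det_mx11 rows_vecs. Qed.

End Determinants.

Section Adapted.
Context {R : realType} {B : topologicalType}.
Local Notation Gr := (grassmannian R 4).
Variable xi : B -> Gr * Gr * Gr.
Hypothesis xiF : hyperconvex_frenet xi.
Local Notation xk := (curve_part xi).

(** The last row of a left inverse of the matrix made of a basis of [V] followed by [u]. *)
Lemma separating_row (V : Gr) (u : 'cV[R]_4) : u \notin V ->
  exists q : 'rV[R]_4, (forall v, v \in V -> q *m v = 0) /\ q *m u = 1%:M.
Proof.
move=> uV; have [D DV] := colspan_ex (erefl (\dim V)).
have dD : \dim (colspan D) = \dim V by rewrite DV.
have uD : u \notin colspan D by rewrite DV.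
have [N NE] := injmx_left_inverse (row_mx_inj ((dim_colspan D).1 dD) uD).
exists (dsubmx N); have := NE; rewrite -[N]vsubmxK mul_col_row.
rewrite [1%:M]scalar_mx_block vsubmxK => /eq_block_mx[_ _ ND Nu]; split => //.
move=> v vV; have : v \in colspan D by rewrite DV.
by move=> /mem_colspan[z ->]; rewrite mulmxA ND mul0mx.
Qed.

Lemma mem_extend (V W : Gr) (u v : 'cV[R]_4) : \dim V = (\dim W).+1 ->
  (W <= V)%VS -> u \in V -> u \notin W -> v \in V ->
  exists c, v - c *: u \in W.
Proof.
move=> dV WV uV uW.
have -> : V = (W + <[u]>)%VS.
  apply/eqP; rewrite eq_sym eqEdim subv_add WV -memvE uV /= dV.
  rewrite ltnNge; apply: contra uW => d.
  have /eqP -> : W == (W + <[u]>)%VS by rewrite eqEdim addvSl.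
  exact: (subvP (addvSr _ _) _ (memv_line u)).
move=> /memv_addP[w wW [_ /vlineP[c ->] ->]]; exists c.
by rewrite addrK.
Qed.

Lemma exists_notin (V W : Gr) : (\dim W < \dim V)%N ->
  exists2 u, u \in V & u \notin W.
Proof.
move=> d; have : ~~ (V <= W)%VS by apply: contraL d => /dimvS; rewrite -leqNgt.
by move=> /subvPn[u uV uW]; exists u.
Qed.

(* In the coordinates [M *m u], the flag at [z] is the coordinate flag
   [{x0 = x1 = x2 = 0}], [{x0 = x1 = 0}], [{x0 = 0}]. *)
Definition adapted (M : 'M[R]_4) (z : B) := M \in unitmx /\
  forall u, [/\ u \in xk 3 z -> (M *m u) 0 0 = 0,
    u \in xk 2 z -> (M *m u) 1 0 = 0 & u \in xk 1 z -> (M *m u) 2 0 = 0].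

(** Each row of [M] is a form that vanishes on one member of the flag and equals 1 at a vector of
    the next larger one. On these four vectors [M] is triangular with unit diagonal, hence
    invertible. *)
Lemma adapted_ex z : exists M, adapted M z.
Proof.
have dl := dim_curve xiF.
have [u0 _ u0n] : exists2 u, u \in (fullv : Gr) & u \notin xk 3 z.
  by apply: exists_notin; rewrite dim_fullv4 dl.
have [u1 u1V u1n] : exists2 u, u \in xk 3 z & u \notin xk 2 z.
  by apply: exists_notin; rewrite !dl.
have [u2 u2V u2n] : exists2 u, u \in xk 2 z & u \notin xk 1 z.
  by apply: exists_notin; rewrite !dl.
have [u3 u3V u3n] : exists2 u, u \in xk 1 z & u \notin (0%VS : Gr).
  by apply: exists_notin; rewrite !dl // dimv0.
have [q0 [q0z q0u]] := separating_row u0n; have [q1 [q1z q1u]] := separating_row u1n.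
have [q2 [q2z q2u]] := separating_row u2n; have [q3 [q3z q3u]] := separating_row u3n.
have s12 := subvP (curve_sub12 xiF z); have s23 := subvP (curve_sub23 xiF z).
pose M := \matrix_(i < 4) [:: q0; q1; q2; q3]`_i.
have Mrow i u : (M *m u) i 0 = ([:: q0; q1; q2; q3]`_i *m u) 0 0.
  by rewrite !mxE; apply: eq_bigr => l _; rewrite !mxE.
exists M; split; last first.
  by move=> u; split => uz; rewrite Mrow /= ?q0z ?q1z ?q2z ?mxE.
suff : M *m vecs 4 [:: u0; u1; u2; u3] \in unitmx by rewrite unitmx_mul => /andP[].
have E (i j : 'I_4) : (M *m vecs 4 [:: u0; u1; u2; u3]) i j =
    ([:: q0; q1; q2; q3]`_i *m [:: u0; u1; u2; u3]`_j) 0 0.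
  by rewrite -Mrow !mxE; apply: eq_bigr => l _; rewrite !mxE.
rewrite unitmxE unitfE det_trig; last first.
  apply/is_trig_mxP => i j; rewrite E.
  case: i => -[|[|[|[|//]]]] i; case: j => -[|[|[|[|//]]]] j //= _;
  by rewrite ?q0z ?q1z ?q2z ?mxE //; auto.
rewrite big1 ?oner_eq0 // => i _; rewrite E.
by case: i => -[|[|[|[|//]]]] i /=; rewrite ?q0u ?q1u ?q2u ?q3u mxE.
Qed.

End Adapted.

Section NormalForm.
Context {R : realType} {B : topologicalType}.
Local Notation Gr := (grassmannian R 4).
Variable xi : B -> Gr * Gr * Gr.
Hypothesis xiF : hyperconvex_frenet xi.
Local Notation xk := (curve_part xi).

Definition lin4 (p0 p1 p2 p3 : R) (w : 'cV[R]_4) : R :=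
  p0 * w 0 0 + p1 * w 1 0 + p2 * w 2 0 + p3 * w 3 0.

Lemma lin4E p0 p1 p2 p3 w :
  (vec4 p0 p1 p2 p3)^T *m w = (lin4 p0 p1 p2 p3 w)%:M.
Proof.
rewrite {1}(vec4_eta w); apply/matrixP => i j; rewrite !ord1 !mxE eqxx mulr1n.
by rewrite !big_ord_recl big_ord0 !mxE /= addr0 /lin4 !addrA.
Qed.

Lemma lin4D p0 p1 p2 p3 w c u :
  lin4 p0 p1 p2 p3 (w + c *: u) = lin4 p0 p1 p2 p3 w + c * lin4 p0 p1 p2 p3 u.
Proof. by rewrite /lin4 !mxE; ring. Qed.

Lemma lin4_vec4 p0 p1 p2 p3 a b c d :
  lin4 p0 p1 p2 p3 (vec4 a b c d) = p0 * a + p1 * b + p2 * c + p3 * d.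
Proof. by rewrite /lin4 !mxE. Qed.

Lemma annihilator4 (M : 'M[R]_4) (s : seq (nat * B)) p0 p1 p2 p3 : M \in unitmx ->
  uniq (unzip2 s) -> all (leq 1) (unzip1 s) -> sumn (unzip1 s) = 4%N ->
  (forall p u, p \in s -> u \in xk p.1 p.2 -> lin4 p0 p1 p2 p3 (M *m u) = 0) ->
  [/\ p0 = 0, p1 = 0, p2 = 0 & p3 = 0].
Proof.
move=> MU us ps ss H.
have q0 : (vec4 p0 p1 p2 p3)^T *m M = 0.
  apply: (annihilator xiF us ps ss) => p u sp up.
  by rewrite -mulmxA lin4E (H p) // raddf0.
have /(congr1 trmx) : (vec4 p0 p1 p2 p3)^T = 0.
  by rewrite -(mulmxK MU (vec4 _ _ _ _)^T) q0 mul0mx.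
rewrite trmxK trmx0 => /colP E.
by split; [have := E 0|have := E 1|have := E 2|have := E 3]; rewrite !mxE.
Qed.

Lemma mem_step k y u u' : (k < 4)%N -> (xk k y <= xk k.+1 y)%VS ->
  u \in xk k.+1 y -> u \notin xk k y -> u' \in xk k.+1 y ->
  exists c, u' - c *: u \in xk k y.
Proof.
move=> k4 kk uk nuk uk'; apply: (@mem_extend _ (xk k.+1 y)) => //.
by rewrite !(dim_curve xiF) // ltnW.
Qed.

Lemma kill_step (M : 'M[R]_4) k y u p0 p1 p2 p3 : (k < 4)%N ->
  (xk k y <= xk k.+1 y)%VS -> u \in xk k.+1 y -> u \notin xk k y ->
  (forall v, v \in xk k y -> lin4 p0 p1 p2 p3 (M *m v) = 0) ->
  lin4 p0 p1 p2 p3 (M *m u) = 0 ->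
  forall v, v \in xk k.+1 y -> lin4 p0 p1 p2 p3 (M *m v) = 0.
Proof.
move=> k4 kk uk nuk Hk Hu v vk; have [c] := mem_step k4 kk uk nuk vk.
move=> /Hk; rewrite mulmxBr -scalemxAr -scaleNr lin4D Hu mulr0 addr0 => //.
Qed.

Definition pt (M : 'M[R]_4) a b c d : 'cV[R]_4 := invmx M *m vec4 a b c d.

Lemma pt_mem (M : 'M[R]_4) (V : Gr) u s a b c d : M \in unitmx -> s != 0 ->
  M *m u = s *: vec4 a b c d -> u \in V -> pt M a b c d \in V.
Proof.
move=> MU s0 E uV; have -> : pt M a b c d = s^-1 *: u; last exact: memvZ.
by rewrite /pt -(mulKmx MU u) E -scalemxAr scalerA mulVf // scale1r.
Qed.

(** Gaussian elimination on a basis adapted to the flag at [y]. The pivots are non-zero because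
    [xi^1 y], [xi^2 y], [xi^3 y] are complementary to [xi^3 z], [xi^2 z], [xi^1 z]: a zero pivot
    would give a non-zero form killing both members of such a pair. *)
Lemma normal_form (M : 'M[R]_4) z y : adapted xi M z -> y != z ->
  exists X f g m n G, [/\ pt M 1 X f g \in xk 1 y, pt M 0 1 m n \in xk 2 y &
    pt M 0 0 1 G \in xk 3 y].
Proof.
move=> [MU Mz] yz; have dl := dim_curve xiF.
have s12 := curve_sub12 xiF y; have s23 := curve_sub23 xiF y.
have s01 : (xk 0 y <= xk 1 y)%VS by exact: sub0v.
have uz : uniq [:: z; y] by rewrite /= inE eq_sym yz.
have z3 u : u \in xk 3 z -> (M *m u) 0 0 = 0 by have [+ _ _] := Mz u.
have z2 u : u \in xk 2 z -> (M *m u) 0 0 = 0 /\ (M *m u) 1 0 = 0.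
  move=> u2; have [+ + _] := Mz u; move=> -> //; last first.
    exact: (subvP (curve_sub23 xiF z)).
  by move=> ->.
have z1 u : u \in xk 1 z -> [/\ (M *m u) 0 0 = 0, (M *m u) 1 0 = 0 & (M *m u) 2 0 = 0].
  move=> u1; have [|-> ->] := z2 u; first exact: (subvP (curve_sub12 xiF z)).
  by have [_ _ ->] := Mz u.
have [u u1 un] : exists2 u, u \in xk 1 y & u \notin (0%VS : Gr).
  by apply: exists_notin; rewrite !dl // dimv0.
have Mu0 : (M *m u) 0 0 != 0.
  apply/negP => /eqP M0.
  have [|/eqP] := @annihilator4 M [:: (3%N, z); (1%N, y)] 1 0 0 0 MU uz isT erefl; last first.
    by rewrite oner_eq0.
  move=> q v; rewrite !inE => /orP[] /eqP -> /=.
    by move=> /z3 E; rewrite /lin4 E; ring.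
  apply: (kill_step (k := 0%N) (y := y) (u := u)) => //.
    by move=> v'; rewrite memv0 => /eqP ->; rewrite mulmx0 /lin4 !mxE; ring.
  by rewrite /lin4 M0; ring.
have [X [f [g vE]]] : exists X f g, (M *m u) = (M *m u) 0 0 *: vec4 1 X f g.
  move: Mu0; move: (M *m u) => w w0.
  exists (w 1 0 / w 0 0), (w 2 0 / w 0 0), (w 3 0 / w 0 0).
  rewrite {1}(vec4_eta w); apply/colP => -[[|[|[|[|//]]]] i];
    by rewrite !mxE /= ?mulr1 // mulrC divfK.
have v1 : pt M 1 X f g \in xk 1 y.
  exact: pt_mem vE u1.
set v := pt M 1 X f g in v1; have Mv : M *m v = vec4 1 X f g by exact: mulKVmx.
have v2 := subvP s12 _ v1; have v3 := subvP s23 _ v2.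
have kill1 p0 p1 p2 p3 : lin4 p0 p1 p2 p3 (M *m v) = 0 ->
    forall w, w \in xk 1 y -> lin4 p0 p1 p2 p3 (M *m w) = 0.
  move=> Hv; apply: (kill_step (k := 0%N) (u := v)) => //.
    rewrite memv0; apply/eqP => v0; move: Mv; rewrite v0 mulmx0 => /colP/(_ 0)/eqP.
    by rewrite !mxE /= eq_sym oner_eq0.
  by move=> v'; rewrite memv0 => /eqP ->; rewrite mulmx0 /lin4 !mxE; ring.
have [u' u2 un'] : exists2 u, u \in xk 2 y & u \notin xk 1 y.
  by apply: exists_notin; rewrite !dl.
pose v' := u' - (M *m u') 0 0 *: v.
have v'2 : v' \in xk 2 y by apply: memvB => //; exact: memvZ.
have v'n : v' \notin xk 1 y.
  by apply: contra un' => H; rewrite -(subrK ((M *m u') 0 0 *: v) u') memvD // memvZ.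
have Mv'0 : (M *m v') 0 0 = 0.
  by rewrite mulmxBr -scalemxAr Mv !mxE /= mulr1 subrr.
have kill2 p0 p1 p2 p3 : lin4 p0 p1 p2 p3 (M *m v) = 0 ->
    lin4 p0 p1 p2 p3 (M *m v') = 0 ->
    forall w, w \in xk 2 y -> lin4 p0 p1 p2 p3 (M *m w) = 0.
  by move=> Hv Hv'; apply: (kill_step (k := 1%N) (u := v')) => //; exact: kill1.
have Mv'1 : (M *m v') 1 0 != 0.
  apply/negP => /eqP M1.
  have [|_ /eqP] := @annihilator4 M [:: (2%N, z); (2%N, y)] (- X) 1 0 0
    MU uz isT erefl; last first.
    by rewrite oner_eq0.
  move=> q w; rewrite !inE => /orP[] /eqP -> /=.
    by move=> /z2[E0 E1]; rewrite /lin4 E0 E1; ring.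
  apply: kill2; first by rewrite Mv lin4_vec4; ring.
  by rewrite /lin4 Mv'0 M1; ring.
have [m [n wE]] : exists m n, (M *m v') = (M *m v') 1 0 *: vec4 0 1 m n.
  move: Mv'0 Mv'1; move: (M *m v') => w w0 w1.
  exists (w 2 0 / w 1 0), (w 3 0 / w 1 0).
  rewrite {1}(vec4_eta w) w0; apply/colP => -[[|[|[|[|//]]]] i];
    by rewrite !mxE /= ?mulr1 ?mulr0 // mulrC divfK.
have w2 : pt M 0 1 m n \in xk 2 y.
  exact: pt_mem wE v'2.
set w := pt M 0 1 m n in w2; have Mw : M *m w = vec4 0 1 m n by exact: mulKVmx.
have w3 := subvP s23 _ w2.
have [u'' u3 un''] : exists2 u, u \in xk 3 y & u \notin xk 2 y.
  by apply: exists_notin; rewrite !dl.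
pose x := u'' - (M *m u'') 0 0 *: v; pose t := x - (M *m x) 1 0 *: w.
have t3 : t \in xk 3 y by do 2?[apply: memvB]; rewrite ?memvZ.
have tn : t \notin xk 2 y.
  apply: contra un'' => H.
  rewrite -(subrK ((M *m u'') 0 0 *: v) u'') memvD ?memvZ //.
  by rewrite -/x -(subrK ((M *m x) 1 0 *: w) x) memvD // memvZ.
have Mx0 : (M *m x) 0 0 = 0.
  by rewrite mulmxBr -scalemxAr Mv !mxE /= mulr1 subrr.
have Mt0 : (M *m t) 0 0 = 0.
  by rewrite mulmxBr -scalemxAr Mw [LHS]mxE Mx0 !mxE /= mulr0 subrr.
have Mt1 : (M *m t) 1 0 = 0.
  by rewrite mulmxBr -scalemxAr Mw !mxE /= mulr1 subrr.
have Mt2 : (M *m t) 2 0 != 0.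
  apply/negP => /eqP M2.
  have [|_ _ /eqP] := @annihilator4 M [:: (1%N, z); (3%N, y)]
    (m * X - f) (- m) 1 0 MU uz isT erefl; last first.
    by rewrite oner_eq0.
  move=> q r; rewrite !inE => /orP[] /eqP -> /=.
    by move=> /z1[E0 E1 E2]; rewrite /lin4 E0 E1 E2; ring.
  apply: (kill_step (k := 2%N) (y := y) (u := t)) => //; last by rewrite /lin4 Mt0 Mt1 M2; ring.
  apply: kill2; first by rewrite Mv lin4_vec4; ring.
  by rewrite wE /lin4 !mxE /=; ring.
have [G GE] : exists G, (M *m t) = (M *m t) 2 0 *: vec4 0 0 1 G.
  move: Mt0 Mt1 Mt2; move: (M *m t) => r r0 r1 r2.
  exists (r 3 0 / r 2 0).
  rewrite {1}(vec4_eta r) r0 r1; apply/colP => -[[|[|[|[|//]]]] i];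
    by rewrite !mxE /= ?mulr1 ?mulr0 // mulrC divfK.
exists X, f, g, m, n, G; split => //.
exact: pt_mem GE t3.
Qed.

End NormalForm.

(** * The Frenet conditions in terms of the coordinate functions *)

Section ChartOfCurve.
Context {R : realType} {B : topologicalType}.
Local Notation Gr := (grassmannian R 4).
Variable xi : B -> Gr * Gr * Gr.
Hypothesis xiF : hyperconvex_frenet xi.
Local Notation xk := (curve_part xi).

Lemma det_rows2 (i0 i1 : 'I_4) (M : 'M[R]_4) u1 u2 :
  \det (rows 2 [:: i0; i1] M *m vecs 2 [:: u1; u2]) =
    (M *m u1) i0 0 * (M *m u2) i1 0 - (M *m u2) i0 0 * (M *m u1) i1 0.
Proof. by rewrite det2E !rows_vecs. Qed.

Lemma det_rows3 (i0 i1 i2 : 'I_4) (M : 'M[R]_4) u1 u2 u3 :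
  \det (rows 3 [:: i0; i1; i2] M *m vecs 3 [:: u1; u2; u3]) =
    let a i := (M *m u1) i 0 in let b i := (M *m u2) i 0 in
    let c i := (M *m u3) i 0 in
    a i0 * (b i1 * c i2 - c i1 * b i2) - b i0 * (a i1 * c i2 - c i1 * a i2)
    + c i0 * (a i1 * b i2 - b i1 * a i2).
Proof. by rewrite det3E !rows_vecs. Qed.

Lemma cvg_plucker k (P' P : 'M[R]_(k, 4)) (T : Type) (F : set_system T)
    (FF : Filter F) (V : T -> Gr) (D : 'M[R]_(4, k)) :
  \det (P *m D) != 0 -> V @ F --> (colspan D : Gr) ->
  plucker P' P (V t) @[t --> F] --> \det (P' *m D) / \det (P *m D).
Proof.
move=> PD VD; rewrite -pluckerE ?(dim_colspan_det PD) //.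
apply: (@continuous_cvg _ _ _ F) VD.
exact: plucker_continuous.
Qed.

Variables (M : 'M[R]_4) (z : B) (c : R -> B) (X f g m n G : R -> R).

Definition normal_chart := forall t, [/\ pt M 1 (X t) (f t) (g t) \in xk 1 (c t),
  pt M 0 1 (m t) (n t) \in xk 2 (c t) & pt M 0 0 1 (G t) \in xk 3 (c t)].

Hypotheses (Mz : adapted xi M z) (cc : continuous c) (ci : injective c)
  (cz : forall t, c t != z) (nc : normal_chart).

Let v t := pt M 1 (X t) (f t) (g t).
Let w t := pt M 0 1 (m t) (n t).
Let u t := pt M 0 0 1 (G t).

Let MU : M \in unitmx. Proof. by case: Mz. Qed.
Let Mpt a b p q : M *m pt M a b p q = vec4 a b p q.
Proof. exact: mulKVmx. Qed.

Let v0 t : (M *m v t) 0 0 = 1. Proof. by rewrite Mpt mxE. Qed.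

Lemma chart_span1 t : colspan (vecs 1 [:: v t]) = xk 1 (c t).
Proof.
apply: (@colspan_vecs _ _ [:: 0] M); rewrite ?(dim_curve xiF) //.
  by rewrite rows_vecs_det1 Mpt mxE oner_eq0.
by move=> [|//] _; have [] := nc t.
Qed.

Lemma chart_span2 t : colspan (vecs 2 [:: v t; w t]) = xk 2 (c t).
Proof.
apply: (@colspan_vecs _ _ [:: 0; 1] M); rewrite ?(dim_curve xiF) //.
  by rewrite det_rows2 !Mpt !mxE /= mul0r subr0 mul1r oner_eq0.
have [v1 w2 _] := nc t.
by move=> [|[|//]] _ //=; exact: (subvP (curve_sub12 xiF _)).
Qed.

Lemma chart_span3 t : colspan (vecs 3 [:: v t; w t; u t]) = xk 3 (c t).
Proof.
apply: (@colspan_vecs _ _ [:: 0; 1; 2] M); rewrite ?(dim_curve xiF) //.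
  rewrite det_rows3 /= !Mpt !mxE /= (_ : _ + _ = 1); first exact: oner_neq0.
  by ring.
have [v1 w2 u3] := nc t; have s23 := subvP (curve_sub23 xiF (c t)).
move=> [|[|[|//]]] _ //=; last exact: s23.
by apply/s23/(subvP (curve_sub12 xiF _)).
Qed.

Lemma chart_cvg_curve k t : xk k (c s) @[s --> t] --> xk k (c t).
Proof.
apply: (@continuous_cvg _ _ _ (nbhs t)).
  exact: curve_continuous.
exact: cc.
Qed.

(** The normalization makes the reference minor equal to 1, so [p] is itself a Pluecker ratio of
    [xi^k] along the curve. *)
Lemma chart_minor_cont k (P' P : 'M[R]_(k, 4)) (us : R -> seq 'cV[R]_4) (p : R -> R) :
  (forall t, colspan (vecs k (us t)) = xk k (c t)) ->
  (forall t, \det (P *m vecs k (us t)) = 1) ->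
  (forall t, \det (P' *m vecs k (us t)) = p t) -> continuous p.
Proof.
move=> uE P1 P'p t.
have := @cvg_plucker k P' P _ (nbhs t) _ (fun s => xk k (c s)) (vecs k (us t)).
rewrite P1 oner_eq0 divr1 P'p uE => /(_ _ isT) H.
apply: cvg_eq1 (H (@chart_cvg_curve k t)) => s.
rewrite -uE pluckerE; first by rewrite P1 P'p divr1.
by apply: (@dim_colspan_det _ _ _ _ P); rewrite P1 oner_eq0.
Qed.

Lemma normal_cont : [/\ continuous X, continuous f & continuous g] /\
  [/\ continuous m, continuous n & continuous G].
Proof.
have v_ t : [/\ (M *m v t) 0 0 = 1, (M *m v t) 1 0 = X t, (M *m v t) 2 0 = f t &
    (M *m v t) 3 0 = g t] by rewrite Mpt !mxE.
have w_ t : [/\ (M *m w t) 0 0 = 0, (M *m w t) 1 0 = 1, (M *m w t) 2 0 = m t &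
    (M *m w t) 3 0 = n t] by rewrite Mpt !mxE.
have u_ t : [/\ (M *m u t) 0 0 = 0, (M *m u t) 1 0 = 0, (M *m u t) 2 0 = 1 &
    (M *m u t) 3 0 = G t] by rewrite Mpt !mxE.
have one i (p : R -> R) : (forall t, (M *m v t) i 0 = p t) -> continuous p.
  move=> vp; apply: (@chart_minor_cont 1 (rows 1 [:: i] M) (rows 1 [:: 0] M)
    (fun t => [:: v t])); first exact: chart_span1.
    by move=> t; rewrite rows_vecs_det1 /=; case: (v_ t).
  by move=> t; rewrite rows_vecs_det1 /= vp.
have two i (p : R -> R) : (forall t, (M *m w t) i 0 = p t) -> continuous p.
  move=> wp; apply: (@chart_minor_cont 2 (rows 2 [:: 0; i] M) (rows 2 [:: 0; 1] M)
    (fun t => [:: v t; w t])); first exact: chart_span2.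
    by move=> t; rewrite det_rows2; case: (v_ t) (w_ t) => -> -> _ _ [-> -> _ _]; ring.
  by move=> t; rewrite det_rows2 wp; case: (v_ t) (w_ t) => -> _ _ _ [-> _ _ _]; ring.
split; split.
- by apply: (one 1) => t; case: (v_ t).
- by apply: (one 2) => t; case: (v_ t).
- by apply: (one 3) => t; case: (v_ t).
- by apply: (two 2) => t; case: (w_ t).
- by apply: (two 3) => t; case: (w_ t).
- apply: (@chart_minor_cont 3 (rows 3 [:: 0; 1; 3] M) (rows 3 [:: 0; 1; 2] M)
    (fun t => [:: v t; w t; u t])); first exact: chart_span3.
    move=> t; rewrite det_rows3 /=.
    by case: (v_ t) (w_ t) (u_ t) => -> -> -> _ [-> -> -> _] [-> -> -> _]; ring.
  move=> t; rewrite det_rows3 /=.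
  by case: (v_ t) (w_ t) (u_ t) => -> -> _ -> [-> -> _ ->] [-> -> _ ->]; ring.
Qed.

Lemma kill_normal1 t p0 p1 p2 p3 u' : lin4 p0 p1 p2 p3 (vec4 1 (X t) (f t) (g t)) = 0 ->
  u' \in xk 1 (c t) -> lin4 p0 p1 p2 p3 (M *m u') = 0.
Proof.
move=> H; rewrite -chart_span1 => /mem_colspan[y ->].
rewrite vecs_mul big_ord_recl big_ord0 addr0 /= -scalemxAr Mpt.
by rewrite -[_ *: _]add0r lin4D H mulr0 addr0 /lin4 !mxE; ring.
Qed.

Lemma kill_normal3 t p0 p1 p2 p3 u' : lin4 p0 p1 p2 p3 (vec4 1 (X t) (f t) (g t)) = 0 ->
  lin4 p0 p1 p2 p3 (vec4 0 1 (m t) (n t)) = 0 ->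
  lin4 p0 p1 p2 p3 (vec4 0 0 1 (G t)) = 0 ->
  u' \in xk 3 (c t) -> lin4 p0 p1 p2 p3 (M *m u') = 0.
Proof.
move=> H1 H2 H3; rewrite -chart_span3 => /mem_colspan[y ->].
rewrite vecs_mul !big_ord_recl big_ord0 addr0 /= !mulmxDr -!scalemxAr !Mpt.
by rewrite addrA -[y _ _ *: vec4 1 _ _ _]add0r !lin4D H1 H2 H3 !mulr0 !addr0 /lin4 !mxE; ring.
Qed.

Lemma kill_base p0 p1 p2 p3 u' :
  [/\ u' \in xk 3 z -> p1 = 0 -> p2 = 0 -> p3 = 0 -> lin4 p0 p1 p2 p3 (M *m u') = 0,
  u' \in xk 2 z -> p2 = 0 -> p3 = 0 -> lin4 p0 p1 p2 p3 (M *m u') = 0 &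
  u' \in xk 1 z -> p3 = 0 -> lin4 p0 p1 p2 p3 (M *m u') = 0].
Proof.
have [_ /(_ u')[H3 H2 H1]] := Mz.
have s23 := subvP (curve_sub23 xiF z); have s12 := subvP (curve_sub12 xiF z).
rewrite /lin4; split=> [uz -> -> ->|uz -> ->|uz ->].
- by rewrite H3 //; ring.
- by rewrite H3 ?H2 //; [ring|exact: s23].
- by rewrite H3 ?H2 ?H1 //; [ring|exact: s12|exact/s23/s12].
Qed.

(** If [X s = X t], the form [x1 - X s * x0] kills [xi^2 z] and both points of [xi^1], which
    together span R^4. *)
Lemma normal_neq s t : s != t -> X s != X t.
Proof.
move=> st; apply/negP => /eqP E.
have u3 : uniq [:: z; c s; c t].
  by rewrite /= !inE negb_or !(eq_sym z) !cz /= andbT (inj_eq ci).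
have [|_ /eqP] := annihilator4 xiF (M := M) (s := [:: (2%N, z); (1%N, c s); (1%N, c t)])
  (p0 := - X s) (p1 := 1) (p2 := 0) (p3 := 0) MU u3 isT erefl; last first.
  by rewrite oner_eq0.
move=> q u'; rewrite !inE => /or3P[] /eqP -> /= u'k.
- by have [_ + _] := kill_base (- X s) 1 0 0 u'; apply.
- by apply: (kill_normal1 (t := s)) => //; rewrite lin4_vec4; ring.
- by apply: (kill_normal1 (t := t)) => //; rewrite lin4_vec4 E; ring.
Qed.

(** Projection from [xi^1 z] drops the last coordinate, so no three points (X, f) are collinear; the
    form used is the equation of the line through the first two. *)
Lemma normal_area_neq0 s t r : uniq [:: s; t; r] -> area X f s t r != 0.
Proof.
move=> str; apply/negP => /eqP E.
have u4 : uniq [:: z; c s; c t; c r].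
  rewrite /= !inE !negb_or !(eq_sym z) !cz /= !(inj_eq ci).
  by move: str; rewrite /= !inE negb_or.
have Xst : X t - X s != 0.
  by rewrite subr_eq0 normal_neq //; move: str; rewrite /= !inE negb_or eq_sym => /andP[/andP[]].
pose l := (f t - f s) / (X t - X s).
have [|_ _ /eqP] := annihilator4 xiF (M := M)
  (s := [:: (1%N, z); (1%N, c s); (1%N, c t); (1%N, c r)])
  (p0 := l * X s - f s) (p1 := - l) (p2 := 1) (p3 := 0) MU u4 isT erefl; last first.
  by rewrite oner_eq0.
move=> q u'; rewrite !inE => /or4P[] /eqP -> /= u'k.
- by have [_ _] := kill_base (l * X s - f s) (- l) 1 0 u'; apply.
- by apply: (kill_normal1 (t := s)) => //; rewrite lin4_vec4; ring.
- by apply: (kill_normal1 (t := t)) => //; rewrite lin4_vec4 /l; field.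
- apply: (kill_normal1 (t := r)) => //; rewrite lin4_vec4.
  have -> : (l * X s - f s) * 1 + - l * X r + 1 * f r + 0 * g r
      = area X f s t r / (X t - X s) by rewrite /l /area; field.
  by rewrite E mul0r.
Qed.

(** A common ratio [a] for two triples sharing [t] and [r] makes [g - a * f] affine in [X] at all
    four parameters, and the four points of [xi^1] coplanar. *)
Lemma normal_ratio_neq s t r q : uniq [:: s; t; r; q] ->
  area X f t r q * area X g s t r != area X f s t r * area X g t r q.
Proof.
move=> strq; apply/negP => /eqP E.
have u4 : uniq [:: c s; c t; c r; c q] by rewrite -(map_inj_uniq ci) in strq.
have A1 : area X f s t r != 0.
  by apply: normal_area_neq0; move: strq => /(take_uniq 3).
have Xtr : X r - X t != 0.
  rewrite subr_eq0 normal_neq // eq_sym.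
  by move: strq; rewrite /= !inE !negb_or => /and3P[_ /andP[]].
pose a := area X g s t r / area X f s t r.
pose l := ((g r - a * f r) - (g t - a * f t)) / (X r - X t).
have [|_ _ _ /eqP] := annihilator4 xiF (M := M)
  (s := [:: (1%N, c s); (1%N, c t); (1%N, c r); (1%N, c q)])
  (p0 := l * X t - (g t - a * f t)) (p1 := - l) (p2 := - a) (p3 := 1) MU u4 isT erefl;
  last by rewrite oner_eq0.
have Eg : area X g s t r = a * area X f s t r by rewrite /a divfK.
have Eq : area X g t r q = a * area X f t r q.
  by apply: (mulfI A1); rewrite -E Eg; ring.
move=> p u'; rewrite !inE => /or4P[] /eqP -> /= u'k.
- apply: (kill_normal1 (t := s)) => //; rewrite lin4_vec4.
  have -> : (l * X t - (g t - a * f t)) * 1 + - l * X s + - a * f s + 1 * g s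
      = (area X g s t r - a * area X f s t r) / (X r - X t).
    by rewrite /l /area; field.
  by rewrite Eg subrr mul0r.
- by apply: (kill_normal1 (t := t)) => //; rewrite lin4_vec4; ring.
- by apply: (kill_normal1 (t := r)) => //; rewrite lin4_vec4 /l; field.
- apply: (kill_normal1 (t := q)) => //; rewrite lin4_vec4.
  have -> : (l * X t - (g t - a * f t)) * 1 + - l * X q + - a * f q + 1 * g q
      = (area X g t r q - a * area X f t r q) / (X r - X t).
    by rewrite /l /area; field.
  by rewrite Eq subrr mul0r.
Qed.

(** Equality would put [xi^1 (c y)] inside [xi^3 (c x)]. *)
Lemma normal_transverse x y : x != y ->
  g y - g x - n x * (X y - X x) != G x * (f y - f x - m x * (X y - X x)).
Proof.
move=> xy; apply/negP => /eqP E.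
have u2 : uniq [:: c x; c y] by rewrite /= !inE (inj_eq ci) xy.
have [|_ _ _ /eqP] := annihilator4 xiF (M := M) (s := [:: (3%N, c x); (1%N, c y)])
  (p0 := - g x + n x * X x + G x * (f x - m x * X x)) (p1 := - n x + G x * m x)
  (p2 := - G x) (p3 := 1) MU u2 isT erefl; last by rewrite oner_eq0.
move=> q u'; rewrite !inE => /orP[] /eqP -> /= u'k.
  by apply: (kill_normal3 (t := x)) => //; rewrite lin4_vec4; ring.
apply: (kill_normal1 (t := y)) => //; rewrite lin4_vec4.
have -> : (- g x + n x * X x + G x * (f x - m x * X x)) * 1 +
    (- n x + G x * m x) * X y + - G x * f y + 1 * g y =
    (g y - g x - n x * (X y - X x)) - G x * (f y - f x - m x * (X y - X x)) by ring.
by rewrite E subrr.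
Qed.

Lemma chord_span x y : x != y ->
  colspan (vecs 2 [:: v x; v y]) = (xk 1 (c x) + xk 1 (c y))%VS :> Gr.
Proof.
move=> xy; apply: (@colspan_vecs _ _ [:: 0; 1] M).
- by rewrite det_rows2 !Mpt !mxE /= mul1r mul1r subr_eq0 eq_sym normal_neq.
- apply: leq_trans (leq_of_leqif (dimv_add_leqif _ _)) _.
  by rewrite !(dim_curve xiF).
- have [vx _ _] := nc x; have [vy _ _] := nc y.
  by move=> [|[|//]] _ /=; [apply: (subvP (addvSl _ _))|apply: (subvP (addvSr _ _))].
Qed.

Lemma triple_span x y t : uniq [:: x; y; t] ->
  colspan (vecs 3 [:: v x; v y; v t])
    = (xk 1 (c x) + (xk 1 (c y) + xk 1 (c t)))%VS :> Gr.
Proof.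
move=> xyt; have A := normal_area_neq0 xyt; apply: (@colspan_vecs _ _ [:: 0; 1; 2] M).
- apply: contra A => /eqP; rewrite det_rows3 /= !Mpt !mxE /= => <-.
  by apply/eqP; rewrite /area; ring.
- apply: leq_trans (leq_of_leqif (dimv_add_leqif _ _)) _.
  rewrite (dim_curve xiF) // add1n ltnS.
  apply: leq_trans (leq_of_leqif (dimv_add_leqif _ _)) _.
  by rewrite !(dim_curve xiF).
- have [vx _ _] := nc x; have [vy _ _] := nc y; have [vt _ _] := nc t.
  move=> [|[|[|//]]] _ /=; first exact: (subvP (addvSl _ _)).
    by apply: (subvP (addvSr _ _)); exact: (subvP (addvSl _ _)).
  by apply: (subvP (addvSr _ _)); exact: (subvP (addvSr _ _)).
Qed.

Lemma cvg_param (s : nat -> R) x : s @ \oo --> x -> c (s k) @[k --> \oo] --> c x.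
Proof. by move=> sx; apply: (@continuous_cvg _ _ _ \oo) sx; exact: cc. Qed.

(** The minor of rows 0, [i] divided by that of rows 0, 1 is [slope X p] for a chord and [p' t] for
    the tangent line, so convergence of chords to [xi^2] is convergence of slopes. *)
Lemma normal_tangent (i : 'I_4) (p p' : R -> R) :
  (forall t, (M *m v t) i 0 = p t) -> (forall t, (M *m w t) i 0 = p' t) ->
  forall t, tangent X p t (p' t).
Proof.
move=> vp wp t s st sc.
have cst_ : c t @[_ --> \oo] --> c t by exact: cvg_cst.
have cn k : c t != c (s k) by rewrite (inj_eq ci) eq_sym.
have := frenet_cvg2 xiF cn cst_ (cvg_param sc); rewrite -chart_span2.
have PD : \det (rows 2 [:: 0; 1] M *m vecs 2 [:: v t; w t]) = 1.
  by rewrite det_rows2 !Mpt !mxE /=; ring.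
have PD0 : \det (rows 2 [:: 0; 1] M *m vecs 2 [:: v t; w t]) != 0.
  by rewrite PD oner_eq0.
move=> /(@cvg_plucker _ (rows 2 [:: 0; i] M) _ _ _ _ _ _ PD0).
rewrite PD divr1 det_rows2 wp [(M *m v t) 0 0]v0 mul1r !Mpt !mxE mul0r subr0.
apply: cvg_eq1 => k; have tsk : t != s k by rewrite eq_sym.
rewrite -chord_span // pluckerE.
  by rewrite !det_rows2 !vp !v0 !mul1r !Mpt !mxE.
rewrite chord_span //; apply/eqP; rewrite -chord_span //.
rewrite (@dim_colspan_det _ _ _ _ (rows 2 [:: 0; 1] M)) //.
by rewrite det_rows2 !Mpt !mxE /= mul1r mul1r subr_eq0 normal_neq.
Qed.

(** The minor of rows 0, 1, 3 divided by that of rows 0, 1, 2 is the ratio of the two areas for a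
    triple of points, and [G x] for [xi^3]. *)
Lemma normal_osculating x (a b d : nat -> R) : (forall k, uniq [:: a k; b k; d k]) ->
  a @ \oo --> x -> b @ \oo --> x -> d @ \oo --> x ->
  area X g (a k) (b k) (d k) / area X f (a k) (b k) (d k) @[k --> \oo] --> G x.
Proof.
move=> abd ax bx dx.
have cn k : uniq [:: c (a k); c (b k); c (d k)].
  by have := abd k; rewrite -(map_inj_uniq ci).
have := frenet_cvg3 xiF cn (cvg_param ax) (cvg_param bx) (cvg_param dx).
rewrite -chart_span3.
have PD : \det (rows 3 [:: 0; 1; 2] M *m vecs 3 [:: v x; w x; u x]) = 1.
  by rewrite det_rows3 /= !Mpt !mxE /=; ring.
have PD0 : \det (rows 3 [:: 0; 1; 2] M *m vecs 3 [:: v x; w x; u x]) != 0.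
  by rewrite PD oner_eq0.
have PD' : \det (rows 3 [:: 0; 1; 3] M *m vecs 3 [:: v x; w x; u x]) = G x.
  by rewrite det_rows3 /= !Mpt !mxE /=; ring.
move=> /(@cvg_plucker _ (rows 3 [:: 0; 1; 3] M) _ _ _ _ _ _ PD0).
rewrite PD divr1 PD'.
apply: cvg_eq1 => k; rewrite -triple_span // pluckerE.
  rewrite !det_rows3 /= !Mpt !mxE /=; congr (_ / _); rewrite /area; ring.
rewrite (@dim_colspan_det _ _ _ _ (rows 3 [:: 0; 1; 2] M)) //.
have := normal_area_neq0 (abd k); apply: contra => /eqP.
rewrite det_rows3 /= !Mpt !mxE /= => <-.
by apply/eqP; rewrite /area; ring.
Qed.

Lemma normal_frenet_chart : incr X ->
  (forall a b d, a < b -> b < d -> 0 < area X f a b d) ->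
  (forall a b d e, a < b -> b < d -> d < e ->
     area X f b d e * area X g a b d < area X f a b d * area X g b d e) ->
  frenet_chart X f g m n G.
Proof.
move=> Xi cvx rat; have [[cX cf cg] [cm cn cG]] := normal_cont.
split => //.
- by apply: (@normal_tangent 2) => t; rewrite Mpt mxE.
- by apply: (@normal_tangent 3) => t; rewrite Mpt mxE.
- move=> x a b d abd; apply: normal_osculating => k.
  have /andP[ab bd] := abd k; rewrite /= !inE negb_or !lt_eqF //.
  exact: lt_trans bd.
- exact: normal_transverse.
Qed.

End ChartOfCurve.

(** * Constancy of signs on increasing tuples *)

Section Signs.
Context {R : realType}.

Definition ordered k (a : 'I_k -> R) := forall i j : 'I_k, (i < j)%N -> a i < a j.

Let seg k (a b : 'I_k -> R) t i := a i + t * (b i - a i).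

(* Ordered tuples form a convex set, on which the sign of a non-vanishing
   continuous function is constant. *)
Lemma sign_const k (h : ('I_k -> R) -> R) :
  (forall a, ordered a -> h a != 0) ->
  (forall a b, continuous (fun t => h (seg a b t))) ->
  (forall a, ordered a -> 0 < h a) \/ (forall a, ordered a -> h a < 0).
Proof.
move=> h0 hc; pose a0 (i : 'I_k) : R := i%:R.
have o0 : ordered a0 by move=> i j ij; rewrite ltr_nat.
have os a b t : ordered a -> ordered b -> 0 <= t <= 1 -> ordered (seg a b t).
  move=> oa ob /andP[t0 t1] i j ij; have := oa i j ij; have := ob i j ij => bij aij.
  rewrite /seg; have [->|tn0] := eqVneq t 0; first by rewrite !mul0r !addr0.
  have tp : 0 < t by rewrite lt_def tn0.
  have := mulr_gt0 tp (_ : 0 < b j - b i); rewrite subr_gt0 => /(_ bij) H1.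
  have : 0 <= (1 - t) * (a j - a i) by rewrite mulr_ge0 // subr_ge0 // ltW.
  lra.
have same a : ordered a -> 0 < h a0 * h a.
  move=> oa; pose p t := h (seg a0 a t).
  have p0 : p 0 = h a0 by congr h; apply/funext => i; rewrite /seg mul0r addr0.
  have p1 : p 1 = h a by congr h; apply/funext => i; rewrite /seg mul1r addrC subrK.
  rewrite -p0 -p1 ltNge; apply/negP => le0.
  have [||t] := @IVT _ p 0 1 0 ler01.
  - exact/continuous_subspaceT/hc.
  - by rewrite ge_min le_max; apply/andP; split; apply/orP;
      have [] := lerP (p 0) 0; have [] := lerP (p 1) 0; (try by auto); nra.
  - rewrite in_itv /= => t01 /eqP; rewrite /p (negPf (h0 _ _)) //; exact: os.
have := h0 _ o0; rewrite neq_lt => /orP[hn|hp]; [right|left] => a /same.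
  by rewrite nmulr_rgt0.
by rewrite pmulr_rgt0.
Qed.

Lemma area_cvg (X h : R -> R) (T : Type) (F : set_system T) (FF : Filter F)
    (a b d : T -> R) a0 b0 d0 : continuous X -> continuous h ->
  a @ F --> a0 -> b @ F --> b0 -> d @ F --> d0 ->
  area X h (a t) (b t) (d t) @[t --> F] --> area X h a0 b0 d0.
Proof.
move=> Xc hc aa bb dd.
have cX (s : T -> R) s0 : s @ F --> s0 -> X (s t) @[t --> F] --> X s0.
  by move=> ss; apply: continuous_cvg ss; exact: Xc.
have ch (s : T -> R) s0 : s @ F --> s0 -> h (s t) @[t --> F] --> h s0.
  by move=> ss; apply: continuous_cvg ss; exact: hc.
by apply: cvgB; apply: cvgM; apply: cvgB; by [exact: cX|exact: ch].
Qed.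

Lemma seg_cvg (a b : R) : continuous (fun t : R => a + t * (b - a)).
Proof.
move=> t; apply: (@cvgD _ _ _ (nbhs t)); first exact: cvg_cst.
by apply: (@cvgM _ _ (nbhs t)); [exact: cvg_id|exact: cvg_cst].
Qed.

Lemma sign_area (X f : R -> R) : continuous X -> continuous f ->
  (forall a b d, uniq [:: a; b; d] -> area X f a b d != 0) ->
  (forall a b d, a < b -> b < d -> 0 < area X f a b d) \/
  (forall a b d, a < b -> b < d -> area X f a b d < 0).
Proof.
move=> Xc fc A0.
have [a ao|a b t|H|H] := @sign_const 3 (fun a => area X f (a 0) (a 1) (a 2)).
- apply: A0; rewrite /= !inE negb_or !lt_eqF //; exact: ao.
- by apply: (@area_cvg _ _ _ (nbhs t)) => //; exact: seg_cvg.
- left=> a b d ab bd; apply: (H (fun i => [:: a; b; d]`_i)).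
  by move=> [[|[|[|//]]] i] [[|[|[|//]]] j] //= _; exact: lt_trans bd.
- right=> a b d ab bd; apply: (H (fun i => [:: a; b; d]`_i)).
  by move=> [[|[|[|//]]] i] [[|[|[|//]]] j] //= _; exact: lt_trans bd.
Qed.

Lemma sign_incr (X : R -> R) : continuous X -> (forall s t, s != t -> X s != X t) ->
  incr X \/ (forall s t, s < t -> X t < X s).
Proof.
move=> Xc X0.
have [a ao|a b t|H|H] := @sign_const 2 (fun a => X (a 1) - X (a 0)).
- by rewrite subr_eq0 X0 // gt_eqF // ao.
- by apply: (@cvgB _ _ _ (nbhs t)); apply: (@continuous_cvg _ _ _ (nbhs t));
    by [exact: Xc|exact: seg_cvg].
- left=> a b ab; rewrite -subr_gt0; apply: (H (fun i => [:: a; b]`_i)).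
  by move=> [[|[|//]] i] [[|[|//]] j].
- right=> a b ab; rewrite -subr_lt0; apply: (H (fun i => [:: a; b]`_i)).
  by move=> [[|[|//]] i] [[|[|//]] j].
Qed.

Lemma sign_ratio (X f g : R -> R) : continuous X -> continuous f -> continuous g ->
  (forall a b d e, uniq [:: a; b; d; e] ->
     area X f b d e * area X g a b d != area X f a b d * area X g b d e) ->
  (forall a b d e, a < b -> b < d -> d < e ->
     area X f b d e * area X g a b d < area X f a b d * area X g b d e) \/
  (forall a b d e, a < b -> b < d -> d < e ->
     area X f a b d * area X g b d e < area X f b d e * area X g a b d).
Proof.
move=> Xc fc gc A0.
have [a ao|a b t|H|H] := @sign_const 4 (fun a =>
    area X f (a 0) (a 1) (a 2) * area X g (a 1) (a 2) (a 3)
    - area X f (a 1) (a 2) (a 3) * area X g (a 0) (a 1) (a 2)).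
- by rewrite subr_eq0 eq_sym A0 //= !inE !negb_or !lt_eqF //; exact: ao.
- by apply: (@cvgB _ _ _ (nbhs t)); apply: (@cvgM _ _ (nbhs t));
    apply: (@area_cvg _ _ _ (nbhs t)) => //; exact: seg_cvg.
- left=> a b d e ab bd de; rewrite -subr_gt0; apply: (H (fun i => [:: a; b; d; e]`_i)).
  have ad := lt_trans ab bd; have be := lt_trans bd de; have ae := lt_trans ad de.
  by move=> [[|[|[|[|//]]]] i] [[|[|[|[|//]]]] j].
- right=> a b d e ab bd de; rewrite -subr_lt0; apply: (H (fun i => [:: a; b; d; e]`_i)).
  have ad := lt_trans ab bd; have be := lt_trans bd de; have ae := lt_trans ad de.
  by move=> [[|[|[|[|//]]]] i] [[|[|[|[|//]]]] j].
Qed.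

End Signs.

Section FrameChart.
Context {R : realType} {B : topologicalType}.
Local Notation Gr := (grassmannian R 4).
Variable xi : B -> Gr * Gr * Gr.
Hypotheses (xiF : hyperconvex_frenet xi) (circleB : is_topological_circle (R := R) B).
Local Notation xk := (curve_part xi).

Definition flip (e1 e2 e3 : R) (M : 'M[R]_4) : 'M[R]_4 :=
  diag_mx (\row_i [:: 1; e1; e2; e3]`_i) *m M.

Lemma flipE e1 e2 e3 M u : flip e1 e2 e3 M *m u =
  vec4 ((M *m u) 0 0) (e1 * (M *m u) 1 0) (e2 * (M *m u) 2 0) (e3 * (M *m u) 3 0).
Proof.
rewrite /flip -mulmxA mul_diag_mx [M *m u]vec4_eta.
apply/colP => -[[|[|[|[|//]]]] i]; by rewrite [LHS]mxE [RHS]mxE !mxE /= ?mul1r.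
Qed.

Lemma flip_unit e1 e2 e3 M : e1 != 0 -> e2 != 0 -> e3 != 0 -> M \in unitmx ->
  flip e1 e2 e3 M \in unitmx.
Proof.
move=> e10 e20 e30 MU; rewrite /flip unitmx_mul MU andbT unitmxE det_diag unitfE.
by rewrite !big_ord_recl big_ord0 !mxE /= mul1r mulr1 !mulf_neq0.
Qed.

Lemma flip_adapted e1 e2 e3 M z : e1 != 0 -> e2 != 0 -> e3 != 0 ->
  adapted xi M z -> adapted xi (flip e1 e2 e3 M) z.
Proof.
move=> e10 e20 e30 [MU Mz]; split; first exact: flip_unit.
move=> u; have := Mz u; rewrite flipE; move: (M *m u) => r [H3 H2 H1]; rewrite !mxE /=.
by split=> [/H3 //|uz|uz]; rewrite ?H2 ?H1 // mulr0.
Qed.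

(** The factor [e3 / e2] of [G] comes from rescaling (0, 0, e2, e3 G) to third entry 1. *)
Lemma flip_normal e2 e3 M c X f g m n G : M \in unitmx ->
  e2 != 0 -> e3 != 0 -> normal_chart xi M c X f g m n G ->
  normal_chart xi (flip 1 e2 e3 M) c X (fun t => e2 * f t) (fun t => e3 * g t)
    (fun t => e2 * m t) (fun t => e3 * n t) (fun t => e3 / e2 * G t).
Proof.
move=> MU e20 e30 nc t; have [v1 w2 u3] := nc t.
have FU : flip 1 e2 e3 M \in unitmx by rewrite flip_unit ?oner_neq0.
split.
- apply: (pt_mem (s := 1)) v1; rewrite ?oner_neq0 //.
  by rewrite flipE mulKVmx // scale1r !mxE /= mul1r.
- apply: (pt_mem (s := 1)) w2; rewrite ?oner_neq0 //.
  by rewrite flipE mulKVmx // scale1r !mxE /= mul1r.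
- apply: (pt_mem (s := e2)) u3 => //.
  rewrite flipE mulKVmx //; apply/colP => -[[|[|[|[|//]]]] i]; rewrite !mxE /=;
    by [rewrite mulr0|rewrite !mulr0|field].
Qed.

(** Three inequalities hold up to sign: monotonicity of [X] is restored by reversing the parameter,
    convexity of [f] by [e2], the ratio condition by [e3]. The first two rows of [M] are thus
    untouched, which lets [sheet_frame_ex] control on which side a point lies. *)
Lemma frame_chart M z : adapted xi M z ->
  exists (M' : 'M[R]_4) (c : R -> B) (t : B -> R) (X f g m n G : R -> R),
  [/\ adapted xi M' z,
      forall u : 'cV[R]_4, (M' *m u) 0 0 = (M *m u) 0 0 /\ (M' *m u) 1 0 = (M *m u) 1 0,
      param_chart z c t, normal_chart xi M' c X f g m n G &
      frenet_chart X f g m n G].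
Proof.
move=> Mz; have [MU _] := Mz.
have [c0 [t0 pc0]] := circle_chart circleB z.
have norm_ex c t : param_chart z c t -> exists (X f g m n G : R -> R),
    normal_chart xi M c X f g m n G.
  move=> [_ _ cz _ _].
  have /choice[p pE] s : exists p : (R * R * R) * (R * R * R),
    [/\ pt M 1 p.1.1.1 p.1.1.2 p.1.2 \in xk 1 (c s),
      pt M 0 1 p.2.1.1 p.2.1.2 \in xk 2 (c s) & pt M 0 0 1 p.2.2 \in xk 3 (c s)].
    have [X [f [g [m [n [G H]]]]]] := normal_form xiF Mz (cz s).
    by exists ((X, f, g), (m, n, G)).
  exists (fun s => (p s).1.1.1), (fun s => (p s).1.1.2), (fun s => (p s).1.2),
    (fun s => (p s).2.1.1), (fun s => (p s).2.1.2), (fun s => (p s).2.2).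
  exact: pE.
have [X0 [f0 [g0 [m0 [n0 [G0 nc0]]]]]] := norm_ex _ _ pc0.
have [c [t [X [f [g [m [n [G [pc nc Xi]]]]]]]]] : exists c t X f g m n G,
    [/\ param_chart z c t, normal_chart xi M c X f g m n G & incr X].
  have [cc0 ct0 cz0 tc0 cn0] := pc0.
  have ci0 := can_inj ct0.
  have [[cX _ _] _] := normal_cont xiF Mz cc0 nc0.
  have [Xi|Xd] := sign_incr cX (normal_neq xiF Mz ci0 cz0 nc0).
    by exists c0, t0, X0, f0, g0, m0, n0, G0.
  exists (c0 \o -%R), (fun y => - t0 y), (X0 \o -%R), (f0 \o -%R), (g0 \o -%R),
    (m0 \o -%R), (n0 \o -%R), (G0 \o -%R); split.
  - split.
    + move=> s; apply: (@continuous_comp _ _ _ (-%R) c0); [exact: opp_continuous|exact: cc0].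
    + by move=> s; rewrite /= ct0 opprK.
    + by move=> s; exact: cz0.
    + by move=> y yz; rewrite /= opprK tc0.
    + move=> s e e0; apply: filterS (cn0 (- s) e e0) => y [yz ye]; split => //.
      by move: ye; rewrite opprK -[X in _ -> X < _]normrN opprD !opprK.
  - by move=> s; exact: nc0.
  - by move=> s s' ss; apply: Xd; rewrite ltrN2.
have [cc ct cz _ _] := pc; have ci := can_inj ct.
have [[cX cf cg] _] := normal_cont xiF Mz cc nc.
have [e2 e20 A2] : exists2 e2, e2 != 0 &
    forall a b d, a < b -> b < d -> 0 < area X (fun s => e2 * f s) a b d.
  have aE e a b d : area X (fun s => e * f s) a b d = e * area X f a b d.
    by rewrite /area; ring.
  have [H|H] := sign_area cX cf (normal_area_neq0 xiF Mz ci cz nc).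
    by exists 1; rewrite ?oner_neq0 // => a b d ab bd; rewrite aE mul1r H.
  exists (-1); first by rewrite oppr_eq0 oner_neq0.
  by move=> a b d ab bd; rewrite aE mulN1r oppr_gt0 H.
have one0 : (1 : R) != 0 by exact: oner_neq0.
have nc2 := flip_normal MU e20 one0 nc.
have M2 := flip_adapted one0 e20 one0 Mz.
have [[_ cf2 cg2] _] := normal_cont xiF M2 cc nc2.
have [e3 e30 A3] : exists2 e3, e3 != 0 & forall a b d e, a < b -> b < d -> d < e ->
     area X (fun s => e2 * f s) b d e * area X (fun s => e3 * g s) a b d
     < area X (fun s => e2 * f s) a b d * area X (fun s => e3 * g s) b d e.
  have aE e a b d : area X (fun s => e * g s) a b d = e * area X g a b d.
    by rewrite /area; ring.
  have [H|H] := sign_ratio cX cf2 cg2 (normal_ratio_neq xiF M2 ci cz nc2).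
    by exists 1; rewrite ?oner_neq0.
  exists (-1); first by rewrite oppr_eq0 oner_neq0.
  move=> a b d e ab bd de; have := H _ _ _ _ ab bd de.
  by rewrite !aE !mul1r !mulN1r !mulrN ltrN2.
have nc3 := flip_normal MU e20 e30 nc; have M3 := flip_adapted one0 e20 e30 Mz.
exists (flip 1 e2 e3 M), c, t, X, (fun s => e2 * f s), (fun s => e3 * g s),
  (fun s => e2 * m s), (fun s => e3 * n s), (fun s => e3 / e2 * G s); split => //.
  by move=> u; rewrite flipE; move: (M *m u) => r; rewrite !mxE /= mul1r.
exact: (normal_frenet_chart xiF M3 cc ci cz nc3).
Qed.

End FrameChart.

(** * Smooth points and convexity *)

Section RuledSurface.
Context {R : realType} {B : topologicalType}.
Local Notation Gr := (grassmannian R 4).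
Variable xi : B -> Gr * Gr * Gr.
Hypotheses (xiF : hyperconvex_frenet xi) (circleB : is_topological_circle (R := R) B).
Local Notation xk := (curve_part xi).

Section InChart.
Variables (M : 'M[R]_4) (z : B) (c : R -> B) (t : B -> R) (X f g m n G : R -> R).
Hypotheses (Mz : adapted xi M z) (pc : param_chart z c t)
  (nc : normal_chart xi M c X f g m n G) (C : frenet_chart X f g m n G).

Let MU : M \in unitmx. Proof. by case: Mz. Qed.
Let cz s : c s != z. Proof. by case: pc. Qed.
Let ct : cancel c t. Proof. by case: pc. Qed.
Let tc y : y != z -> c (t y) = y. Proof. by case: pc => _ _ _ + _; apply. Qed.

Local Notation chart := (affine_chart (invmx M)).

(** A form that vanishes on the hyperplane [xi^3 z] and at a vector outside it is zero; the pair
    [(4, z)] stands for the whole space. *)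
Lemma vertical_lin (u : 'cV[R]_4) : (u \notin xk 3 z) -> (M *m u) 0 0 != 0.
Proof.
move=> uz; apply/negP => /eqP u0.
have [|/eqP] := annihilator4 xiF (M := M) (s := [:: (4%N, z)])
  (p0 := 1) (p1 := 0) (p2 := 0) (p3 := 0) MU isT isT erefl; last by rewrite oner_eq0.
move=> q v; rewrite inE => /eqP -> /= _.
apply: (kill_step xiF (k := 3%N) (y := z) (u := u)) => //.
- exact: subvf.
- exact: memvf.
- move=> w wz; have [H _ _] := kill_base xiF Mz 1 0 0 0 w; exact: H.
- by rewrite /lin4 u0; ring.
- exact: memvf.
Qed.

Lemma chart_rule v s : projectivization (xk 2 (c s)) (chart v) <->
  v 1 0 = ruleY X f m s (v 0 0) /\ v 2 0 = ruleZ X g n s (v 0 0).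
Proof.
have [v1 w2 _] := nc s; have v2 := subvP (curve_sub12 xiF _) _ v1.
have E b : invmx M *m vec4 1 (X s + b) (f s + b * m s) (g s + b * n s) \in xk 2 (c s).
  have -> : vec4 1 (X s + b) (f s + b * m s) (g s + b * n s) =
      vec4 1 (X s) (f s) (g s) + b *: vec4 0 1 (m s) (n s).
    by apply/colP => -[[|[|[|[|//]]]] i]; rewrite !mxE /= ?mulr0 ?mulr1 ?addr0.
  by rewrite mulmxDr -scalemxAr memvD // memvZ.
split=> [[_]|[vY vZ]].
  rewrite affine_chartE -memvE -(chart_span2 xiF Mz nc) => /mem_colspan[w].
  rewrite vecs_mul !big_ord_recl big_ord0 addr0 /= => /(congr1 (mulmx M)).
  rewrite mulKVmx // mulmxDr -!scalemxAr !mulKVmx // => /colP H.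
  have := H 0; have := H 1; have := H 2; have := H 3; rewrite !mxE /= => h3 h2 h1 h0.
  have h0' : w 0 0 = 1 by rewrite h0; ring.
  have h1' : w (lift ord0 ord0) 0 = v 0 0 - X s by rewrite h1 h0'; ring.
  by rewrite /ruleY /ruleZ h2 h3 h0' h1'; split; ring.
split; first exact: chart_RP3.
rewrite affine_chartE -memvE; have := E (v 0 0 - X s).
by rewrite /aff vY vZ /ruleY /ruleZ addrC subrK.
Qed.

Lemma chart_not_base v : ~ projectivization (xk 2 z) (chart v).
Proof.
move=> [_]; rewrite affine_chartE -memvE => /(subvP (curve_sub23 xiF z)).
have [_ /(_ (invmx M *m aff v))[H _ _]] := Mz => /H.
by rewrite mulKVmx // mxE /= => /eqP; rewrite oner_eq0.
Qed.

Lemma chart_dOmega v : dOmega xi (chart v) <-> exists s,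
  v 1 0 = ruleY X f m s (v 0 0) /\ v 2 0 = ruleZ X g n s (v 0 0).
Proof.
split=> [[y _]|[s /chart_rule H]]; last by exists (c s).
have [->|yz] := eqVneq y z; first by move=> /chart_not_base.
by rewrite -(tc yz) => /chart_rule H; exists (t y).
Qed.

Lemma chart_point (u : 'cV[R]_4) s : u \in xk 1 (c s) ->
  M *m u = (M *m u) 0 0 *: vec4 1 (X s) (f s) (g s).
Proof.
rewrite -(chart_span1 xiF Mz nc) => /mem_colspan[w ->].
rewrite vecs_mul big_ord_recl big_ord0 addr0 /= -scalemxAr mulKVmx //.
by rewrite !mxE /= mulr1.
Qed.

Lemma chart_on_curve (v : 'cV[R]_3) s : v 0 0 = X s -> v 1 0 = ruleY X f m s (v 0 0) ->
  v 2 0 = ruleZ X g n s (v 0 0) -> chart v = xk 1 (c s).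
Proof.
move=> vX; rewrite vX /ruleY /ruleZ subrr !mul0r !addr0 => vY vZ.
apply/esym/chart_mem; rewrite ?(dim_curve xiF) //.
by rewrite /aff vX vY vZ; have [] := nc s.
Qed.

End InChart.

(** If a first [z] fails, then in coordinates adapted to [z] the point is the direction (0, 1, m, n)
    of its tangent line. The form of any other osculating plane takes there a non-zero multiple of
    [dgap], which is positive; [s + 1] is merely a parameter other than [s]. *)
Lemma osculating_avoid x0 (p : Gr) : RP3 p -> (p <= xk 2 x0)%VS -> p != xk 1 x0 ->
  exists2 z, z != x0 & ~~ (p <= xk 3 z)%VS.
Proof.
move=> p1 px0 pn; have [c0 [t0 [_ _ cn0 _ _]]] := circle_chart circleB x0.
set z := c0 0; have zx : z != x0 by exact: cn0.
have [pz|] := boolP (p <= xk 3 z)%VS; last by exists z.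
have [M0 M0z] := adapted_ex xiF z.
have [M [c [t [X [f [g [m [n [G [Mz _ pc nc C]]]]]]]]]] := frame_chart xiF circleB M0z.
have [MU _] := Mz; have [_ ct cz tc _] := pc.
have xz : x0 != z by rewrite eq_sym.
have [u uE] := colspan_ex p1; have pE : p = <[u]>%VS by rewrite -uE colspan_line.
have uz : u \in xk 3 z by rewrite memvE -pE.
have u0 : u != 0 by have := p1; rewrite /RP3 /= pE dim_vline; case: (u != 0).
pose s := t x0; have cs : c s = x0 by exact: tc.
have : u \in xk 2 (c s) by rewrite cs memvE -pE.
rewrite -(chart_span2 xiF Mz nc) => /mem_colspan[w].
rewrite vecs_mul !big_ord_recl big_ord0 addr0 /= => uw.
have Mu : M *m u = w 0 0 *: vec4 1 (X s) (f s) (g s)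
    + w (lift ord0 ord0) 0 *: vec4 0 1 (m s) (n s).
  by rewrite uw mulmxDr -!scalemxAr !mulKVmx.
have w0 : w 0 0 = 0.
  have [_ /(_ u)[/(_ uz)]] := Mz; rewrite Mu !mxE /= mulr1 mulr0 addr0 //.
move: Mu uw; rewrite w0 !scale0r !add0r; set b := w _ 0 => Mu uw.
have b0 : b != 0 by apply: contra u0 => /eqP b0; rewrite uw b0 scale0r.
have ss : s + 1 != s by rewrite -subr_eq0 addrAC subrr add0r oner_eq0.
exists (c (s + 1)); first by rewrite -cs (inj_eq (can_inj ct)).
rewrite pE -memvE; apply/negP => us.
set x := s + 1 in ss us.
have : lin4 (- g x + n x * X x + G x * (f x - m x * X x)) (- n x + G x * m x) (- G x) 1
    (M *m u) = 0.
  by apply: (kill_normal3 xiF Mz nc) us; rewrite lin4_vec4; ring.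
rewrite Mu -[_ *: _]add0r lin4D lin4_vec4.
have [d0 _] := gap_bound C ss.
rewrite (_ : lin4 _ _ _ _ 0 = 0); last by rewrite /lin4 !mxE; ring.
rewrite add0r => /eqP; rewrite mulf_eq0 (negPf b0) /=.
move=> /eqP E; have : dgap m n G x s = 0 by rewrite -E /dgap; ring.
by move=> /eqP; rewrite gt_eqF.
Qed.

End RuledSurface.

Section SmoothPoints.
Context {R : realType} {B : topologicalType}.
Local Notation Gr := (grassmannian R 4).
Variable xi : B -> Gr * Gr * Gr.
Hypotheses (xiF : hyperconvex_frenet xi) (circleB : is_topological_circle (R := R) B).
Local Notation xk := (curve_part xi).

(** [sf_pos] places the point on the half of its tangent line where the abscissa exceeds that of the
    contact point, as [osc_lt] requires. *)
Record sheet_frame (p : Gr) (z : B) (M : 'M[R]_4) (c : R -> B) (t : B -> R)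
    (X f g m n G : R -> R) (s : R) (v : 'cV[R]_3) : Prop := SheetFrame {
  sf_adapted : adapted xi M z;
  sf_param : param_chart z c t;
  sf_normal : normal_chart xi M c X f g m n G;
  sf_chart : frenet_chart X f g m n G;
  sf_point : p = affine_chart (invmx M) v;
  sf_sub : (p <= xk 2 (c s))%VS;
  sf_pos : X s < v 0 0 }.

(** A point on the wrong half of its tangent line is brought to the right one by changing the sign
    of coordinate 1 and taking a new frame: the abscissas of the point and of the contact point both
    change sign. *)
Lemma sheet_frame_ex x0 (p : Gr) : RP3 p -> (p <= xk 2 x0)%VS -> p != xk 1 x0 ->
  exists z M c t X f g m n G s v, sheet_frame p z M c t X f g m n G s v.
Proof.
move=> p1 px0 pn; have [z zx pz] := osculating_avoid xiF circleB p1 px0 pn.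
have [M0 M0z] := adapted_ex xiF z.
have [M [c [t [X [f [g [m [n [G [Mz _ pc nc C]]]]]]]]]] := frame_chart xiF circleB M0z.
have [MU _] := Mz; have xz : x0 != z by rewrite eq_sym.
have [u uE] := colspan_ex p1; have pE : p = <[u]>%VS by rewrite -uE colspan_line.
have up : u \in p by rewrite pE memv_line.
have uz : u \notin xk 3 z by rewrite memvE -pE.
have Mu0 := vertical_lin xiF Mz uz.
have [v pv vE] := chart_ex MU p1 up Mu0.
have v0E : v 0 0 = (M *m u) 1 0 / (M *m u) 0 0.
  have /colP/(_ 1) := vE; rewrite !mxE /= => ->.
  by rewrite mulrC; congr (_ / _); rewrite !mxE.
have cs0 : c (t x0) = x0 by case: pc => _ _ _ + _; apply.
have [v0X|Xv0|E] := ltgtP (v 0 0) (X (t x0)); last 1 first.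
- case/eqP: pn; rewrite pv -[in RHS]cs0.
  have [vY vZ] : v 1 0 = ruleY X f m (t x0) (v 0 0) /\ v 2 0 = ruleZ X g n (t x0) (v 0 0).
    by apply/(chart_rule xiF Mz nc); rewrite cs0 -pv; split.
  exact: (chart_on_curve xiF Mz nc E vY vZ).
- have one0 : (1 : R) != 0 by exact: oner_neq0.
  have None0 : (-1 : R) != 0 by rewrite oppr_eq0.
  have M1z := flip_adapted None0 one0 one0 Mz.
  have [M2 [c2 [t2 [X2 [f2 [g2 [m2 [n2 [G2 [M2z M2r pc2 nc2 C2]]]]]]]]]] :=
    frame_chart xiF circleB M1z.
  have [M2U _] := M2z.
  have row0 (w : 'cV_4) : (M2 *m w) 0 0 = (M *m w) 0 0.
    by have [-> _] := M2r w; rewrite flipE [LHS]mxE.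
  have row1 (w : 'cV_4) : (M2 *m w) 1 0 = - (M *m w) 1 0.
    by have [_ ->] := M2r w; rewrite flipE [LHS]mxE /= mulN1r.
  have M2u0 : (M2 *m u) 0 0 != 0 by rewrite row0.
  have [v2 pv2 v2E] := chart_ex M2U p1 up M2u0.
  have cs2 : c2 (t2 x0) = x0 by case: pc2 => _ _ _ + _; apply.
  exists z, M2, c2, t2, X2, f2, g2, m2, n2, G2, (t2 x0), v2; split => //; rewrite ?cs2 //.
  have e1 : pt M 1 (X (t x0)) (f (t x0)) (g (t x0)) \in xk 1 (c2 (t2 x0)).
    by rewrite cs2; have [+ _ _] := nc (t x0); rewrite cs0.
  have := chart_point xiF M2z nc2 e1; rewrite row0 mulKVmx // => /colP/(_ 1).
  rewrite row1 mulKVmx // [vec4 _ _ _ _ 0 0]mxE /= scale1r !mxE /= => XE.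
  have /colP/(_ 1) := v2E; rewrite [LHS]mxE [RHS]mxE /= => ->.
  by rewrite row0 row1 mulrN mulrC -v0E -XE ltrN2.
- by exists z, M, c, t, X, f, g, m, n, G, (t x0), v; split => //; rewrite cs0.
Qed.

(** Distinct tangent lines are disjoint, because two copies of [xi^2] are in direct sum. Hence each
    line other than the one through [p] avoids a neighbourhood of [p], locally uniformly in its
    parameter, and compactness of the circle makes this uniform. *)
Lemma localize z (c : R -> B) t s (p : Gr) (e : R) : param_chart z c t -> RP3 p ->
  (p <= xk 2 (c s))%VS -> 0 < e ->
  \forall L \near p, forall y, (L <= xk 2 y)%VS -> y != z /\ `|t y - s| < e.
Proof.
move=> pc p1 ps e0.
apply: (@circle_near_covering _ _ circleB _ (nbhs p)
  (fun L y => (L <= xk 2 y)%VS -> y != z /\ `|t y - s| < e)) => y.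
have [->|ys] := eqVneq y (c s).
  have [_ _ _ _ /(_ s e e0) near_s] := pc.
  exists ([set y | y != z /\ `|t y - s| < e], setT) => /=.
    by split => //; exact: filterT.
  by move=> [y' L] /= [].
have py : ~ (p <= xk 2 y)%VS.
  move=> py.
  have cap : (1 <= \dim (xk 2 y :&: xk 2 (c s)))%N.
    have : (p <= xk 2 y :&: xk 2 (c s))%VS by rewrite subv_cap py.
    by move=> /dimvS; apply: leq_trans; rewrite p1.
  have sum_lt : (\dim (xk 2 y + xk 2 (c s)) < \dim (fullv : Gr))%N.
    rewrite dim_fullv4 -(ltn_add2r (\dim (xk 2 y :&: xk 2 (c s)))) dimv_sum_cap.
    by rewrite !(dim_curve xiF) // -addn1 leq_add2l.
  have [w _ wn] := exists_notin sum_lt; have [q [qk qw]] := separating_row wn.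
  have q0 : q = 0.
    apply: (annihilator xiF (s := [:: (2%N, y); (2%N, c s)])) => //=.
      by rewrite !inE ys.
    move=> a b; rewrite !inE => /orP[] /eqP -> /= bk; apply: qk.
      exact: (subvP (addvSl _ _)).
    exact: (subvP (addvSr _ _)).
  move: qw; rewrite q0 mul0mx => /matrixP/(_ 0 0)/eqP.
  by rewrite !mxE eq_sym oner_eq0.
have := line_notin_near p1 (dim_curve xiF y (isT : (2 <= 4)%N)) py.
move=> [[S T] /= [SV TL] ST].
exists ([set y' | S (xk 2 y')], T) => /=.
  by split => //; have H := @curve_continuous _ _ _ xiF 2%N y; exact: H.
move=> [y' L] /= [Sy TLL] Ly; exfalso; exact: (ST (_, L) (conj Sy TLL)).
Qed.

End SmoothPoints.

Section Surface.
Context {R : realType} {B : topologicalType}.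
Local Notation Gr := (grassmannian R 4).
Variable xi : B -> Gr * Gr * Gr.
Hypotheses (xiF : hyperconvex_frenet xi) (circleB : is_topological_circle (R := R) B).
Local Notation xk := (curve_part xi).

Lemma continuous_small (X : R -> R) x (e : R) : continuous X -> 0 < e ->
  exists2 d, 0 < d & forall t, `|t - x| <= d -> `|X t - X x| < e.
Proof.
move=> Xc e0; have := Xc x => /cvgr_dist_lt /(_ _ e0) /nbhs_ballP[d /= d0 H].
exists (d / 2); first by rewrite divr_gt0.
move=> t td; rewrite distrC; apply: H; rewrite /ball /= distrC.
by apply: le_lt_trans td _; rewrite ltr_pdivrMr // ltr_pMr // ltr1n.
Qed.

(** [localize] provides a neighbourhood in which [dOmega] consists of the graph of [sheet] alone;
    the projection [pr] inverts the graph map, which is thus a homeomorphism onto its image. *)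
Lemma sheet_C1_point p z M c t X f g m n G s v :
  sheet_frame xi p z M c t X f g m n G s v -> C1_point (dOmega xi) p.
Proof.
move=> [Mz pc nc C pv ps pos]; have [MU _] := Mz; have [_ ct cz tc _] := pc.
exists (invmx M), v; split => //; first by rewrite unitmx_inv.
pose b := v 0 0 - X s; have b0 : 0 < b by rewrite subr_gt0.
have b40 : 0 < b / 4 by rewrite divr_gt0.
have [d d0 small] := continuous_small s (chart_contX C) b40.
have p1 : RP3 p by rewrite pv; exact: chart_RP3.
have nb : nbhs p [set L : Gr | forall y, (L <= xk 2 y)%VS -> y != z /\ `|t y - s| < d].
  exact: localize pc p1 ps d0.
move: nb; rewrite nbhsE => -[N [oN Np] NH].
pose D := @sheet_dom _ X f m s b d; pose h := @sheet _ X f g m n s d.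
have oD : open D := open_sheet_dom C small.
pose pr (u : 'cV[R]_3) : 'cV[R]_2 := vec2 (u 0 0) (u 1 0).
have prc : continuous pr.
  move=> u; apply: (@cvg_vec2 _ _ (nbhs u)).
    exact: (@coord_continuous R 3 1 0 0 u).
  exact: (@coord_continuous R 3 1 1 0 u).
have prg w : pr (graph_map h w) = w.
  by rewrite [RHS]vec2_eta /pr !mxE.
have chc := affine_chart_continuous MU.
have [vY vZ] : v 1 0 = ruleY X f m s (v 0 0) /\ v 2 0 = ruleZ X g n s (v 0 0).
  by apply/(chart_rule xiF Mz nc); rewrite -pv; split.
pose U := pr @^-1` D `&` affine_chart (invmx M) @^-1` N.
have Dv : D (pr v).
  split; first by rewrite /pr !mxE /= -/b subrr normr0.
  by exists s; rewrite /pr ?subrr ?normr0 // !mxE.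
exists U, (D `&` (fun w => affine_chart (invmx M) (graph_map h w)) @^-1` N), (graph_map h).
have C1h : C1_on D (graph_map h) := sheet_C1 C small.
have onD w : D w -> dOmega xi (affine_chart (invmx M) (graph_map h w)).
  move=> Dw; have [_ E] := sheet_paramP Dw.
  apply/(chart_dOmega xiF Mz pc nc); exists (@sheet_param _ X f m s d w).
  by rewrite !mxE /=; split.
split.
- split.
    apply: openI; first by apply: open_comp => // u _; exact: prc.
    by apply: open_comp => // u _; exact: chc.
  by split => //; rewrite /= -pv.
- rewrite openE => w [Dw Nw]; apply: filterI; first exact: open_nbhs_nbhs.
  have [/differentiable_continuous gc _] := C1h w Dw.
  have : {for w, continuous (affine_chart (invmx M) \o graph_map h)}.
    by apply: continuous_comp => //; exact: chc.
  by apply; exact: open_nbhs_nbhs.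
- by move=> w [Dw _]; exact: C1h.
- by move=> w [Dw _]; exact: (sheet_diff_inj C small).
split.
- by move=> w w' _ _ /(congr1 pr); rewrite !prg.
- apply/seteqP; split=> [_ [w [Dw Nw] <-]|u [Mu [Du Nu]]].
    by split; [exact: onD|split => //; rewrite /= prg].
  have [y _ yu] := Mu; have [_ /(NH _ Nu)[yz yd]] := yu.
  rewrite -(tc y yz) in yu; have [uY uZ] := (chart_rule xiF Mz nc _ _).1 yu.
  have pE : @sheet_param _ X f m s d (pr u) = t y.
    by apply: (sheet_paramE C small) => //; [case: Du|rewrite /pr !mxE /= uY].
  have gu : graph_map h (pr u) = u.
    by rewrite /graph_map /h /sheet pE [RHS]vec3_eta /pr !mxE /= -uZ.
  by exists (pr u) => //; split => //; rewrite /= gu.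
- move=> W oW WV; exists (pr @^-1` W); first by apply: open_comp => // u _; exact: prc.
  apply/seteqP; split=> [_ [w Ww <-]|u [[w Vw <-] /=]].
    by split; [exists w => //; exact: WV|rewrite /= prg].
  by rewrite prg => Ww; exists w.
Qed.

End Surface.

(** * The convex side of the ruled surface *)

Section ConvexSide.
Context {R : realType} {B : topologicalType}.
Local Notation Gr := (grassmannian R 4).
Variable xi : B -> Gr * Gr * Gr.
Hypotheses (xiF : hyperconvex_frenet xi) (circleB : is_topological_circle (R := R) B).
Local Notation xk := (curve_part xi).

(** Convexity with a real coefficient and explicit bounds, in place of the bundled coefficient of
    [convex_set]. *)
Definition convex_comb (A : set 'cV[R]_3) := forall u v t, A u -> A v ->
  0 <= t <= 1 -> A (t *: u + (1 - t) *: v).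

Lemma comb_lt (t a b a' b' : R) : 0 < t <= 1 -> a < b -> a' <= b' ->
  t * a + (1 - t) * a' < t * b + (1 - t) * b'.
Proof.
move=> /andP[t0 t1] ab ab'.
by rewrite ltr_leD ?ltr_pM2l // ler_wpM2l ?subr_ge0.
Qed.

Lemma convex_comb_set A : convex_comb A -> convex_set A.
Proof.
move=> cA u v t; rewrite !inE => Au Av.
by apply: cA => //; rewrite ge0 le1.
Qed.

Lemma cvg_comb (u v : 'cV[R]_3) : continuous (fun t : R => t *: u + (1 - t) *: v).
Proof.
move=> t; apply: (@cvgD _ _ _ (nbhs t)).
  by apply: (@cvgZ _ _ _ (nbhs t)); [exact: cvg_id|exact: cvg_cst].
apply: (@cvgZ _ _ _ (nbhs t)); last exact: cvg_cst.
by apply: (@cvgB _ _ _ (nbhs t)); [exact: cvg_cst|exact: cvg_id].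
Qed.

Lemma convex_comb_connected A : convex_comb A -> A !=set0 -> connected A.
Proof.
move=> cA [u Au].
pose sg v := (fun t : R => t *: u + (1 - t) *: v) @` `[0, 1].
have -> : A = \bigcup_(v in A) sg v.
  apply/seteqP; split=> [v Av|_ [v Av [t /= t01 <-]]].
    exists v => //; exists 0; first by rewrite /= in_itv /= lexx ler01.
    by rewrite scale0r add0r subr0 scale1r.
  by apply: cA => //; move: t01; rewrite in_itv.
apply: bigcup_connected.
  exists u => v Av; exists 1; first by rewrite /= in_itv /= lexx ler01.
  by rewrite scale1r subrr scale0r addr0.
move=> v Av; apply: connected_continuous_connected; first exact: segment_connected.
by apply: continuous_subspaceT; exact: cvg_comb.
Qed.

Section Cap.
Variables X f g m n G : R -> R.
Hypothesis C : frenet_chart X f g m n G.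

Lemma osc_comb x t u v u' v' : osc X f g m n G x (t * u + (1 - t) * u') (t * v + (1 - t) * v')
  = t * osc X f g m n G x u v + (1 - t) * osc X f g m n G x u' v'.
Proof. by rewrite /osc; ring. Qed.

Lemma osc_cvg (T : Type) (F : set_system T) (FF : Filter F) (a b d : T -> R) x u v :
  a @ F --> x -> b @ F --> u -> d @ F --> v ->
  osc X f g m n G (a t) (b t) (d t) @[t --> F] --> osc X f g m n G x u v.
Proof.
move=> ax bu dv.
have H (h : R -> R) : continuous h -> h (a t) @[t --> F] --> h x.
  by move=> hc; apply: continuous_cvg ax; exact: hc.
have HX := H _ (chart_contX C); have Hf := H _ (chart_contf C).
have Hg := H _ (chart_contg C); have Hm := H _ (chart_contm C).
have Hn := H _ (chart_contn C); have HG := H _ (chart_contG C).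
apply: cvgD.
  by apply: cvgD => //; apply: cvgM => //; exact: cvgB.
apply: cvgM => //; apply: cvgB; first exact: cvgB.
by apply: cvgM => //; exact: cvgB.
Qed.

Variables (q : 'cV[R]_3) (r s d : R).

(** The part of a box above a family of osculating planes: convex as an intersection of half-spaces
    with a box, and open because the parameters form a compact interval. *)
Definition cap : set 'cV[R]_3 := [set v | (forall i, `|v i 0 - q i 0| < r) /\
  forall x, `|x - s| <= d -> osc X f g m n G x (v 0 0) (v 1 0) < v 2 0].

Lemma cap_convex : convex_comb cap.
Proof.
move=> u v t [uq uo] [vq vo] /andP[t0 t1].
have [->|tn0] := eqVneq t 0; first by rewrite scale0r add0r subr0 scale1r.
have tp : 0 < t <= 1 by rewrite lt_def tn0 t0.
split=> [i|x xs]; last by rewrite !mxE osc_comb comb_lt ?uo // ltW // vo.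
have := uq i; have := vq i; rewrite !ltr_norml !mxE => /andP[v1 v2] /andP[u1 u2].
have := comb_lt tp u1 (ltW v1); have := comb_lt tp u2 (ltW v2).
by move=> H1 H2; apply/andP; split; lra.
Qed.

Lemma cap_open : open cap.
Proof.
rewrite openE => v [vq vo].
have n1 : \forall w \near v, forall i, `|(w : 'cV[R]_3) i 0 - q i 0| < r.
  apply: (@filter_forall _ _ _ (nbhs v)) => i.
  have H : (fun w : 'cV[R]_3 => `|w i 0 - q i 0|) @ v --> `|v i 0 - q i 0|.
    apply: (@cvg_norm _ _ _ (nbhs v)); apply: (@cvgB _ _ _ (nbhs v)); last exact: cvg_cst.
    exact: coord_continuous.
  by move: H => /cvgr_lt; apply.
have /compact_near_coveringP cov := @segment_compact R (s - d) (s + d).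
have n2 : \forall w \near v, `[s - d, s + d]%classic `<=`
    (fun x => osc X f g m n G x ((w : 'cV[R]_3) 0 0) (w 1 0) < w 2 0).
  apply: (cov _ (nbhs v) (fun (w : 'cV[R]_3) x => osc X f g m n G x (w 0 0) (w 1 0) < w 2 0)).
  move=> x xd.
  have xs : `|x - s| <= d.
    by move: xd; rewrite /= in_itv /= ler_norml => /andP[? ?]; apply/andP; split; lra.
  pose FF := filter_prod (nbhs x) (nbhs v).
  have H : (fun z : R * 'cV[R]_3 => z.2 2 0 - osc X f g m n G z.1 (z.2 0 0) (z.2 1 0)) @ FF
      --> v 2 0 - osc X f g m n G x (v 0 0) (v 1 0).
    have c2 (i : 'I_3) : (fun z : R * 'cV[R]_3 => z.2 i 0) @ FF --> v i 0.
      by apply: (@cvg_entry _ _ _ _ FF _ snd); exact: cvg_snd.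
    apply: (@cvgB _ _ _ FF); first exact: c2.
    by apply: (@osc_cvg _ FF) => //; exact: cvg_fst.
  have := vo x xs; rewrite -subr_gt0; move: H => /cvgr_gt H /H.
  by apply: filterS => -[x' w] /=; rewrite subr_gt0.
apply: filterS2 n1 n2 => w w1 w2; split => // x xs; apply: w2.
by move: xs; rewrite /= in_itv /= ler_norml => /andP[? ?]; apply/andP; split; lra.
Qed.

End Cap.

(** At a limit line at infinity some coordinate [lift 0 i] is non-zero, and the ratio of coordinate
    0 to it tends to 0; on the image of [A] this ratio is the inverse of [v i 0], of absolute value
    above [1 / k]. *)
Lemma bounded_closure (M : 'M[R]_4) (A : set 'cV[R]_3) (k : R) : M \in unitmx ->
  (forall v i, A v -> `|v i 0| < k) ->
  closure (affine_chart (invmx M) @` A) `<=` range (affine_chart (invmx M)).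
Proof.
move=> MU Ak L cL.
have L1 : RP3 L.
  have oR : open (~` (RP3 : set Gr)).
    move=> l D dD /= A1; apply: (@nearW _ (nbhs D)) => D' dD' D1.
    by apply: A1; rewrite /RP3 /= dD -dD'.
  apply: contrapT => nL.
  have [_ [[v Av <-]]] := cL _ (open_nbhs_nbhs (conj oR nL)).
  by apply; exact: chart_RP3.
have [u uE] := colspan_ex L1.
have uL : u \in L by rewrite -uE colspan_line memv_line.
have [M0|M0] := eqVneq ((M *m u) 0 0) 0; last first.
  by have [v -> _] := chart_ex MU L1 uL M0; exists v.
have u0 : u != 0.
  by have := L1; rewrite /RP3 /= -uE colspan_line dim_vline; case: (u != 0).
have [i Mi] : exists i : 'I_3, (M *m u) (lift 0 i) 0 != 0.
  apply: contrapT => H; move/eqP : u0; apply; rewrite -(mulKmx MU u).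
  suff -> : M *m u = 0 by rewrite mulmx0.
  apply/colP => j; rewrite [RHS]mxE; case: (unliftP 0 j) => [i ->|-> //].
  by apply/eqP; apply: contrapT => /negP Mi; apply: H; exists i.
have d0 : \det (row (lift 0 i) M *m u) != 0 by rewrite det_row_mul.
have chE w : (M *m (invmx M *m aff w)) (lift 0 i) 0 = w i 0.
  rewrite mulKVmx // [w in RHS]vec3_eta !mxE.
  by case: i {Mi d0} => -[|[|[|]]].
have k0 : 0 < k.
  have [_ [[v Av <-] _]] := cL _ (@filterT _ (nbhs L) _).
  exact: le_lt_trans (normr_ge0 _) (Ak v 0 Av).
have cont (P : 'rV[R]_4) : plucker P (row (lift 0 i) M) L' @[L' --> L]
    --> \det (P *m u) / \det (row (lift 0 i) M *m u).
  have := plucker_continuous (P' := P) d0; rewrite uE => H.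
  by rewrite -(pluckerE P) ?uE //; exact: H.
have n1 : \forall L' \near L, `|plucker (row 0 M) (row (lift 0 i) M) L'| < k^-1.
  have := cont (row 0 M); rewrite det_row_mul M0 mul0r => /cvgr0_norm_lt; apply.
  by rewrite invr_gt0.
(* A ratio of a coordinate to itself again serves to detect that this coordinate is non-zero. *)
have n2 : \forall L' \near L, plucker (row (lift 0 i) M) (row (lift 0 i) M) L' != 0.
  by have := cont (row (lift 0 i) M); rewrite divff // => /cvgr_neq0; apply; exact: oner_neq0.
have [_ [[v Av <-] []]] := cL _ (filterI n1 n2).
rewrite affine_chartE -colspan_line !pluckerE; try by
  rewrite colspan_line dim_vline aff_neq0.
rewrite !det_row_mul !chE mulKVmx // [aff v 0 0]mxE /= => H1 H2.
have vi : v i 0 != 0 by apply: contra H2 => /eqP ->; rewrite mul0r.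
move: H1; rewrite mul1r normfV ltf_pV2 ?posrE ?normr_gt0 // ltNge.
by rewrite ltW // Ak.
Qed.

Lemma sheet_convex p z M c t X f g m n G s v :
  sheet_frame xi p z M c t X f g m n G s v ->
  exists N D : set Gr, [/\ nbhs p N, domain D, properly_convex D &
    dOmega xi `&` N `<=` boundary D].
Proof.
move=> [Mz pc nc C pv ps pos]; have [MU _] := Mz; have [_ ct cz tc _] := pc.
pose b := v 0 0 - X s; have b0 : 0 < b by rewrite subr_gt0.
have b40 : 0 < b / 4 by rewrite divr_gt0.
have [d d0 small] := continuous_small s (chart_contX C) b40.
have p1 : RP3 p by rewrite pv; exact: chart_RP3.
have [vY vZ] : v 1 0 = ruleY X f m s (v 0 0) /\ v 2 0 = ruleZ X g n s (v 0 0).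
  by apply/(chart_rule xiF Mz nc); rewrite -pv; split.
pose A := cap X f g m n G v (b / 4) s d.
have chc := affine_chart_continuous MU.
have oA : open A by exact: cap_open.
have oQ : open [set w : 'cV[R]_3 | forall i, `|w i 0 - v i 0| < b / 4].
  rewrite openE => w wq; apply: (@filter_forall _ _ _ (nbhs w)) => i.
  have H : (fun w : 'cV[R]_3 => `|w i 0 - v i 0|) @ w --> `|w i 0 - v i 0|.
    apply: (@cvg_norm _ _ _ (nbhs w)); apply: (@cvgB _ _ _ (nbhs w)); last exact: cvg_cst.
    exact: coord_continuous.
  by move: H => /cvgr_lt; apply; exact: wq.
have rng u : `|u - v 0 0| < b / 4 -> `|u - X s - b| < b / 4.
  by rewrite /b opprB addrA subrK.
have sd0 : `|s - s| <= d by rewrite subrr normr0 ltW.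
(* A second point of the surface in the box, at the abscissa of [v] but on another tangent line. *)
have [y [ys yd yv]] : exists y, [/\ y != s, `|y - s| <= d &
    forall i, `|vec3 (v 0 0) (ruleY X f m y (v 0 0)) (ruleZ X g n y (v 0 0)) i 0 - v i 0| < b / 4].
  pose w y := vec3 (v 0 0) (ruleY X f m y (v 0 0)) (ruleZ X g n y (v 0 0)).
  have ws : w y @[y --> s] --> v.
    rewrite [X in _ --> X]vec3_eta vY vZ.
    apply: (@cvg_vec3 _ _ (nbhs s)); first exact: cvg_cst.
      by apply: (@ruleY_cvg _ _ _ _ _ _ _ C _ (nbhs s)); [exact: cvg_id|exact: cvg_cst].
    apply: (@cvgD _ _ _ (nbhs s)); first exact: chart_contg C s.
    apply: (@cvgM _ _ (nbhs s)); last exact: chart_contn C s.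
    by apply: (@cvgB _ _ _ (nbhs s)); [exact: cvg_cst|exact: chart_contX C s].
  have nv : nbhs v [set u : 'cV[R]_3 | forall i, `|u i 0 - v i 0| < b / 4].
    by apply: open_nbhs_nbhs; split => // i; rewrite subrr normr0.
  have := ws _ nv.
  move=> /nbhs_ballP[e /= e0 He].
  pose k := Num.min (e / 2) d.
  have k0 : 0 < k by rewrite lt_min divr_gt0 //=.
  exists (s + k); split.
  - by rewrite -subr_eq0 addrAC subrr add0r gt_eqF.
  - by rewrite addrAC subrr add0r gtr0_norm // ge_min lexx orbT.
  - apply: He; rewrite /ball /= opprD addrA subrr sub0r normrN gtr0_norm //.
    by rewrite gt_min ltr_pdivrMr // ltr_pMr // ltr1n.
(* The midpoint of [v] and this second point: both are on or above every plane of the family, and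
   each plane is strictly below at least one of them. *)
have A0 : A !=set0.
  pose u := vec3 (v 0 0) (ruleY X f m y (v 0 0)) (ruleZ X g n y (v 0 0)).
  exists ((1 / 2) *: v + (1 - 1 / 2) *: u); split.
    move=> i; have := yv i; rewrite -/u ltr_norml !mxE => /andP[? ?].
    by rewrite ltr_norml; apply/andP; split; lra.
  move=> x xs; rewrite !mxE /= osc_comb.
  have rv : `|v 0 0 - X s - b| < b / 4 by apply: rng; rewrite subrr normr0.
  have H1 := sheet_osc_le C small xs sd0 rv; have H2 := sheet_osc_le C small xs yd rv.
  rewrite -vY -vZ in H1.
  have [xs'|xns] := eqVneq x s.
    have := sheet_osc_lt C small xs yd rv; rewrite xs' eq_sym => /(_ ys) H3.
    rewrite xs' in H1; lra.
  have := sheet_osc_lt C small xs sd0 rv xns; rewrite -vY -vZ => H3; lra.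
have cA : convex_comb A by exact: cap_convex.
have nb : nbhs p [set L : Gr | forall y, (L <= xk 2 y)%VS -> y != z /\ `|t y - s| < d].
  exact: localize pc p1 ps d0.
exists ([set L : Gr | forall y, (L <= xk 2 y)%VS -> y != z /\ `|t y - s| < d] `&`
  affine_chart (invmx M) @` [set w : 'cV[R]_3 | forall i, `|w i 0 - v i 0| < b / 4]).
exists (affine_chart (invmx M) @` A).
have oD : open (affine_chart (invmx M) @` A) by exact: open_chart_image.
split.
- apply: filterI => //; apply: open_nbhs_nbhs; split; first exact: open_chart_image.
  by exists v => // i; rewrite subrr normr0.
- split => //.
  + by move=> _ [w _ <-]; exact: chart_RP3.
  + by have [w Aw] := A0; exists (affine_chart (invmx M) w); exists w.
  + apply: connected_continuous_connected; first exact: convex_comb_connected.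
    exact: continuous_subspaceT.
- exists (invmx M); split; first by rewrite unitmx_inv.
    apply: (@bounded_closure _ _ (b / 4 + `|v 0 0| + `|v 1 0| + `|v 2 0|)) => // w i [wv _].
    have := wv i; have := ler_normD (w i 0 - v i 0) (v i 0); rewrite subrK.
    have := normr_ge0 (v 0 0); have := normr_ge0 (v 1 0); have := normr_ge0 (v 2 0).
    have : `|v i 0| <= `|v 0 0| + `|v 1 0| + `|v 2 0|.
      rewrite {1}[v]vec3_eta mxE; have := normr_ge0 (v 0 0).
      have := normr_ge0 (v 1 0); have := normr_ge0 (v 2 0).
      case: i => -[|[|[|//]]] i /=; lra.
    lra.
  apply: convex_comb_set; rewrite (_ : _ @^-1` _ = A) //.
  apply/seteqP; split=> [w [w' Aw' /(can_inj (chart_coordK MU)) <-] //|w Aw].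
  by exists w.
move=> L [[x _ Lx] [NL [w wq wL]]]; have [xz xd] := NL x Lx.2.
have Lx' := Lx; rewrite -wL -(tc x xz) in Lx'.
have [wY wZ] := (chart_rule xiF Mz nc _ _).1 Lx'.
split.
  (* Points of the segment from [w] to a point [a] of [A], other than [w], belong to [A]; hence [w]
     is in the closure. *)
  move=> W; rewrite -wL => /chc Ww; have [a Aa] := A0.
  have : nbhs (0 : R) [set e : R | W (affine_chart (invmx M) (e *: a + (1 - e) *: w))].
    have := @cvg_comb a w 0 (affine_chart (invmx M) @^-1` W).
    by rewrite scale0r add0r subr0 scale1r; apply.
  move=> /nbhs_ballP[e /= e0 He].
  pose k := Num.min (e / 2) 1.
  have k0 : 0 < k by rewrite lt_min divr_gt0 //= ltr01.
  have k1 : k <= 1 by rewrite ge_min lexx orbT.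
  exists (affine_chart (invmx M) (k *: a + (1 - k) *: w)); split.
    have kk : 0 < k <= 1 by rewrite k0.
    exists (k *: a + (1 - k) *: w) => //; have [aq ao] := Aa; split=> [i|x' xs'].
      have := aq i; have := wq i; rewrite !ltr_norml !mxE => /andP[w1 w2] /andP[a1 a2].
      have := comb_lt kk a1 (ltW w1); have := comb_lt kk a2 (ltW w2).
      by move=> H1 H2; apply/andP; split; lra.
    rewrite !mxE osc_comb; apply: comb_lt => //; first exact: ao.
    rewrite wY wZ; apply: (sheet_osc_le C small xs' (ltW xd)).
    exact/rng/wq.
  apply: He; rewrite /ball /= sub0r normrN gtr0_norm //.
  by rewrite gt_min ltr_pdivrMr // ltr_pMr // ltr1n.
(* The domain is open, and [w] lies on, not above, the osculating plane of its own tangent line. *)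
rewrite (interior_id _).1 // -wL => -[w' [_ /(_ (t x) (ltW xd)) o]].
move=> /(can_inj (chart_coordK MU)) E; move: o; rewrite E.
by rewrite wY osc_rule -wZ ltxx.
Qed.

End ConvexSide.

(** * The cuspidal edge *)

Section CuspidalEdge.
Context {R : realType} {B : topologicalType}.
Local Notation Gr := (grassmannian R 4).
Variable xi : B -> Gr * Gr * Gr.
Hypotheses (xiF : hyperconvex_frenet xi) (circleB : is_topological_circle (R := R) B).
Local Notation xk := (curve_part xi).

(** On each side of [s], take a chord from [s] with slope within [e] of [m s]; by [ruleY_chord]
    every tangent line is below it, whence the uniformity in [r]. *)
Lemma rule_below X f g m n G s (e : R) : frenet_chart X f g m n G -> 0 < e ->
  exists2 d, 0 < d & forall r u, `|u - X s| < d ->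
    ruleY X f m r u - f s - m s * (u - X s) <= e * `|u - X s|.
Proof.
move=> C e0; have Xi := chart_incr C.
have near_slope y : y != s -> exists k, `|slope X f s (approach s y k) - m s| < e.
  move=> ys; have ny k : approach s y k != s.
    rewrite /approach -subr_eq0 addrAC subrr add0r mulf_eq0 negb_or subr_eq0 ys.
    by rewrite invr_eq0 pnatr_eq0.
  have := chart_tangentf C ny (@approach_cvg _ s y).
  move=> /cvgr_dist_lt /(_ _ e0) [k _ /(_ k (leqnn k))] /=.
  by rewrite distrC; exists k.
have up : s < s + 1 by lra.
have dn : s - 1 < s by lra.
have [k1] := near_slope (s + 1) (negbT (gt_eqF up)).
have /andP[st _] := approach_between k1 up.
set t := approach s (s + 1) k1 in st *.
have [k2] := near_slope (s - 1) (negbT (lt_eqF dn)).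
have /andP[_ ts] := approach_between_gt k2 dn.
set t' := approach s (s - 1) k2 in ts *.
rewrite !ltr_norml => /andP[S1 S2] /andP[S3 S4].
have Xt := Xi _ _ st; have Xt' := Xi _ _ ts.
exists (Num.min (X t - X s) (X s - X t')).
  by rewrite lt_min !subr_gt0 Xt Xt'.
move=> r u; rewrite lt_min !ltr_norml => /andP[/andP[_ u2] /andP[u3 _]].
have [us|us] := leP (X s) u.
  rewrite ger0_norm ?subr_ge0 //.
  have := ruleY_chord C r st us (_ : u <= X t).
  have -> : u <= X t by lra.
  move=> /(_ isT) H.
  have : (slope X f s t - m s) * (u - X s) <= e * (u - X s).
    by rewrite ler_wpM2r ?subr_ge0 // ltW.
  lra.
rewrite ltr0_norm ?subr_lt0 //.
have := ruleY_chord C r ts (_ : X t' <= u) (ltW us).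
have -> : X t' <= u by lra.
move=> /(_ isT) H.
have E : f t' + slope X f t' s * (u - X t') = f s + slope X f s t' * (u - X s).
  by rewrite [slope X f t' s]slopeC /slope; field; lra.
have : (m s - slope X f s t') * (X s - u) <= e * (X s - u).
  by rewrite ler_wpM2r ?subr_ge0 ?ltW //; lra.
rewrite E in H; lra.
Qed.

Lemma le0_small (a b : R) : 0 <= b -> (forall e, 0 < e -> a <= e * b) -> a <= 0.
Proof.
move=> b0 H; rewrite leNgt; apply/negP => a0.
have b1 : 0 < 2 * (b + 1) by lra.
have := H _ (divr_gt0 a0 b1).
by rewrite mulrAC ler_pdivlMr // ler_pM2l // => ?; lra.
Qed.

Definition vec0 (d : 'cV[R]_3) : 'cV[R]_4 := vec4 0 (d 0 0) (d 1 0) (d 2 0).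

Lemma aff_vec0 q e d : aff (q + e *: d) = aff q + e *: vec0 d.
Proof. by apply/colP => -[[|[|[|[|//]]]] i]; rewrite !mxE /= ?mulr0 ?addr0 ?mxE. Qed.

Lemma lin4_cvg (p0 p1 p2 p3 : R) (T : Type) (F : set_system T) (FF : Filter F)
    (w : T -> 'cV[R]_4) w0 : w @ F --> w0 ->
  lin4 p0 p1 p2 p3 (w t) @[t --> F] --> lin4 p0 p1 p2 p3 w0.
Proof.
move=> ww; have H (p : R) (i : 'I_4) : p * w t i 0 @[t --> F] --> p * w0 i 0.
  by apply: cvgM; [exact: cvg_cst|exact: cvg_entry].
by apply: cvgD; [apply: cvgD; [apply: cvgD|]|].
Qed.

Lemma lin4Z (p0 p1 p2 p3 e : R) w : lin4 p0 p1 p2 p3 (e *: w) = e * lin4 p0 p1 p2 p3 w.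
Proof. by rewrite /lin4 !mxE; ring. Qed.

Section TangentPlane.
Variables (M : 'M[R]_4) (z : B) (c : R -> B) (t : B -> R) (X f g m n G : R -> R).
Hypotheses (Mz : adapted xi M z) (pc : param_chart z c t)
  (nc : normal_chart xi M c X f g m n G) (C : frenet_chart X f g m n G).
Variables (s : R) (g0 : 'M[R]_4) (q : 'cV[R]_3) (V : set 'cV[R]_2)
  (F : 'cV[R]_2 -> 'cV[R]_3) (w : 'cV[R]_2).
Hypotheses (g0U : g0 \in unitmx) (pq : xk 1 (c s) = affine_chart g0 q)
  (oV : open V) (Vw : V w) (Fw : F w = q) (dF : differentiable F w)
  (VM : forall w', V w' -> dOmega xi (affine_chart g0 (F w'))).

Let MU : M \in unitmx. Proof. by case: Mz. Qed.

(** [phi] has kernel [xi^2 (c s) + xi^1 z], and [ell] vanishes on [xi^2 z] and [xi^1 (c s)]. Divided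
    by coordinate 0, they give the height above the tangent line of (X, f) at [s] and the abscissa
    measured from [X s]. *)
Let phi := lin4 (m s * X s - f s) (- m s) 1 0.
Let ell := lin4 (- X s) 1 0 0.
Let W v := M *m (g0 *m aff v).
Let D d := M *m (g0 *m vec0 d).

Let W_line v e d : W (v + e *: d) = W v + e *: D d.
Proof. by rewrite /W aff_vec0 !mulmxDr -!scalemxAr. Qed.

Let chart_line v : affine_chart g0 v = <[g0 *m aff v]>%VS.
Proof. by rewrite -{1}(invmxK g0) affine_chartE // invmxK. Qed.

Lemma cusp_base : exists2 a0, a0 != 0 & W q = a0 *: vec4 1 (X s) (f s) (g s).
Proof.
have qs : g0 *m aff q \in xk 1 (c s) by rewrite pq chart_line memv_line.
have E := chart_point xiF Mz nc qs; exists ((W q) 0 0) => //.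
apply/negP => /eqP a0; move: E; rewrite -/(W q) a0 scale0r => W0.
have := aff_neq0 (M := invmx g0) _ q; rewrite unitmx_inv invmxK => /(_ g0U)/eqP; apply.
by rewrite -(mulKmx MU (g0 *m aff q)) -/(W q) W0 mulmx0.
Qed.

Lemma cusp_ineq (e : R) : 0 < e -> exists2 d, 0 < d & forall v,
  dOmega xi (affine_chart g0 v) -> (W v) 0 0 != 0 -> `|ell (W v) / (W v) 0 0| < d ->
  phi (W v) / (W v) 0 0 <= e * `|ell (W v) / (W v) 0 0|.
Proof.
move=> e0; have [d d0 H] := rule_below s C e0; exists d => // v dv w0 lv.
have L1 : RP3 (affine_chart g0 v) by have [y _ []] := dv.
have up : g0 *m aff v \in affine_chart g0 v by rewrite chart_line memv_line.
have [v' v'E aE] := chart_ex MU L1 up w0.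
have [r [rY _]] : exists r, v' 1 0 = ruleY X f m r (v' 0 0) /\ v' 2 0 = ruleZ X g n r (v' 0 0).
  by apply/(chart_dOmega xiF Mz pc nc); rewrite -v'E.
have ellE : ell (W v) / (W v) 0 0 = v' 0 0 - X s.
  rewrite mulrC -lin4Z -aE /aff lin4_vec4; ring.
have phiE : phi (W v) / (W v) 0 0 = v' 1 0 - f s - m s * (v' 0 0 - X s).
  rewrite mulrC -lin4Z -aE /aff lin4_vec4; ring.
by rewrite phiE ellE rY; apply: H; rewrite -ellE.
Qed.

Lemma diff_quotient_cvg (h : 'cV[R]_2) :
  k.+1%:R *: (F (w + k.+1%:R^-1 *: h) - q) @[k --> \oo] --> 'd F w h.
Proof.
have : derivable F w h by exact: diff_derivable.
rewrite /derivable => /cvg_ex[l Hl].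
have lE : l = 'd F w h by rewrite -deriveE // /derive; apply/esym; exact: cvg_lim.
rewrite -lE.
have h0 : (fun k : nat => k.+1%:R^-1 : R) @ \oo --> (0 : R)^'.
  move=> A /= [e e0 He]; have := @cvg_harmonic R => /cvgr0_norm_lt /(_ _ e0).
  apply: filterS => k ke; apply: He; first by rewrite /ball /= sub0r normrN.
  by rewrite /= invr_eq0 pnatr_eq0.
apply: cvg_eq1 (cvg_comp _ _ h0 Hl) => k /=.
by rewrite invrK Fw [_ + w]addrC.
Qed.

(** Along [F (w + ek k *: h)] both [phi] and [ell] equal the step times their values at the
    difference quotient. Dividing [cusp_ineq] by the step and passing to the limit bounds the left
    side by [e] times a fixed number, for every [e]. *)
Lemma cusp_le (h : 'cV[R]_2) : forall a0, a0 != 0 -> W q = a0 *: vec4 1 (X s) (f s) (g s) ->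
  phi (D ('d F w h)) / a0 <= 0.
Proof.
move=> a0 a00 WE.
pose ek k : R := k.+1%:R^-1.
pose vk k := F (w + ek k *: h).
pose dk k := k.+1%:R *: (vk k - q).
have ek0 k : 0 < ek k by rewrite invr_gt0.
have dk_cvg : dk @ \oo --> 'd F w h by exact: diff_quotient_cvg.
have vkE k : vk k = q + ek k *: dk k.
  by rewrite /dk scalerA mulVf ?pnatr_eq0 // scale1r addrC subrK.
have wk_cvg : w + ek k *: h @[k --> \oo] --> w.
  have H : ek k *: h @[k --> \oo] --> (0 : R) *: h.
    by apply: cvgZ; [exact: cvg_harmonic|exact: cvg_cst].
  by rewrite -[X in _ --> X]addr0 -(scale0r h); apply: cvgD; [exact: cvg_cst|].
have vk_cvg : vk @ \oo --> q.
  rewrite -Fw; apply: (@continuous_cvg _ _ _ \oo) wk_cvg.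
  exact: differentiable_continuous.
have affc (T : Type) (FF0 : set_system T) (FF : Filter FF0) (v : T -> 'cV[R]_3) v0 :
    v @ FF0 --> v0 -> D (v t) @[t --> FF0] --> D v0.
  move=> vv; apply: cvg_mulmx; first exact: cvg_cst.
  apply: cvg_mulmx; first exact: cvg_cst.
  apply: cvg_mx => i j; rewrite mxE; under eq_fun do rewrite mxE.
  by case: i => -[|[|[|[|//]]]] i; [exact: cvg_cst|exact: cvg_entry..].
have Dk_cvg : D (dk k) @[k --> \oo] --> D ('d F w h) by exact: affc.
have ek_cvg : ek @ \oo --> (0 : R) by exact: cvg_harmonic.
have Wk_cvg : W (vk k) @[k --> \oo] --> W q.
  have H : W q + ek k *: D (dk k) @[k --> \oo] --> W q + 0 *: D ('d F w h).
    by apply: cvgD; [exact: cvg_cst|apply: cvgZ].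
  rewrite scale0r addr0 in H; apply: cvg_eq1 H => k.
  by rewrite vkE W_line.
have W0_cvg : (W (vk k)) 0 0 @[k --> \oo] --> a0.
  have -> : a0 = (W q) 0 0 by rewrite WE !mxE /= mulr1.
  exact: cvg_entry.
have phiW : phi (W q) = 0 by rewrite WE /phi lin4Z lin4_vec4; ring.
have ellW : ell (W q) = 0 by rewrite WE /ell lin4Z lin4_vec4; ring.
have phik k : phi (W (vk k)) = ek k * phi (D (dk k)).
  by rewrite vkE W_line /phi lin4D -/phi phiW add0r.
have ellk k : ell (W (vk k)) = ek k * ell (D (dk k)).
  by rewrite vkE W_line /ell lin4D -/ell ellW add0r.
have le_e e : 0 < e -> phi (D ('d F w h)) / a0 <= e * `|ell (D ('d F w h)) / a0|.
  move=> e0; have [d d0 Hd] := cusp_ineq e0.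
  have nV : \forall k \near \oo, V (w + ek k *: h).
    by apply: wk_cvg; exact: open_nbhs_nbhs.
  have n0 : \forall k \near \oo, (W (vk k)) 0 0 != 0.
    by move: W0_cvg => /cvgr_neq0; apply.
  have nl : \forall k \near \oo, `|ell (W (vk k)) / (W (vk k)) 0 0| < d.
    have H : ell (W (vk k)) / (W (vk k)) 0 0 @[k --> \oo] --> ell (W q) / a0.
      by apply: cvgM; [exact: lin4_cvg|exact: cvgV].
    by rewrite ellW mul0r in H; move: H => /cvgr0_norm_lt; apply.
  have L : phi (D (dk k)) / (W (vk k)) 0 0 @[k --> \oo] --> phi (D ('d F w h)) / a0.
    by apply: cvgM; [exact: lin4_cvg|exact: cvgV].
  have L' : e * `|ell (D (dk k)) / (W (vk k)) 0 0| @[k --> \oo]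
      --> e * `|ell (D ('d F w h)) / a0|.
    apply: cvgM; first exact: cvg_cst.
    by apply: cvg_norm; apply: cvgM; [exact: lin4_cvg|exact: cvgV].
  apply: ler_cvg_to L L' _; apply: filterS3 nV n0 nl => k kV k0 kl.
  have := Hd _ (VM kV) k0 kl; rewrite phik ellk -!mulrA normrM (gtr0_norm (ek0 k)).
  by rewrite [leRHS]mulrCA ler_pM2l.
exact: le0_small (normr_ge0 _) le_e.
Qed.

Lemma cusp_tangent (h : 'cV[R]_2) : phi (D ('d F w h)) = 0.
Proof.
have [a0 a00 WE] := cusp_base.
have := cusp_le h a00 WE; have := cusp_le (- h) a00 WE.
have -> : phi (D ('d F w (- h))) = - phi (D ('d F w h)).
  rewrite linearN /D (_ : vec0 (- _) = - 1 *: vec0 ('d F w h)).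
    by rewrite -!scalemxAr /phi lin4Z mulN1r.
  by apply/colP => -[[|[|[|[|//]]]] i]; rewrite !mxE /= ?mulr0 // mulN1r.
rewrite mulNr oppr_le0 => H1 H2.
have /eqP : phi (D ('d F w h)) / a0 = 0 by apply/le_anti/andP.
by rewrite mulf_eq0 invr_eq0 (negPf a00) orbF => /eqP.
Qed.

End TangentPlane.

(* Every [z] away from [x0] forces the tangent plane at [xi^1 x0] to be
   [xi^2 x0 + xi^1 z]; two different [z] give a contradiction. *)
Lemma curve_not_C1 x0 : ~ C1_point (dOmega xi) (xk 1 x0).
Proof.
move=> [g0 [q [g0U pq [U [V [F [[oU Uq] oV C1F Finj [_ FV _]]]]]]]].
have dq : dOmega xi (affine_chart g0 q).
  rewrite -pq; exists x0 => //; split; first exact: (@dim_curve _ _ _ xiF 1 x0 isT).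
  exact: curve_sub12.
have [w Vw Fw] : exists2 w, V w & F w = q.
  by have : (F @` V) q; [rewrite FV|move=> [w ? ?]; exists w].
have [dF _] := C1F w Vw.
have VM w' : V w' -> dOmega xi (affine_chart g0 (F w')).
  by move=> Vw'; have : (F @` V) (F w'); [exists w'|rewrite FV => -[]].
have [c0 [t0 [_ ct0 cn0 _ _]]] := circle_chart circleB x0.
pose z1 := c0 0; pose z2 := c0 1.
have z12 : z1 != z2 by rewrite (inj_eq (can_inj ct0)) eq_sym oner_eq0.
pose e1 : 'cV[R]_2 := vec2 1 0; pose e2 : 'cV[R]_2 := vec2 0 1.
pose d1 := 'd F w e1; pose d2 := 'd F w e2.
(* Its span is the linear hyperplane over the tangent plane of the surface at [q]; injectivity of
   the differential gives it dimension 3. *)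
pose K := vecs 3 [:: g0 *m aff q; g0 *m vec0 d1; g0 *m vec0 d2].
have dimK : \dim (colspan K) = 3%N.
  apply/dim_colspan => y; rewrite vecs_mul !big_ord_recl big_ord0 addr0 /=.
  rewrite !scalemxAr -!mulmxDr => /(congr1 (mulmx (invmx g0))).
  rewrite mulKmx // mulmx0; set a := y ord0 0; set b := y _ 0; set b' := y _ 0.
  move=> /colP E; have := E 0; rewrite !mxE /= !mulr0 !addr0 mulr1 => a0.
  have : b *: d1 + b' *: d2 = 0.
    apply/colP => i; have := E (lift 0 i); rewrite a0 scale0r add0r !mxE /= => Ei.
    rewrite -[RHS]Ei [d1]vec3_eta [d2]vec3_eta !mxE.
    by case: i {Ei} => -[|[|[|//]]] i.
  move=> E'; have /(Finj w Vw) /colP H : 'd F w (b *: e1 + b' *: e2) = 'd F w 0.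
    by rewrite linearD !linearZ linear0; exact: E'.
  have := H 0; have := H 1; rewrite !mxE /= !mulr0 !mulr1 addr0 add0r => b'0 b0.
  apply/colP => j; rewrite [RHS]mxE; case: j => -[|[|[|//]]] j.
  - by rewrite -[RHS]a0 /a; congr (y _ _); exact: val_inj.
  - by rewrite -[RHS]b0 /b; congr (y _ _); exact: val_inj.
  - by rewrite -[RHS]b'0 /b'; congr (y _ _); exact: val_inj.
have kills z : z != x0 -> exists (M : 'M[R]_4) (c : R -> B) (t : B -> R)
    (X f g m n G : R -> R),
    [/\ adapted xi M z, param_chart z c t, normal_chart xi M c X f g m n G,
      frenet_chart X f g m n G & forall u, u \in colspan K ->
      lin4 (m (t x0) * X (t x0) - f (t x0)) (- m (t x0)) 1 0 (M *m u) = 0].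
  move=> zx; have [M0 M0z] := adapted_ex xiF z.
  have [M [c [t [X [f [g [m [n [G [Mz _ pc nc C]]]]]]]]]] := frame_chart xiF circleB M0z.
  exists M, c, t, X, f, g, m, n, G; split => // u.
  have cs : c (t x0) = x0 by case: pc => _ _ _ + _; apply; rewrite eq_sym.
  have pq' : xk 1 (c (t x0)) = affine_chart g0 q by rewrite cs.
  have [a0 _ WE] := cusp_base Mz nc g0U pq'.
  have T h := cusp_tangent Mz pc nc C g0U pq' oV Vw Fw dF VM h.
  move=> /mem_colspan[y ->]; rewrite vecs_mul !big_ord_recl big_ord0 addr0 /=.
  rewrite addrA !mulmxDr -!scalemxAr !lin4D lin4Z WE !T lin4Z lin4_vec4; ring.
have [M1 [c1 [t1 [X1 [f1 [g1 [m1 [n1 [G1 [M1z _ _ _ K1]]]]]]]]]] := kills z1 (cn0 0).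
have [M2 [c2 [t2 [X2 [f2 [g2 [m2 [n2 [G2 [M2z pc2 nc2 C2 K2]]]]]]]]]] := kills z2 (cn0 1).
have [_ ct2 _ tc2 _] := pc2; have [M2U _] := M2z; have [M1U _] := M1z.
have [e ez en] : exists2 u, u \in xk 1 z1 & u \notin (0%VS : Gr).
  by apply: exists_notin; rewrite (dim_curve xiF) // dimv0.
have cr : c2 (t2 z1) = z1 by exact: tc2.
have cs : c2 (t2 x0) = x0 by apply: tc2; rewrite eq_sym; exact: cn0.
(* In coordinates adapted to [z2], the form killing [K] is non-zero at [xi^1 z1], because (X, f) is
   strictly above its tangent line at [x0]. *)
have eK : e \notin colspan K.
  apply/negP => /K2; have e1z : e \in xk 1 (c2 (t2 z1)) by rewrite cr.
  have E := chart_point xiF M2z nc2 e1z; rewrite E lin4Z lin4_vec4.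
  have rs : t2 x0 != t2 z1.
    by apply/eqP => E'; have := cn0 0; rewrite -/z1 -cr -E' cs eqxx.
  have lt := chart_above_tangent C2 rs.
  move=> /eqP; rewrite mulf_eq0 => /orP[/eqP a0|/eqP H]; last first.
    by have : 0 < (0 : R); [move: lt; rewrite -subr_gt0 -{2}H => lt; lra|rewrite ltxx].
  case/negP: en; rewrite memv0 -(mulKmx M2U e) E a0 scale0r mulmx0.
  exact: eqxx.
(* The form attached to [z1] kills both [K] and [xi^1 z1], which span R^4, although its third
   coefficient is 1. *)
have [|_ _ /eqP] := annihilator4 xiF (M := M1) (s := [:: (4%N, z1)])
  (p0 := m1 (t1 x0) * X1 (t1 x0) - f1 (t1 x0)) (p1 := - m1 (t1 x0)) (p2 := 1) (p3 := 0)
  M1U isT isT erefl; last by rewrite oner_eq0.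
move=> p u _ _.
have [a] : exists a, u - a *: e \in (colspan K : Gr).
  apply: (@mem_extend _ (fullv : Gr)) => //; rewrite ?memvf ?subvf //.
  by rewrite dim_fullv4 dimK.
move=> /K1; rewrite mulmxBr -scalemxAr -scaleNr lin4D.
have [_ _ H] := kill_base xiF M1z (m1 (t1 x0) * X1 (t1 x0) - f1 (t1 x0)) (- m1 (t1 x0)) 1 0 e.
by rewrite (H ez erefl) mulr0 addr0.
Qed.

End CuspidalEdge.

Theorem propositionC (R : realType)
    (S : topologicalType) (genus : nat)
    (hgenus : (2 <= genus)%N)
    (hS : closed_oriented_surface (R := R) genus S)
    (s0 : S) (Gamma : fgGroup)
    (hGamma : is_fundamental_group (R := R) s0 Gamma)
    (hcircle : is_topological_circle (R := R) (gromov_boundary Gamma))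
    (rho : Gamma -> set 'M[R]_4)
    (hrho : hitchin rho)
    (xi : gromov_boundary Gamma ->
          grassmannian R 4 * grassmannian R 4 * grassmannian R 4)
    (hxi : is_limit_map rho xi) :
  (forall p, dOmega xi p ->
     (C1_point (dOmega xi) p <-> ~ range (curve_part xi 1) p)) /\
  (forall p, dOmega xi p -> ~ range (curve_part xi 1) p ->
     exists N D : set (grassmannian R 4),
       [/\ nbhs p N, domain D, properly_convex D &
           dOmega xi `&` N `<=` boundary D]).
Proof.
have [_ xiF] := hxi.
have flat p : dOmega xi p -> ~ range (curve_part xi 1) p ->
    exists z M c t X f g m n G s v, sheet_frame xi p z M c t X f g m n G s v.
  move=> [x _ [p1 px]] np; apply: (sheet_frame_ex xiF hcircle p1 px).
  by apply/eqP => px1; apply: np; exists x.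
split=> p dp.
  split=> [Cp [x _ xp]|/(flat p dp)].
    by rewrite -xp in Cp; exact: (curve_not_C1 xiF hcircle Cp).
  move=> [z [M [c [t [X [f [g [m [n [G [s [v sf]]]]]]]]]]]].
  exact: (sheet_C1_point xiF hcircle sf).
move=> /(flat p dp)[z [M [c [t [X [f [g [m [n [G [s [v sf]]]]]]]]]]]].
exact: (sheet_convex xiF hcircle sf).
Qed.
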